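(* Let $-\infty<a<b<+\infty$, $T>0$, $\Omega=(a,b)\times(0,T]$, $\alpha\in(0,1]$, $0<\beta_1,\beta_2\leq 1$ with $1<\beta_1+\beta_2\leq 2$, $\nu>0$, let $\varphi$ be continuous on $[a,b]$ and let $F(x,t,u)$ be continuous and nonincreasing with respect to $u$. Then the problem $$\mathcal{D}_{0+,t}^{\alpha}u(x,t)=\nu\mathcal{D}_{a+,x}^{\beta_1}\mathcal{D}_{a+,x}^{\beta_2}u(x,t)+F(x,t,u(x,t)),\ (x,t)\in\Omega,\qquad u(x,0)=\varphi(x),\ x\in[a,b],\qquad u(a,t)=u(b,t)=0,\ t\in[0,T],$$ admits at most one solution $u$ (in the class $u\in C([a,b]\times[0,T])$ with $\mathcal{D}_{0+,t}^{\alpha}u,\ \mathcal{D}_{a+,x}^{\beta_1}\mathcal{D}_{a+,x}^{\beta_2}u\in C([a,b]\times[0,T])$).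
   Context: For $0<\gamma<1$, the Caputo derivative in a variable $s$ starting at $s_0$ is $\mathcal{D}^\gamma_{s_0+,s}g(s)=\frac{\partial}{\partial s}\frac{1}{\Gamma(1-\gamma)}\int_{s_0}^s (s-\tau)^{-\gamma}(g(\tau)-g(s_0))\,d\tau$; for $\gamma=1$ it is the ordinary partial derivative. $\mathcal{D}_{a+,x}^{\beta_1}\mathcal{D}_{a+,x}^{\beta_2}u$ means $\mathcal{D}_{a+,x}^{\beta_1}$ applied to $\mathcal{D}_{a+,x}^{\beta_2}u$. *)

(* Defs.v *)
From HB Require Import structures.
From mathcomp Require Import all_boot all_order all_algebra.
From mathcomp Require Import all_classical all_reals all_analysis.
Set Implicit Arguments. Unset Strict Implicit. Unset Printing Implicit Defensive.
Import Order.TTheory GRing.Theory Num.Theory.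
Import numFieldNormedType.Exports.
Local Open Scope classical_set_scope.
Local Open Scope ring_scope.

Section Defs.
Variable R : realType.

Definition Gamma (z : R) : R :=
  \int[lebesgue_measure]_(t in `]0%R, +oo[) (t `^ (z - 1) * expR (- t)).

Definition caputo_integrand (gam s0 s : R) (g : R -> R) (tau : R) : R :=
  (s - tau) `^ (- gam) * (g tau - g s0).

Definition caputo_int (gam s0 : R) (g : R -> R) (s : R) : R :=
  (Gamma (1 - gam))^-1 *
    \int[lebesgue_measure]_(tau in `[s0, s]) caputo_integrand gam s0 s g tau.

Definition has_deriv_within (A : set R) (f : R -> R) (s v : R) : Prop :=
  (fun h : R => h^-1 * (f (s + h) - f s))
    @ within (fun h : R => h != 0 /\ A (s + h)) (nbhs (0 : R)) --> v.

Definition is_caputo (gam s0 s1 : R) (g : R -> R) (s v : R) : Prop :=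
  if gam == 1 then has_deriv_within `[s0, s1] g s v
  else (forall s', s0 <= s' <= s1 ->
          lebesgue_measure.-integrable `[s0, s']
            (EFin \o caputo_integrand gam s0 s' g)) /\
       has_deriv_within `[s0, s1] (caputo_int gam s0 g) s v.

Definition rect (a b T : R) : set (R * R) :=
  [set p | a <= p.1 <= b /\ 0 <= p.2 <= T].

Definition is_solution (a b T alpha beta1 beta2 nu : R) (phi : R -> R)
    (F : R -> R -> R -> R) (u : R -> R -> R) : Prop :=
  {within rect a b T, continuous (fun p : R * R => u p.1 p.2)} /\
  exists (Dt Dx2 Dxx : R -> R -> R),
    (forall x t, rect a b T (x, t) -> is_caputo alpha 0 T (fun s => u x s) t (Dt x t)) /\
    {within rect a b T, continuous (fun p : R * R => Dt p.1 p.2)} /\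
    (forall x t, rect a b T (x, t) -> is_caputo beta2 a b (fun y => u y t) x (Dx2 x t)) /\
    (forall x t, rect a b T (x, t) -> is_caputo beta1 a b (fun y => Dx2 y t) x (Dxx x t)) /\
    {within rect a b T, continuous (fun p : R * R => Dxx p.1 p.2)} /\
    (forall x t, a < x < b -> 0 < t <= T ->
       Dt x t = nu * Dxx x t + F x t (u x t)) /\
    (forall x, a <= x <= b -> u x 0 = phi x) /\
    (forall t, 0 <= t <= T -> u a t = 0 /\ u b t = 0).

End Defs.

(* Main.v *)
(* For [be1 < 1] the operator [D^be1 D^be2] has no maximum principle in the sup
   norm, so the uniqueness rests on accretivity in another norm.  Let [w] be the
   difference of two solutions.  Inverting the Caputo derivatives expresses [w]
   as a fractional integral of [D_t w] in time and as an iterated fractional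
   integral of [D_xx w] in space.  On a grid these integrals become
   convolutions with the coefficients of [(1 - z)^(- s)], and the discrete
   analogue of [- D^be1 D^be2] is accretive for the norm [N] that measures
   [u] by the least total mass of some [mu >= 0] such that the convolution of
   [mu] with [(1 - z)^(be1 - 1)] dominates [u] (plus the same quantity for
   [- u]).  As [F] is nonincreasing in [u], this gives, up to a small error,
   [N (w t) <= N (w t - lam * D_t w t)].
   In time, truncating the series [(1 - z)^(- al)] at [m] terms yields
   [p >= 0] of total mass at most 1, supported on [j >= m], such that
   [w_k - lam * D_t w_k] is close to [sum_j p_j w_(k - j)]; a comparison
   argument then makes [N (w_k) / N 1] arbitrarily small, which forces [w] to
   vanish since [N u / N 1] controls the mean values of [u] on intervals. *)

Require Import Defs.
From HB Require Import structures.
From mathcomp Require Import all_boot all_order all_algebra.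
From mathcomp Require Import ring lra.
From mathcomp Require Import all_classical all_reals all_analysis measurable_realfun.
Set Implicit Arguments. Unset Strict Implicit. Unset Printing Implicit Defensive.
Import Order.TTheory GRing.Theory Num.Theory.
Import numFieldNormedType.Exports.
Local Open Scope classical_set_scope.
Local Open Scope ring_scope.

(** * Convolutions and the coefficients of (1 - z)^(- s) *)

(** The obstacle is a boundary term. With [gam = be1 + be2], the series [(1 - z)^gam] shifted one
    place to the left has nonnegative off-diagonal coefficients and creates no mass, like the
    generator of a sub-Markov chain. But the sequential Caputo operator also annihilates
    [(x - a)^be2], so on the grid one must subtract [w 1] times the coefficients of
    [(1 - z)^(be1 - 1)]; for [be1 < 1] this term has the wrong sign for a comparison of values. Read
    as a convolution with those same coefficients it is a point mass at the origin, so majorizing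
    measures are required to vanish there and the term acts as absorption. For [be1 = 1] the norm is
    the plain l^1 norm. The price is a norm with no uniform equivalence to a mean value: [N 1] is of
    order [n^be1], and an l^1 sum is bounded by [N] only up to a factor of order [n^(1 - be1)]. The
    product of the two being of order [n] is what lets [N u / N 1] see averages. The parameters are
    fixed in the order window length, time step, space grid: the errors of one step must be small
    compared with [lam], which depends on the window. *)

Section cauchy_product.
Context {R : realFieldType}.
Implicit Types u v w : nat -> R.

Definition convn u v (n : nat) : R := \sum_(j < n.+1) u j * v (n - j)%N.

(** Up to index [n] a Cauchy product is a product of truncated polynomials, so commutativity and
    associativity are inherited from the polynomial ring. *)
Lemma convn_coef u v (n k : nat) : (k <= n)%N ->
  convn u v k = ((\poly_(i < n.+1) u i) * (\poly_(i < n.+1) v i))`_k.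
Proof.
move=> kn; rewrite coefM; apply: eq_bigr => j _.
rewrite !coef_poly !ltnS (leq_trans (leq_subr _ _) kn).
by rewrite (leq_trans _ kn)// -ltnS.
Qed.

Lemma convnC u v n : convn u v n = convn v u n.
Proof. by rewrite !(convn_coef _ _ (leqnn n)) mulrC. Qed.

Lemma convnA u v w n : convn u (convn v w) n = convn (convn u v) w n.
Proof.
pose P (x : nat -> R) := \poly_(i < n.+1) x i.
have convnP x y (z : {poly R}) : (forall k, (k <= n)%N -> x k = z`_k) ->
    convn x y n = (z * P y)`_n.
  move=> h; rewrite coefM; apply: eq_bigr => j _.
  by rewrite h ?coef_poly ?ltnS ?leq_subr// -ltnS.
rewrite convnC (@convnP _ _ (P v * P w)); last by move=> k; exact: convn_coef.
rewrite (@convnP _ _ (P u * P v)); last by move=> k; exact: convn_coef.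
by congr (_`_n); rewrite mulrC mulrA.
Qed.

Lemma eq_convn u u' v v' n : (forall k, (k <= n)%N -> u k = u' k) ->
  (forall k, (k <= n)%N -> v k = v' k) -> convn u v n = convn u' v' n.
Proof.
by move=> hu hv; apply: eq_bigr => j _; rewrite hu ?hv ?leq_subr// -ltnS.
Qed.

Lemma convnDr u v w n : convn u (fun k => v k + w k) n = convn u v n + convn u w n.
Proof. by rewrite -big_split; apply: eq_bigr => j _; rewrite mulrDr. Qed.

Lemma convnDl u v w n : convn (fun k => v k + w k) u n = convn v u n + convn w u n.
Proof. by rewrite convnC convnDr !(convnC u). Qed.

Lemma convnZr (a : R) u v n : convn u (fun k => a * v k) n = a * convn u v n.
Proof. by rewrite mulr_sumr; apply: eq_bigr => j _; rewrite mulrCA. Qed.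

Lemma ler_convn u v w n : (forall k, (k <= n)%N -> 0 <= u k) ->
  (forall k, (k <= n)%N -> v k <= w k) -> convn u v n <= convn u w n.
Proof.
move=> hu hv; apply: ler_sum => j _; apply: ler_wpM2l.
  by apply: hu; rewrite -ltnS.
by apply: hv; rewrite leq_subr.
Qed.

Lemma convn_ge0 u v n : (forall k, (k <= n)%N -> 0 <= u k) ->
  (forall k, (k <= n)%N -> 0 <= v k) -> 0 <= convn u v n.
Proof.
move=> hu hv; apply: sumr_ge0 => j _; apply: mulr_ge0.
  by apply: hu; rewrite -ltnS.
by apply: hv; rewrite leq_subr.
Qed.

Lemma convn_shift u v n : v 0 = 0 ->
  convn u v n.+1 = convn u (fun k => v k.+1) n.
Proof.
move=> v0; rewrite convnC /convn big_ord_recl/= v0 mul0r add0r.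
rewrite -[RHS]/(convn u (fun k => v k.+1) n) convnC.
by apply: eq_bigr => j _; rewrite subSS.
Qed.

Lemma convn1 u n : convn u (fun=> 1) n = \sum_(j < n.+1) u j.
Proof. by apply: eq_bigr => j _; rewrite mulr1. Qed.

Lemma convn_delta u n : convn (fun k => (k == 0)%:R) u n = u n.
Proof.
rewrite /convn big_ord_recl/= mul1r subn0 big1 ?addr0// => i _.
by rewrite mul0r.
Qed.

End cauchy_product.

Section binomial_series.
Context {R : realFieldType}.
Implicit Types s t : R.

(* The coefficients of the power series [(1 - z)^(- s)]. *)
Definition bcoef s (k : nat) : R := \prod_(j < k) ((s + j%:R) / j.+1%:R).

Lemma bcoef0 s : bcoef s 0 = 1.
Proof. by rewrite /bcoef big_ord0. Qed.

Lemma bcoefS s k : bcoef s k.+1 = bcoef s k * ((s + k%:R) / k.+1%:R).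
Proof. by rewrite /bcoef big_ord_recr. Qed.

Lemma bcoefSM s k : k.+1%:R * bcoef s k.+1 = (s + k%:R) * bcoef s k.
Proof.
rewrite bcoefS mulrCA (mulrC k.+1%:R) divfK ?pnatr_eq0// mulrC//.
Qed.

Lemma bcoef1 s : bcoef s 1 = s.
Proof. by rewrite bcoefS bcoef0 mul1r addr0 divr1. Qed.

(** The recurrence [bcoefSM] is the differential equation [(1 - z) f' = s f] of [(1 - z)^(- s)]; the
    induction step is the Leibniz rule for a product of two such series. *)
Lemma convn_bcoef s t n : convn (bcoef s) (bcoef t) n = bcoef (s + t) n.
Proof.
elim: n => [|n IH]; first by rewrite /convn big_ord1 !bcoef0 mulr1.
have n0 : n.+1%:R != 0 :> R by rewrite pnatr_eq0.
apply: (mulfI n0); rewrite bcoefSM -IH.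
have -> : n.+1%:R * convn (bcoef s) (bcoef t) n.+1 =
    \sum_(j < n.+2) (j%:R * bcoef s j) * bcoef t (n.+1 - j)%N +
    \sum_(j < n.+2) bcoef s j * ((n.+1 - j)%:R * bcoef t (n.+1 - j)%N).
  rewrite -big_split mulr_sumr; apply: eq_bigr => j _ /=.
  have jn : (j <= n.+1)%N by rewrite -ltnS.
  have -> : n.+1%:R = j%:R + (n.+1 - j)%:R :> R by rewrite -natrD subnKC.
  ring.
rewrite big_ord_recl/= !mul0r add0r.
rewrite [X in _ + X]big_ord_recr/= subnn mul0r mulr0 addr0.
rewrite -big_split/= mulr_sumr; apply: eq_bigr => j _.
have jn : (j <= n)%N by rewrite -ltnS.
rewrite bcoefSM subSS (subSn jn) bcoefSM.
have -> : n%:R = j%:R + (n - j)%:R :> R by rewrite -natrD subnKC.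
ring.
Qed.

Lemma bcoef_one k : bcoef 1 k = 1.
Proof.
elim: k => [|k IH]; first by rewrite bcoef0.
by rewrite bcoefS IH mul1r addrC natr1 divff// pnatr_eq0.
Qed.

Lemma bcoef_zero k : bcoef 0 k = (k == 0)%:R.
Proof.
elim: k => [|k IH]; first by rewrite bcoef0.
by rewrite bcoefS IH add0r; case: k {IH} => [|k]; rewrite /= ?mul0r ?mulr0.
Qed.

Lemma sum_bcoef s n : \sum_(j < n.+1) bcoef s j = bcoef (1 + s) n.
Proof.
rewrite addrC -convn_bcoef -convn1; apply: eq_bigr => j _; by rewrite bcoef_one.
Qed.

Lemma bcoef_ge0 s k : 0 <= s -> 0 <= bcoef s k.
Proof.
move=> s0; apply: prodr_ge0 => j _.
by rewrite divr_ge0 ?addr_ge0 ?ler0n.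
Qed.

Lemma bcoef_gt0 s k : 0 < s -> 0 < bcoef s k.
Proof.
move=> s0; apply: prodr_gt0 => j _.
by rewrite divr_gt0 ?ltr_wpDr ?ltr0n ?ler0n.
Qed.

Lemma bcoef_nincr s k : 0 <= s <= 1 -> bcoef s k.+1 <= bcoef s k.
Proof.
move=> /andP[s0 s1]; rewrite bcoefS ler_piMr ?bcoef_ge0//.
by rewrite ler_pdivrMr ?ltr0n// mul1r -natr1 addrC lerD2l.
Qed.

Lemma bcoef_nincreasing s i j : 0 <= s <= 1 -> (i <= j)%N -> bcoef s j <= bcoef s i.
Proof.
move=> s01; elim: j => [|j IH]; first by rewrite leqn0 => /eqP->.
rewrite leq_eqVlt => /predU1P[->//|]; rewrite ltnS => /IH.
exact/le_trans/bcoef_nincr.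
Qed.

Lemma bcoef_ndecr s k : 1 <= s -> bcoef s k <= bcoef s k.+1.
Proof.
move=> s1; rewrite bcoefS ler_peMr ?bcoef_ge0 ?(le_trans _ s1)//.
by rewrite ler_pdivlMr ?ltr0n// mul1r -natr1 addrC lerD2r.
Qed.

Lemma bcoef_ndecreasing s i j : 1 <= s -> (i <= j)%N -> bcoef s i <= bcoef s j.
Proof.
move=> s01; elim: j => [|j IH]; first by rewrite leqn0 => /eqP->.
rewrite leq_eqVlt => /predU1P[->//|]; rewrite ltnS => /IH h.
exact: le_trans h (bcoef_ndecr j s01).
Qed.

Lemma bcoef_neg s k : -1 <= s <= 0 -> bcoef s k.+1 <= 0.
Proof.
move=> /andP[s1 s0]; elim: k => [|k IH]; first by rewrite bcoef1.
rewrite bcoefS mulr_le0_ge0// divr_ge0//.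
by rewrite -natr1; have := ler0n R k; lra.
Qed.

Lemma bcoef_neg2 s k : -2 <= s <= -1 -> 0 <= bcoef s k.+2.
Proof.
move=> /andP[s1 s0]; elim: k => [|k IH].
  rewrite bcoefS bcoef1 mulr_le0//; first lra.
  by rewrite mulr_le0_ge0// ?invr_ge0; lra.
rewrite bcoefS mulr_ge0// divr_ge0//.
by rewrite -!natr1; have := ler0n R k; lra.
Qed.

End binomial_series.

(** * Growth of the coefficients *)

Section bcoef_asymptotics.
Context {R : realType}.

(** Bernoulli's inequality for a concave power, from Young's inequality applied to [y^s] and 1 with
    the exponents [1/s] and [1/(1 - s)]. *)
Lemma powR_le_affine (y s : R) : 0 < s <= 1 -> 0 <= y ->
  y `^ s <= 1 + s * (y - 1).
Proof.
move=> /andP[s0]; rewrite le_eqVlt => /predU1P[-> y0|s1 y0].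
  by rewrite powRr1//; lra.
have s'0 : 0 < 1 - s by lra.
have := @conjugate_powR R (y `^ s) 1 s^-1 (1 - s)^-1.
rewrite powR_ge0 ler01 !invr_gt0 !invrK -powRrM mulfV ?gt_eqF// powRr1// powR1.
rewrite mulr1 => /(_ isT isT s0 s'0); rewrite addrCA subrr addr0 => /(_ erefl).
by move=> h; apply: (le_trans h); lra.
Qed.

(** The quotients [lo] by [k.+1^s] increase, the quotients [up] decrease, and [lo j <= up k] for all
    indices, so the supremum of [lo] separates them and serves as [C]. Both monotonicities are
    Bernoulli's inequality. *)
Lemma bcoef_sandwich (s : R) : 0 < s <= 1 ->
  exists2 C, 0 < C & forall k, C * k%:R `^ s <= bcoef (1 + s) k <= C * k.+1%:R `^ s.
Proof.
move=> s01; have /andP[s0 s1] := s01.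
have s1' : 0 < 1 + s by lra.
pose lo k := bcoef (1 + s) k / k.+1%:R `^ s.
pose up k := bcoef (1 + s) k.+1 / k.+1%:R `^ s.
have p0 k : 0 < k.+1%:R `^ s :> R by rewrite powR_gt0.
have n0 k : k.+1%:R != 0 :> R by rewrite pnatr_eq0.
have bcoefE k : bcoef (1 + s) k.+1 = bcoef (1 + s) k * (1 + s / k.+1%:R).
  have e : 1 + s + k%:R = k.+1%:R + s :> R by rewrite -natr1; ring.
  by rewrite bcoefS e mulrDl divff.
have lo_ndecr : nondecreasing_seq lo.
  apply/nondecreasing_seqP => k; rewrite /lo ler_pdivrMr// mulrAC ler_pdivlMr//.
  rewrite bcoefE -mulrA ler_pM2l ?bcoef_gt0//.
  have -> : k.+2%:R = k.+1%:R * (1 + k.+1%:R^-1) :> R.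
    by rewrite mulrDr mulr1 divff// natr1.
  have y0 : 0 <= 1 + k.+1%:R^-1 :> R by rewrite addr_ge0 ?invr_ge0.
  rewrite powRM ?ler0n// mulrC ler_pM2r//.
  by apply: (le_trans (powR_le_affine s01 y0)); rewrite addrAC subrr add0r.
have up_nincr : nonincreasing_seq up.
  apply/nonincreasing_seqP => k; rewrite /up ler_pdivrMr// mulrAC ler_pdivlMr//.
  rewrite (bcoefE k.+1) -mulrA ler_pM2l ?bcoef_gt0//.
  have -> : k.+1%:R = k.+2%:R * (1 - k.+2%:R^-1) :> R.
    by rewrite mulrBr mulr1 divff// -[k.+2%:R]natr1 addrK.
  have y0 : 0 <= 1 - k.+2%:R^-1 :> R.
    by rewrite subr_ge0 invf_le1// ler1n.
  rewrite powRM ?ler0n// mulrCA ler_piMr ?powR_ge0//.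
  have := powR_le_affine s01 y0; rewrite addrAC subrr add0r mulrN => h.
  have u0 : 0 <= s / k.+2%:R by rewrite divr_ge0 ?ler0n// ltW.
  apply: (@le_trans _ _ ((1 + s / k.+2%:R) * (1 - s / k.+2%:R))).
    by rewrite ler_wpM2l// addr_ge0.
  by move: (s / _) u0 => {h} x x0; nra.
have loup j k : lo j <= up k.
  apply: (@le_trans _ _ (lo (maxn j k))); first by rewrite lo_ndecr// leq_maxl.
  apply: (@le_trans _ _ (up (maxn j k))); last by rewrite up_nincr// leq_maxr.
  by rewrite /lo /up ler_pM2r ?invr_gt0// bcoef_ndecr// lerDl ltW.
have lo_sup : has_sup (range lo).
  by split; [exists (lo 0); exists 0 | exists (up 0) => _ [j _ <-]].
exists (sup (range lo)).
  apply: (@lt_le_trans _ _ (lo 0)); last by apply: ub_le_sup; [case: lo_sup|exists 0].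
  by rewrite /lo bcoef0 powR1 divr1.
move=> k; apply/andP; split; last first.
  by rewrite -ler_pdivrMr//; apply: ub_le_sup; [case: lo_sup|exists k].
case: k => [|k]; first by rewrite powR0 ?gt_eqF// mulr0 bcoef0.
rewrite -ler_pdivlMr//; apply: ge_sup; first by case: lo_sup.
by move=> _ [j _ <-]; exact: loup.
Qed.

End bcoef_asymptotics.

(** * A norm between l^1 and l^oo *)

Section mass.
Context {R : realType}.
Variables (b : nat -> R) (n : nat).
Hypotheses (b0 : b 0 = 1) (b_ge0 : forall k, 0 <= b k).
Implicit Types (u v mu : nat -> R) (M c : R).

(** One-sided cost of [u] at the interior nodes, the end nodes carrying Dirichlet data. The
    condition [mu 0 = 0] bars mass at the origin, whose convolution with [b] would be [b] itself,
    the profile of the boundary term. *)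
Definition majorized u M : Prop := exists mu : nat -> R,
  [/\ forall k, 0 <= mu k, mu 0 = 0,
      forall i, (0 < i < n)%N -> u i <= convn b mu i
    & \sum_(1 <= j < n) mu j <= M].

Definition mass u : R := inf [set M | majorized u M].

Lemma majorized_ge0 u M : majorized u M -> 0 <= M.
Proof.
move=> [mu [mu0 _ _]]; apply: le_trans; exact: sumr_ge0.
Qed.

Lemma majorized_has_lbound u : has_lbound [set M | majorized u M].
Proof. by exists 0 => M; exact: majorized_ge0. Qed.

Lemma majorized_const u mu c : 0 <= c -> (forall k, 0 <= mu k) -> mu 0 = 0 ->
  (forall i, (0 < i < n)%N -> 1 <= convn b mu i) ->
  (forall i, (0 < i < n)%N -> u i <= c) ->
  majorized u (c * \sum_(1 <= j < n) mu j).
Proof.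
move=> c0 mu0 mu00 hmu uc; exists (fun k => c * mu k); split.
- by move=> k; rewrite mulr_ge0.
- by rewrite mu00 mulr0.
- move=> i hi; rewrite convnZr (le_trans (uc _ hi))// ler_peMr//; exact: hmu.
- by rewrite mulr_sumr.
Qed.

Lemma majorized_nonempty u : [set M | majorized u M] !=set0.
Proof.
pose c := \sum_(j < n) `|u j|.
(* Unit masses off the origin majorize 1, because [b 0 = 1] and [b] is nonnegative. *)
exists (c * \sum_(1 <= j < n) (fun k => (k != 0)%:R) j).
apply: majorized_const => //.
- by rewrite sumr_ge0.
- move=> i /andP[i0 _]; rewrite /convn big_ord_recl/= subn0 b0 mul1r.
  by rewrite -lt0n i0 lerDl sumr_ge0// => j _; rewrite mulr_ge0.
- move=> i /andP[_ i_n]; apply: (le_trans (ler_norm _)).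
  by rewrite /c (bigD1 (Ordinal i_n))//= lerDl sumr_ge0.
Qed.

Lemma mass_le u M : majorized u M -> mass u <= M.
Proof. by move=> h; apply: ge_inf => //; exact: majorized_has_lbound. Qed.

Lemma le_mass u M : (forall M', majorized u M' -> M <= M') -> M <= mass u.
Proof. by move=> h; apply: lb_le_inf => //; exact: majorized_nonempty. Qed.

Lemma mass_ge0 u : 0 <= mass u.
Proof. by apply: le_mass => M; exact: majorized_ge0. Qed.

Lemma massD u v : mass (fun k => u k + v k) <= mass u + mass v.
Proof.
rewrite -lerBlDr; apply: le_mass => M1 [m1 [m10 m100 h1 s1]].
rewrite lerBlDr -lerBlDl; apply: le_mass => M2 [m2 [m20 m200 h2 s2]].
rewrite lerBlDl; apply: mass_le; exists (fun k => m1 k + m2 k); split.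
- by move=> k; rewrite addr_ge0.
- by rewrite m100 m200 addr0.
- by move=> i hi; rewrite convnDr lerD ?h1 ?h2.
- by rewrite big_split/= lerD.
Qed.

Lemma massZ c u : 0 <= c -> mass (fun k => c * u k) <= c * mass u.
Proof.
rewrite le_eqVlt => /predU1P[<-|c0].
  rewrite mul0r; apply: mass_le; exists (fun=> 0); split => //.
    by move=> i _; rewrite mul0r convn_ge0.
  by rewrite big1.
rewrite -ler_pdivrMl//; apply: le_mass => M [m [m0 m00 h s]].
rewrite ler_pdivrMl//; apply: mass_le; exists (fun k => c * m k); split.
- by move=> k; rewrite mulr_ge0// ltW.
- by rewrite m00 mulr0.
- by move=> i hi; rewrite convnZr ler_pM2l// h.
- by rewrite -mulr_sumr ler_pM2l.
Qed.

Lemma mass_sum (I : Type) (s : seq I) (c : I -> R) (u : I -> nat -> R) :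
  (forall i, 0 <= c i) ->
  mass (fun k => \sum_(i <- s) c i * u i k) <= \sum_(i <- s) c i * mass (u i).
Proof.
move=> c0; elim: s => [|i s IH].
  rewrite big_nil; apply: mass_le; exists (fun=> 0); split => //.
    by move=> k _; rewrite big_nil convn_ge0.
  by rewrite big1.
rewrite big_cons (_ : (fun k => _) =
    (fun k => c i * u i k + \sum_(j <- s) c j * u j k)); last first.
  by apply/funext => k; rewrite big_cons.
by rewrite (le_trans (massD _ _))// lerD// massZ.
Qed.

Lemma mass_mono u v : (forall i, (0 < i < n)%N -> u i <= v i) ->
  mass u <= mass v.
Proof.
move=> uv; apply: le_mass => M [m [m0 m00 h s]]; apply: mass_le.
by exists m; split => // i hi; rewrite (le_trans (uv _ hi))// h.
Qed.

(** Convolution with [b] multiplies total mass by at most [B], so the sum of any majorant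
    [convn b m] is at most [B] times the mass of [m]. *)
Lemma mass_lower u (P : pred nat) B : 0 < B -> \sum_(j < n) b j <= B ->
  (forall i, P i -> 0 <= u i) ->
  \sum_(1 <= i < n | P i) u i / B <= mass u.
Proof.
move=> B0 hB hP; apply: le_mass => M [m [m0 m00 h s]].
rewrite -mulr_suml ler_pdivrMr//.
apply: (@le_trans _ _ (\sum_(1 <= i < n) convn b m i)).
  rewrite big_mkcond/= big_nat [leRHS]big_nat; apply: ler_sum => i hi.
  by case: ifP => _; [exact: h|rewrite convn_ge0].
apply: (@le_trans _ _ (\sum_(1 <= j < n) m j * B)); last first.
  by rewrite -mulr_suml ler_pM2r.
rewrite [leLHS](_ : _ = \sum_(1 <= i < n) \sum_(j < n)
    (if (j <= i)%N then m j * b (i - j)%N else 0)); last first.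
  rewrite big_nat [RHS]big_nat; apply: eq_bigr => i /andP[_ hi].
  rewrite convnC /convn -big_mkcond/=.
  by rewrite (big_ord_widen n (fun j => m j * b (i - j)%N)).
rewrite exchange_big/=; case: n hB h s => [|n'] hB h s.
  by rewrite big_ord0 big_geq.
rewrite big_ord_recl [leRHS]big_add1/= big_mkord.
rewrite big1 ?add0r; last by move=> i _; rewrite m00 mul0r.
apply: ler_sum => j _; rewrite -big_mkcond/= -mulr_sumr ler_wpM2l//.
apply: le_trans hB; rewrite /bump leq0n add1n.
rewrite [leLHS](_ : _ = \sum_(j.+1 <= i < n'.+1) b (i - j.+1)%N); last first.
  rewrite (big_cat_nat _ (n := j.+1)) //= ?ltnS//; last exact: ltnW.
  rewrite big_nat_cond big1 ?add0r; last first.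
    by move=> i /andP[/andP[_ +]] ; rewrite ltnNge => /negbTE ->.
  by rewrite big_nat_cond [RHS]big_nat_cond; apply: eq_bigl => i;
    case: (j < i)%N; rewrite ?andbF ?andbT.
rewrite -{1}[j.+1]add0n big_addn.
under eq_bigr do rewrite addnK.
rewrite big_mkord (big_ord_widen n'.+1 b) ?leq_subr//.
rewrite [leRHS](bigID (fun i : 'I_n'.+1 => (i < n'.+1 - j.+1)%N))/=.
by rewrite lerDl sumr_ge0.
Qed.

End mass.

(** * Accretivity of the discrete operator in the one-sided norm *)

Section accretivity.
Context {R : realType}.
Variables (beta gam : R).
Hypotheses (beta01 : 0 < beta <= 1) (gam12 : 1 < gam <= 2).
Implicit Types (u v w mu : nat -> R).

Let b := bcoef (1 - beta).
(** For [1 < gam <= 2] the only negative coefficient of [(1 - z)^gam] is that of [z]. It is taken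
    out here and becomes the diagonal term [- gam * w i] after the left shift. *)
Let q (k : nat) : R := bcoef (- gam) k + gam * (k == 1)%:R.

Let b_ge0 k : 0 <= b k.
Proof. by apply: bcoef_ge0; case/andP: beta01 => _; rewrite subr_ge0. Qed.

Let b0 : b 0 = 1. Proof. exact: bcoef0. Qed.

Let q_ge0 k : 0 <= q k.
Proof.
rewrite /q; case: k => [|[|k]].
- by rewrite bcoef0 mulr0 addr0.
- by rewrite bcoef1 mulr1 addNr.
- rewrite mulr0 addr0 bcoef_neg2//; case/andP: gam12 => ? ?; apply/andP; split; lra.
Qed.

Let cvqE w i : convn q w i.+1 = convn (bcoef (- gam)) w i.+1 + gam * w i.
Proof.
rewrite convnDl; congr (_ + _).
rewrite /convn big_ord_recl/= mulr0 mul0r add0r big_ord_recl/= subSS subn0 mulr1.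
by rewrite big1 ?addr0// => j _; rewrite mulr0 mul0r.
Qed.

(** Up to the added [gam], the partial sums of [q] are the coefficients of [(1 - z)^(gam - 1)],
    nonpositive from index 1 on. Thus the jumps encoded by [q] bring in at most the mass [gam] that
    the diagonal removes. *)
Let convn1q k : convn (fun=> 1) q k <= gam.
Proof.
rewrite convnC convn1 /q big_split/= sum_bcoef -mulr_sumr.
case/andP: gam12 => g1 g2; case: k => [|k].
  by rewrite big_ord1/= bcoef0 mulr0 addr0 ltW.
rewrite 2!big_ord_recl/= big1 ?addr0 ?add0r ?mulr1//.
by rewrite gerDr bcoef_neg//; apply/andP; split; lra.
Qed.

(* Grid analogue of [h^gam D^beta D^(gam - beta)] for [w 0 = 0]; the second term
   removes the homogeneous solution carried by [w 1]. *)
Definition frac_op w (i : nat) : R := convn (bcoef (- gam)) w i.+1 - w 1%N * b i.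

(* The majorant of w is built from those of r and w: the left shift moves the
   mass w 1 to the origin, where the boundary term of frac_op cancels it. *)
Lemma mass_accretive n th w F : (1 < n)%N -> 0 <= th -> w 0 = 0 -> w n = 0 ->
  (forall i, (0 < i < n)%N -> 0 < w i -> F i <= 0) ->
  mass b n w + th * w 1%N <= mass b n (fun i => w i - th * frac_op w i - F i).
Proof.
move=> n1 th0 w0 wn hF; set r := fun i => _.
have {}gam0 : 0 < gam by case/andP: gam12 => /(lt_trans ltr01).
have [the|thn0] := eqVneq th 0.
  rewrite the mul0r addr0; apply: le_mass => // M1 [m1 [m10 m100 h1 s1]].
  apply: mass_le => //; exists m1; split => // i hi.
  have [wi|wi] := ltP 0 (w i); last by rewrite (le_trans wi)// convn_ge0.
  by rewrite (le_trans _ (h1 _ hi))// /r the mul0r subr0 lerDl oppr_ge0 hF.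
have {th0 thn0}th0 : 0 < th by rewrite lt_def thn0.
apply: le_mass => // M1 [m1 [m10 m100 h1 s1]].
have thg : 0 < th * gam by rewrite mulr_gt0.
(* Each admissible mass [M2] for [w] gives [(1 + th * gam) * mass w <= M1 + th * (gam * M2 - w 1)].
   Letting [M2] decrease to [mass w] closes the estimate on itself. *)
suff: ((1 + th * gam) * mass b n w - M1 + th * w 1%N) / (th * gam) <=
    mass b n w by rewrite ler_pdivrMr// => ?; lra.
apply: le_mass => // M2 [m2 [m20 m200 h2 s2]].
(* The left shift reads the measure up to index [n], while [M2] only counts indices below [n]; the
   truncation is harmless since [w n = 0]. *)
pose mu k := if (k < n)%N then m2 k else 0.
have mu0 k : 0 <= mu k by rewrite /mu; case: ifP.
have mu00 : mu 0 = 0 by rewrite /mu m200 if_same.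
have wmu i : (i <= n)%N -> w i <= convn b mu i.
  rewrite leq_eqVlt => /predU1P[->|i_n]; first by rewrite wn convn_ge0.
  have [->|i0] := posnP i; first by rewrite w0 convn_ge0.
  rewrite (@eq_convn _ _ b _ m2)//; first by rewrite h2 ?i0.
  by move=> k ki; rewrite /mu (leq_ltn_trans ki).
pose nu k := convn q mu k.+1.
have nu_ge0 k : 0 <= nu k by exact: convn_ge0.
have nu0 : nu 0 = mu 1%N.
  rewrite /nu /convn !big_ord_recl big_ord0/= mu00 mulr0 !addr0.
  by rewrite /q bcoef0 mulr0 addr0 mul1r.
have qw i : (i < n)%N -> convn q w i.+1 <= convn b nu i.
  move=> i_n; apply: (@le_trans _ _ (convn q (convn b mu) i.+1)).
    by apply: ler_convn => // k ki; rewrite wmu// (leq_trans ki).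
  rewrite convnA (@eq_convn _ (convn q b) (convn b q) mu mu)//; last first.
    by move=> k _; exact: convnC.
  rewrite -convnA convn_shift//.
  by rewrite /convn big_ord1 mu00 mulr0.
have w1mu : w 1%N <= mu 1%N.
  have := wmu 1%N (ltnW n1).
  by rewrite /convn !big_ord_recl big_ord0/= mu00 mulr0 !addr0 b0 mul1r.
have D0 : 0 < 1 + th * gam by rewrite addr_gt0.
pose de (k : nat) : R := (k == 1)%:R.
(* The boundary term cancels only [w 1] of the mass [mu 1] that arrives at the origin. The excess
   [mu 1 - w 1] is put at index 1 instead, which still majorizes because [b] is nonincreasing. *)
pose m (k : nat) := (m1 k + (th * (nu k - nu 0 * (k == 0)%:R) +
             th * (mu 1%N - w 1%N) * de k)) / (1 + th * gam).
have cvm i : (0 < i)%N -> (1 + th * gam) * convn b m i =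
    convn b m1 i + (th * (convn b nu i - mu 1%N * b i) +
      th * (mu 1%N - w 1%N) * b i.-1).
  move=> i0.
  have e1 : convn b (fun k => (k == 0)%:R) i = b i by rewrite convnC convn_delta.
  have e2 : convn b de i = b i.-1.
    case: i i0 {e1} => // i _; rewrite convn_shift// convnC.
    by rewrite (@eq_convn _ _ (fun k => (k == 0)%:R) _ b)// convn_delta.
  rewrite -convnZr (@eq_convn _ b b _ (fun k => m1 k +
      (th * (nu k + - mu 1%N * (k == 0)%:R) + th * (mu 1%N - w 1%N) * de k)))//.
    by rewrite convnDr convnDr !convnZr convnDr convnZr e1 e2 mulNr.
  by move=> k _; rewrite /m [LHS]mulrC (divfK (lt0r_neq0 D0)) nu0 mulNr.
have m_ge0 k : 0 <= m k.
  rewrite divr_ge0 ?(ltW D0)// addr_ge0// addr_ge0//.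
    rewrite mulr_ge0 ?(ltW th0)//; case: k => [|k]; first by rewrite mulr1 subrr.
    by rewrite mulr0 subr0 nu_ge0.
  by rewrite !mulr_ge0 ?ler0n ?subr_ge0 ?(ltW th0).
have musum : \sum_(1 <= k < n) nu k + mu 1%N <= gam * M2.
  have -> : \sum_(1 <= k < n) nu k + mu 1%N = convn (fun=> 1) (convn q mu) n.
    rewrite convnC convn1 big_ord_recl.
    rewrite [X in _ = X + _](_ : _ = 0) ?add0r; last first.
      by rewrite /convn big_ord1/= mu00 mulr0.
    rewrite -nu0 addrC; case: (n) n1 => // n' _.
    by rewrite big_ord_recl big_add1/= big_mkord.
  rewrite convnA; apply: (@le_trans _ _ (convn (fun=> gam) mu n)).
    rewrite [leLHS]convnC [leRHS]convnC; apply: ler_convn => // k _; exact: convn1q.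
  rewrite convnC (_ : (fun=> gam) = (fun=> gam * 1)); last first.
    by apply/funext => ?; rewrite mulr1.
  rewrite (convnZr _ _ (fun=> 1)) convn1 ler_pM2l// big_ord_recr/= {2}/mu ltnn addr0.
  apply: le_trans s2; rewrite -(big_mkord xpredT mu) big_ltn ?(ltnW n1)//.
  rewrite mu00 add0r big_nat [leRHS]big_nat; apply: ler_sum => k /andP[_ kn].
  by rewrite /mu kn.
rewrite ler_pdivrMr//.
have : mass b n w <= (M1 + th * (gam * M2 - w 1%N)) / (1 + th * gam).
  apply: mass_le => //; exists m; split => //.
  - by rewrite /m m100 mulr1 subrr !mulr0 !addr0 mul0r.
  - move=> i /andP[i0 i_n].
    have [wi|wi] := ltP 0 (w i); last by rewrite (le_trans wi)// convn_ge0.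
    rewrite -(ler_pM2l D0) cvm//.
    have hr := h1 i; rewrite i0 i_n in hr; have {}hr := hr isT.
    have hF' := hF i; rewrite i0 i_n in hF'; have {}hF' := hF' isT wi.
    have hq := qw _ i_n.
    have bb : b i <= b i.-1.
      case: (i) i0 => // k _; apply: bcoef_nincr.
      by case/andP: beta01 => ? ?; apply/andP; split; lra.
    move: hr; rewrite /r /frac_op => hr.
    have := ler_wpM2l (ltW th0) hq; rewrite cvqE => hq'.
    have : 0 <= th * (mu 1%N - w 1%N) * (b i.-1 - b i).
      by rewrite mulr_ge0 ?subr_ge0// mulr_ge0 ?subr_ge0// ltW.
    move=> hp; nra.
  - rewrite -mulr_suml ler_pM2r ?invr_gt0// big_split/= lerD//.
    apply: (@le_trans _ _ (th * (\sum_(1 <= k < n) nu k + mu 1%N - w 1%N))).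
      rewrite -addrA [leRHS]mulrDr big_split/= lerD//.
        rewrite mulr_sumr big_nat [leRHS]big_nat; apply: ler_sum => k /andP[k0 _].
        by rewrite gtn_eqF// mulr0 subr0.
      rewrite -mulr_sumr big_ltn// big_nat big1 ?addr0 ?mulr1// => k /andP[k1 _].
      by rewrite /de gtn_eqF.
    by rewrite ler_pM2l// lerB.
rewrite ler_pdivlMr// => ?; lra.
Qed.

End accretivity.

(** * The two-sided norm on a grid *)

Section grid_norm.
Context {R : realType}.
Variables (be : R) (n : nat).
Hypothesis be01 : 0 < be <= 1.
Implicit Types (u v e w : nat -> R) (eps : R).

Definition gridnorm u := mass (bcoef (1 - be)) n u + mass (bcoef (1 - be)) n (fun i => - u i).

(** An upper bound, of order [n^be], for the norm of the constant 1; it is the unit in which all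
    errors are measured. *)
Definition gridnorm1 : R := 2 * bcoef (1 + be) n.

Let b0 : bcoef (1 - be) 0 = 1. Proof. exact: bcoef0. Qed.
Let b_ge0 k : 0 <= bcoef (1 - be) k.
Proof. by apply: bcoef_ge0; rewrite subr_ge0; case/andP: be01. Qed.

Lemma gridnorm1_ge0 : 0 <= gridnorm1.
Proof. by rewrite mulr_ge0// bcoef_ge0// addr_ge0//; case/andP: be01 => /ltW. Qed.

Lemma gridnormD u v : gridnorm (fun i => u i + v i) <= gridnorm u + gridnorm v.
Proof.
rewrite /gridnorm [leRHS]addrACA; apply: lerD; first exact: massD.
apply: le_trans (massD _ b0 b_ge0 _ _); apply: mass_mono => // i _.
by rewrite opprD.
Qed.

Lemma eq_gridnorm u v : (forall i, (0 < i < n)%N -> u i = v i) -> gridnorm u = gridnorm v.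
Proof.
move=> uv; congr (_ + _); apply/eqP; rewrite eq_le;
  by apply/andP; split; apply: mass_mono => // i hi; rewrite uv.
Qed.

Lemma gridnorm_sum (m : nat) (p : nat -> R) (u : nat -> nat -> R) :
  (forall j, 0 <= p j) ->
  gridnorm (fun i => \sum_(j < m) p j * u j i) <= \sum_(j < m) p j * gridnorm (u j).
Proof.
move=> p0; rewrite /gridnorm; under [leRHS]eq_bigr do rewrite mulrDr.
rewrite big_split/=; apply: lerD.
  by apply: (mass_sum _ b0 b_ge0 (index_enum 'I_m) (fun j => u j)) => j.
apply: le_trans (mass_sum _ b0 b_ge0 (index_enum 'I_m) (fun j i => - u j i) _) => //.
apply: mass_mono => // i _; rewrite -sumrN.
by rewrite le_eqVlt; apply/orP; left; apply/eqP; apply: eq_bigr => j _; rewrite mulrN.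
Qed.

(** Convolving [bcoef be] with [bcoef (1 - be)] gives the constant 1; moved one place to the right,
    [bcoef be] has no mass at the origin and majorizes 1 at the interior nodes. *)
Lemma mass_small e eps : 0 <= eps -> (forall i, (0 < i < n)%N -> e i <= eps) ->
  mass (bcoef (1 - be)) n e <= eps * bcoef (1 + be) n.
Proof.
move=> eps0 he; have /andP[be0 be1] := be01.
pose mu (k : nat) := if k is k'.+1 then bcoef be k' else 0.
have mu0 k : 0 <= mu k by case: k => //= k; apply: bcoef_ge0; exact: ltW.
apply: mass_le => //.
have : majorized (bcoef (1 - be)) n e (eps * \sum_(1 <= j < n) mu j).
  apply: majorized_const => // -[//|i] _.
  by rewrite convn_shift// convn_bcoef subrK bcoef_one.
move=> [m [m0 m00 h s]]; exists m; split => //; apply: (le_trans s).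
rewrite ler_wpM2l// big_add1/= big_mkord.
case: (n) => [|[|k]]; rewrite ?big_ord0 ?bcoef_ge0 ?addr_ge0 ?(ltW be0)//=.
by rewrite sum_bcoef; apply: bcoef_ndecreasing; [rewrite lerDl ltW|rewrite ltnW].
Qed.

Lemma gridnorm_small e eps : 0 <= eps -> (forall i, (0 < i < n)%N -> `|e i| <= eps) ->
  gridnorm e <= eps * gridnorm1.
Proof.
move=> eps0 he; have -> : eps * gridnorm1 = eps * bcoef (1 + be) n + eps * bcoef (1 + be) n.
  by rewrite /gridnorm1; ring.
apply: lerD; apply: mass_small => // i /he; first exact/le_trans/ler_norm.
by rewrite -normrN; exact/le_trans/ler_norm.
Qed.

Lemma gridnorm_near u v eps : 0 <= eps -> (forall i, (0 < i < n)%N -> `|u i - v i| <= eps) ->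
  gridnorm u <= gridnorm v + eps * gridnorm1.
Proof.
move=> eps0 h; rewrite -lerBlDl; apply: le_trans (gridnorm_small eps0 h).
rewrite lerBlDl; apply: le_trans (gridnormD _ _).
by rewrite le_eqVlt; apply/orP; left; apply/eqP; apply: eq_gridnorm => i _; rewrite addrC subrK.
Qed.

(** The one-sided estimates for [w] and for [- w] carry the boundary contributions [th * w 1] and
    [- th * w 1]. Neither has a sign, but they cancel in the sum, which is why both sides enter the
    norm. *)
Lemma gridnorm_accretive be2 th w F : 1 < be + be2 <= 2 -> (1 < n)%N -> 0 <= th ->
  w 0%N = 0 -> w n = 0 -> (forall i, (0 < i < n)%N -> F i * w i <= 0 /\ (w i = 0 -> F i = 0)) ->
  gridnorm w <= gridnorm (fun i => w i - th * frac_op be (be + be2) w i - F i).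
Proof.
move=> g12 n1 th0 w0 wn hF.
have h1 := @mass_accretive R be (be + be2) be01 g12 n th w F n1 th0 w0 wn.
have h2 := @mass_accretive R be (be + be2) be01 g12 n th (fun i => - w i) (fun i => - F i) n1 th0.
rewrite /= w0 wn oppr0 in h2.
have e : mass (bcoef (1 - be)) n (fun i => - w i - th * frac_op be (be + be2) (fun i => - w i) i - - F i) =
    mass (bcoef (1 - be)) n (fun i => - (w i - th * frac_op be (be + be2) w i - F i)).
  have ee i : - w i - th * frac_op be (be + be2) (fun i => - w i) i - - F i =
     - (w i - th * frac_op be (be + be2) w i - F i).
    rewrite /frac_op (_ : convn _ (fun i => - w i) _ = - convn (bcoef (- (be + be2))) w i.+1); first by ring.
    by rewrite /convn -sumrN; apply: eq_bigr => j _; rewrite mulrN.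
  by apply/eqP; rewrite eq_le; apply/andP; split; apply: mass_mono => // i _; rewrite ee.
rewrite e in h2; rewrite /gridnorm.
suff : mass (bcoef (1 - be)) n w + th * w 1%N + (mass (bcoef (1 - be)) n (fun i => - w i) + th * - w 1%N) <=
  mass (bcoef (1 - be)) n (fun i => w i - th * frac_op be (be + be2) w i - F i) +
  mass (bcoef (1 - be)) n (fun i => - (w i - th * frac_op be (be + be2) w i - F i)).
  by rewrite addrACA mulrN subrr addr0.
apply: lerD.
  by apply: h1 => i hi wi; have [] := hF i hi; rewrite pmulr_lle0.
by apply: h2 => // i hi wi; have [] := hF i hi; rewrite -mulrNN pmulr_lle0.
Qed.

Lemma gridnorm_lower u (P : pred nat) : (forall i, P i -> 0 <= u i) ->
  \sum_(1 <= i < n | P i) u i / bcoef (2 - be) n <= gridnorm u.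
Proof.
move=> hP; have /andP[be0 be1] := be01.
have p2 : 1 <= 2 - be by rewrite lerBrDr -lerBrDl (le_trans be1)//; lra.
rewrite /gridnorm -[leLHS]addr0; apply: lerD; last exact: mass_ge0.
apply: mass_lower => //; first by rewrite bcoef_gt0// (lt_le_trans _ p2).
case: (n) => [|k]; first by rewrite big_ord0 bcoef0.
rewrite sum_bcoef (_ : 1 + (1 - be) = 2 - be); last by ring.
exact: bcoef_ndecreasing.
Qed.

End grid_norm.

(** The factors grow like [n^be] and [n^(1 - be)]. The product is [2 + be * (1 - be)] at [n = 1],
    and by [be * (1 - be) <= 1/4] its successive ratios stay below those of the integers. *)
Lemma bcoef_mul_le {R : realType} (be : R) n : 0 < be <= 1 -> (0 < n)%N -> bcoef (1 + be) n * bcoef (2 - be) n <= 4 * n%:R.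
Proof.
move=> be01; have /andP[be0 be1] := be01; have q : be * (1 - be) <= 4^-1.
  have := sqr_ge0 (be - 2^-1); rewrite expr2; clear; lra.
elim: n => // -[_ _|k IH _].
  by rewrite !bcoef1; clear -q; lra.
rewrite !(bcoefS _ k.+1) mulrACA.
move: (IH isT); set P := bcoef _ _ * bcoef _ _ => hP.
have k0 : 0 < k.+1%:R :> R by [].
have k1 : 0 < k.+2%:R :> R by [].
rewrite (_ : P * _ = P * ((1 + be + k.+1%:R) * (2 - be + k.+1%:R) / (k.+2%:R * k.+2%:R))); last first.
  by field; rewrite gt_eqF.
have kE : k.+2%:R = k.+1%:R + 1 :> R by rewrite -natr1.
rewrite !kE in k1 *; move: k.+1%:R k0 k1 hP => x x0 x1 hP.
have f0 : 0 <= (1 + be + x) * (2 - be + x) / ((x + 1) * (x + 1)).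
  by rewrite divr_ge0 ?mulr_ge0//; clear -be0 be1 x0; lra.
apply: (le_trans (ler_wpM2r f0 hP)).
rewrite mulrA ler_pdivrMr ?mulr_gt0//.
have : x * (be * (1 - be)) <= x * 4^-1 by rewrite ler_pM2l.
clear -x0 x1; nra.
Qed.

(** * Abel's integral identity *)

Section affine.
Context {R : realType}.
Notation leb := (@lebesgue_measure R).

Lemma measurable_affine (l c : R) (D : set R) :
  measurable_fun D (fun u : R => l * u + c).
Proof. by apply: measurable_funD => //; apply: measurable_funM. Qed.

(** By uniqueness of Lebesgue measure it suffices to test intervals []p, q]]; a negative [l]
    reverses the ends of the preimage but not its length. *)
Lemma lebesgue_measure_affine (l c : R) (A : set R) : l != 0 -> measurable A ->
  leb A = (`|l|%:E * leb ((fun u : R => l * u + c)%R @^-1` A))%E.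
Proof.
move=> l0 mA; have nl0 : 0 < `|l| by rewrite normr_gt0.
pose phi : measurableTypeR R -> measurableTypeR R := fun u : R => l * u + c.
have mphi : measurable_fun [set: measurableTypeR R] phi.
  exact: measurable_affine.
pose pm : {measure set (measurableTypeR R) -> \bar R} :=
  measure_function_pushforward__canonical__measure_function_Measure leb mphi.
pose m := mscale (NngNum (ltW nl0)) pm.
rewrite (_ : (_ * _)%E = m A)//.
apply: lebesgue_measure_unique => // _ [[p q]] _ <- /=.
rewrite /m /mscale/= /pushforward/=.
have [lp|ln] := ltP 0 l.
  have -> : phi @^-1` `]p, q]%classic = `](p - c) / l, (q - c) / l]%classic.
    apply/seteqP; split => u; rewrite /phi/= !in_itv/= ltr_pdivrMr// ler_pdivlMr//.
      by rewrite ltrBlDr lerBrDr (mulrC u).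
    by rewrite ltrBlDr lerBrDr (mulrC u).
  rewrite !lebesgue_measure_itv/= !lte_fin ltr_pM2r ?invr_gt0// ltrD2r.
  case: ifP => _; last by rewrite mule0.
  rewrite -!EFinB -EFinM -mulrBl opprB addrA subrK gtr0_norm//.
  by rewrite mulrC divfK.
have {}ln : l < 0 by rewrite lt_def eq_sym l0.
have -> : phi @^-1` `]p, q]%classic = `[(q - c) / l, (p - c) / l[%classic.
  apply/seteqP; split => u; rewrite /phi/= !in_itv/= ltr_ndivlMr// ler_ndivrMr//.
    by rewrite ltrBlDr lerBrDr (mulrC u) andbC.
  by rewrite ltrBlDr lerBrDr (mulrC u) andbC.
rewrite !lebesgue_measure_itv/= !lte_fin ltr_nM2r ?invr_lt0// ltrD2r.
case: ifP => _; last by rewrite mule0.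
rewrite -!EFinB -EFinM -mulrBl opprB addrA subrK ltr0_norm//.
by rewrite mulrC mulrN divfK// opprB.
Qed.

Lemma ge0_integral_affine (l c : R) (f : R -> \bar R) : l != 0 ->
  measurable_fun [set: R] f -> (forall x, 0 <= f x)%E ->
  (\int[leb]_x f x = `|l|%:E * \int[leb]_u f (l * u + c)%R)%E.
Proof.
move=> l0 mf f0; have nl0 : 0 < `|l| by rewrite normr_gt0.
pose phi : measurableTypeR R -> measurableTypeR R := fun u : R => l * u + c.
have mphi : measurable_fun [set: measurableTypeR R] phi.
  exact: measurable_affine.
pose pm : {measure set (measurableTypeR R) -> \bar R} :=
  measure_function_pushforward__canonical__measure_function_Measure leb mphi.
pose m := mscale (NngNum (ltW nl0)) pm.
transitivity (\int[m]_x f x)%E.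
  apply: eq_measure_integral => A mA _.
  exact: (lebesgue_measure_affine c l0 mA).
rewrite /m ge0_integral_mscale//.
by rewrite ge0_integral_pushforward.
Qed.

End affine.

Section power_kernel.
Context {R : realType}.
Notation leb := (@lebesgue_measure R).
Implicit Types s u x l : R.

(** The value 0 for [u <= 0] lets products of kernels be integrated over the whole line, the domains
    of integration being carried by the kernels. *)
Definition pker s u : R := if 0 < u then u `^ (s - 1) else 0.

Lemma pker_ge0 s u : 0 <= pker s u.
Proof. by rewrite /pker; case: ifP => // _; exact: powR_ge0. Qed.

Lemma pkerE s u : 0 < u -> pker s u = u `^ (s - 1).
Proof. by rewrite /pker => ->. Qed.

Lemma pker_le0 s u : u <= 0 -> pker s u = 0.
Proof. by rewrite /pker ltNge => ->. Qed.

Lemma measurable_pker s D : measurable_fun D (pker s).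
Proof.
apply: (@measurable_funS _ _ _ _ setT) => //.
by apply: measurable_fun_ifT => //; exact: measurable_fun_ltr.
Qed.

Lemma is_derive_powRdiv s (u : R) : 0 < s -> 0 < u ->
  is_derive u 1 (fun x : R => x `^ s / s) (u `^ (s - 1)).
Proof.
move=> s0 u0; have := @is_derive1_powR R s u u0 => d.
rewrite (_ : (fun x : R => x `^ s / s) = s^-1 *: (@powR R ^~ s)); last first.
  by apply/funext => x /=; rewrite mulrC.
apply: is_derive_eq; rewrite /GRing.scale/= mulrA mulVf ?mul1r// gt_eqF//.
Qed.

Lemma integral_powR_pos s (c l : R) : 0 < s -> 0 < c -> c < l ->
  (\int[leb]_(u in `[c, l]) (u `^ (s - 1))%:E =
   (l `^ s / s)%:E - (c `^ s / s)%:E)%E.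
Proof.
move=> s0 c0 cl.
have dF (u : R) : 0 < u -> derivable (fun x : R => x `^ s / s) u 1.
  by move=> u0; have [] := is_derive_powRdiv s0 u0.
have cF (u : R) : 0 < u -> {for u, continuous (fun x : R => x `^ s / s)}.
  by move=> u0; apply: differentiable_continuous; apply/derivable1_diffP; exact: dF.
apply: (@continuous_FTC2 R (fun u => u `^ (s - 1)) (fun x => x `^ s / s)) => //.
- apply: continuous_in_subspaceT => u; rewrite inE/= in_itv/= => /andP[cu _].
  have u0 := lt_le_trans c0 cu.
  by apply: differentiable_continuous; apply/derivable1_diffP; apply: derivable_powR;
    rewrite in_itv/= u0.
- split.
  + by move=> u; rewrite in_itv/= => /andP[cu _]; apply: dF; exact: lt_trans cu.
  + by apply: cvg_at_right_filter; exact: cF.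
  + by apply: cvg_at_left_filter; apply: cF; exact: lt_trans cl.
- move=> u; rewrite in_itv/= => /andP[cu _].
  have u0 := lt_trans c0 cu.
  by rewrite derive1E; have [_ ->] := is_derive_powRdiv s0 u0.
Qed.

Lemma powR_cvg0n s (l : R) : 0 < s -> 0 < l ->
  (fun n : nat => (l / n.+1%:R) `^ s) @ \oo --> (0 : R).
Proof.
move=> s0 l0.
have h : (fun n : nat => l / n.+1%:R : R) @ \oo --> (0 : R)^'+.
  have h0 : (fun n : nat => l / n.+1%:R : R) @ \oo --> (0 : R).
    rewrite -(mulr0 l); apply: cvgM; first exact: cvg_cst.
    exact: cvg_harmonic.
  move=> B nB; have := h0 _ nB; apply: (@filterS _ \oo) => n /=; apply.
  by rewrite divr_gt0.
exact: (cvg_comp _ _ h (powR_cvg0 s0)).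
Qed.

(** For [s < 1] the integrand is singular at 0, so the fundamental theorem is applied on
    [[l / n.+1, l]] and the limit taken by monotone convergence. *)
Lemma integral_pker s l : 0 < s -> 0 <= l ->
  (\int[leb]_(u in `[0%R, l]) (pker s u)%:E = (l `^ s / s)%:E)%E.
Proof.
move=> s0; rewrite le_eqVlt => /predU1P[<-|l0].
  by rewrite set_itv1 integral_set1 powR0 ?gt_eqF// mul0r.
have mpk D : measurable_fun D (EFin \o pker s).
  by apply/measurable_EFinP; exact: measurable_pker.
rewrite -integral_itv_obnd_cbnd; last exact: mpk.
pose A (n : nat) := `[l / n.+1%:R, l]%classic.
have UA : `]0, l]%classic = \bigcup_n A n.
  apply/seteqP; split => u /=.
    rewrite in_itv/= => /andP[u0 ul].
    have hn := archimedean.Num.Theory.archi_boundP (ltW (divr_gt0 l0 u0)).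
    exists (Num.bound (l / u)) => //; rewrite /A/= in_itv/= ul andbT.
    rewrite ler_pdivrMr// mulrC -ler_pdivrMr// (le_trans (ltW hn))// ler_nat//.
  by move=> [n _]; rewrite /A/= !in_itv/= => /andP[nu ->]; rewrite (lt_le_trans _ nu)//= divr_gt0.
rewrite UA.
have cA : (\int[leb]_(x in A i) (EFin \o pker s) x)%E @[i --> \oo] -->
    (\int[leb]_(x in \bigcup_i A i) (EFin \o pker s) x)%E.
  apply: ge0_nondecreasing_set_cvg_integral => //.
  - move=> m n mn; rewrite subsetEset /A; apply: subset_itvr; rewrite bnd_simp.
    by rewrite ler_pM2l// lef_pV2 ?posrE// ler_nat ltnS.
  - by move=> i; exact: measurable_itv.
  - by move=> i; exact: mpk.
  - by move=> i x _; rewrite /= lee_fin pker_ge0.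
apply: (cvg_unique _ cA) => //.
have -> : (fun i => \int[leb]_(x in A i) (EFin \o pker s) x)%E =
    EFin \o (fun n : nat => l `^ s / s - (l / n.+1%:R) `^ s / s).
  apply/funext => n /=; have [->|n0] := eqVneq n 0.
    by rewrite /A divr1 set_itv1 integral_set1 subrr.
  have nl : l / n.+1%:R < l by rewrite ltr_pdivrMr// ltr_pMr// ltr1n ltnS lt0n.
  rewrite EFinB -(integral_powR_pos s0 _ nl) ?divr_gt0//; apply: eq_integral => u.
  rewrite inE /A/= in_itv/= => /andP[cu _]; rewrite pkerE// (lt_le_trans _ cu)// divr_gt0//.
apply: cvg_EFin; first exact: nearW.
rewrite -[X in _ --> X](subr0 (l `^ s / s)) -[X in _ - X](mul0r s^-1).
by apply: cvgB; [exact: cvg_cst|apply: cvgMr_tmp; exact: powR_cvg0n].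
Qed.

End power_kernel.

Section abel.
Context {R : realType}.
Notation leb := (@lebesgue_measure R).
Implicit Types s u x l : R.

Lemma pkerM s l u : 0 < l -> pker s (l * u) = l `^ (s - 1) * pker s u.
Proof.
move=> l0; rewrite /pker pmulr_rgt0//; case: ifPn => [u0|_]; last by rewrite mulr0.
by rewrite powRM// ltW.
Qed.

Lemma measurable_pker_affine s (l c : R) D :
  measurable_fun D (fun u : R => pker s (l * u + c)).
Proof.
apply: (@measurable_funS _ _ _ _ setT) => //.
by apply: measurableT_comp; [exact: measurable_pker|exact: measurable_affine].
Qed.

Lemma measurable_pkerB s x D : measurable_fun D (fun u : R => pker s (x - u)).
Proof.
rewrite (_ : (fun u => _) = fun u => pker s (-1 * u + x)).
  exact: measurable_pker_affine.
by apply/funext => u; rewrite mulN1r addrC.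
Qed.

Lemma integral_pkerB s (c x : R) : 0 < s -> c <= x ->
  (\int[leb]_(u in `[c, x]) (pker s (x - u))%:E = ((x - c) `^ s / s)%:E)%E.
Proof.
move=> s0 cx; have xc0 : 0 <= x - c by rewrite subr_ge0.
apply: etrans (integral_pker s0 xc0).
rewrite integral_mkcond [RHS]integral_mkcond.
rewrite (@ge0_integral_affine R (-1) x); first last.
- by move=> u; rewrite erestrict_ge0// => ? _; rewrite lee_fin pker_ge0.
- apply: (measurable_restrictT _ _).1 => //; apply/measurable_EFinP.
  exact: measurable_pkerB.
- by rewrite oppr_eq0 oner_neq0.
rewrite normrN1 mul1e; apply: eq_integral => u _.
rewrite !patchE !mem_setE (_ : x - (-1 * u + x) = u); last by ring.
congr (if _ then _ else _); rewrite !in_itv/=.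
by apply/idP/idP => /andP[? ?]; apply/andP; split; lra.
Qed.

Lemma integrable_pkerB s (c x : R) : 0 < s -> c <= x ->
  leb.-integrable `[c, x] (fun u => (pker s (x - u))%:E).
Proof.
move=> s0 cx; apply/integrableP; split.
  by apply/measurable_EFinP; exact: measurable_pkerB.
under eq_integral do rewrite gee0_abs ?lee_fin ?pker_ge0//.
by rewrite integral_pkerB// ltry.
Qed.

(* The value [B (s, 1 - s)] of the Beta function. *)
Definition beta_cst s : \bar R := (\int[leb]_u (pker s (1 - u) * pker (1 - s) u)%:E)%E.

(** Both exponents are nonpositive, so the integrand is at least 1 on []0, 1[]. *)
Lemma beta_cst_ge1 s : 0 < s < 1 -> (1%:E <= beta_cst s)%E.
Proof.
move=> /andP[s0 s1]; rewrite /beta_cst.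
have m01 : measurable (`]0%R, 1%R[%classic : set R) by exact: measurable_itv.
apply: (@le_trans _ _ (\int[leb]_(u in `]0%R, 1%R[) 1%:E)%E).
  rewrite integral_cst//= mul1e.
  by rewrite [X in (_ <= X)%E]lebesgue_measure_itv/= lte_fin ltr01 sube0.
rewrite [leLHS]integral_mkcond; apply: ge0_le_integral => //.
- by move=> u _; rewrite erestrict_ge0// => ? _; rewrite lee_fin.
- apply: (measurable_restrictT _ _).1 => //.
- apply/measurable_EFinP/measurable_funM; first exact: measurable_pkerB.
  exact: measurable_pker.
- move=> u _; rewrite patchE; case: ifPn => [|_]; last by rewrite lee_fin mulr_ge0 ?pker_ge0.
  rewrite inE/= in_itv/= => /andP[u0 u1]; rewrite lee_fin.
  rewrite !pkerE ?subr_gt0//.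
  have h (v t : R) : 0 < v -> v <= 1 -> t <= 0 -> 1 <= v `^ t.
    by move=> v0 v1 t0; rewrite -(powRr0 v); apply: ger_powR; rewrite ?v0.
  apply: (@le_trans _ _ (1 * 1)); first by rewrite mulr1.
  by apply: ler_pM => //; apply: h; lra.
Qed.

Lemma powR_half_le (v t : R) : 2^-1 <= v -> t <= 0 -> v `^ t <= 2^-1 `^ t.
Proof.
move=> v2 t0; have v0 : 0 < v by apply: lt_le_trans v2.
have e (w : R) : w `^ t = (w `^ (- t))^-1 by rewrite powRN invrK.
rewrite (e v) (e 2^-1) lef_pV2 ?posrE ?powR_gt0//.
have := @ge0_ler_powR R (- t); rewrite oppr_ge0 => /(_ t0); apply => //.
  by rewrite nnegrE invr_ge0.
by rewrite nnegrE ltW.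
Qed.

(** Cutting at 1/2, in each half one of the two factors is away from its singularity and hence
    bounded by its value at 1/2. *)
Lemma pker_pker_le s u : 0 < s < 1 -> 0 <= u <= 1 ->
  pker s (1 - u) * pker (1 - s) u <=
  (2^-1 `^ (s - 1) + 2^-1 `^ (- s)) * (pker s (1 - u) + pker (1 - s) u).
Proof.
move=> /andP[s0 s1] /andP[u0 u1].
have p1 := pker_ge0 s (1 - u); have p2 := pker_ge0 (1 - s) u.
have q1 : 0 <= 2^-1 `^ (s - 1) :> R := powR_ge0 _ _.
have q2 : 0 <= 2^-1 `^ (- s) :> R := powR_ge0 _ _.
have [u2|u2] := leP u 2^-1.
  have e : pker s (1 - u) <= 2^-1 `^ (s - 1).
    by rewrite pkerE ?powR_half_le//; clear -u2 s1; lra.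
  apply: (le_trans (ler_wpM2r p2 e)).
  by apply: ler_pM => //; rewrite ?lerDl// lerDr.
have e : pker (1 - s) u <= 2^-1 `^ (- s).
  rewrite pkerE ?(lt_trans _ u2)// (_ : 1 - s - 1 = - s); last by clear; ring.
  by rewrite powR_half_le// ?oppr_le0 ltW.
apply: (le_trans (ler_wpM2l p1 e)); rewrite mulrC.
by apply: ler_pM => //; rewrite ?lerDl// lerDr.
Qed.

Lemma beta_cst_fin s : 0 < s < 1 -> (beta_cst s < +oo)%E.
Proof.
move=> /andP[s0 s1]; rewrite /beta_cst.
pose C : R := 2^-1 `^ (s - 1) + 2^-1 `^ (- s).
pose f1 u : \bar R := (((fun u => (pker s (1 - u))%:E) \_ `[0%R, 1%R]) u).
pose f2 u : \bar R := (((fun u => (pker (1 - s) u)%:E) \_ `[0%R, 1%R]) u).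
have f10 u : (0 <= f1 u)%E.
  by rewrite erestrict_ge0// => ? _; rewrite lee_fin pker_ge0.
have f20 u : (0 <= f2 u)%E.
  by rewrite erestrict_ge0// => ? _; rewrite lee_fin pker_ge0.
have mf1 : measurable_fun setT f1.
  apply: (measurable_restrictT _ _).1 => //; apply/measurable_EFinP.
  exact: measurable_pkerB.
have mf2 : measurable_fun setT f2.
  apply: (measurable_restrictT _ _).1 => //; apply/measurable_EFinP.
  exact: measurable_pker.
have C0 : 0 <= C by rewrite addr_ge0 ?powR_ge0.
apply: (@le_lt_trans _ _ (C%:E * (\int[leb]_u (f1 u + f2 u)))%E).
  rewrite -ge0_integralZl//; first last.
  - by move=> u _; rewrite adde_ge0.
  - exact: emeasurable_funD.
  apply: ge0_le_integral => //.
  - by move=> u _; rewrite lee_fin mulr_ge0 ?pker_ge0.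
  - apply/measurable_EFinP/measurable_funM; first exact: measurable_pkerB.
    exact: measurable_pker.
  - by apply: measurable_funeM; exact: emeasurable_funD.
  move=> u _; rewrite /f1 /f2 !patchE; case: ifPn; last first.
    rewrite notin_setE/= in_itv/= => /negP; rewrite negb_and -!ltNge => /orP[u0|u1].
      by rewrite (pker_le0 (1 - s)) ?(ltW u0)// mulr0 adde0 mule0.
    by rewrite (pker_le0 s) ?mul0r ?adde0 ?mule0// subr_le0 ltW.
  rewrite inE/= in_itv/= => u01; rewrite -EFinD -EFinM lee_fin.
  by apply: pker_pker_le => //; rewrite s0 s1.
rewrite ge0_integralD// /f1 /f2 -!integral_mkcond integral_pkerB ?integral_pker ?subr_gt0//.
by rewrite -EFinD -EFinM ltry.
Qed.

(** Scale invariance: under [u -> (x - y) * u + y] the exponents [s - 1] and [- s] and the Jacobian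
    contribute powers of [x - y] that add up to zero. *)
Lemma integral_pker_pker s (y x : R) : 0 < s < 1 -> y < x ->
  (\int[leb]_u (pker s (x - u) * pker (1 - s) (u - y))%:E = beta_cst s)%E.
Proof.
move=> /andP[s0 s1] yx; have l0 : 0 < x - y by rewrite subr_gt0.
rewrite (@ge0_integral_affine R (x - y) y) ?gt_eqF//; first last.
- by move=> u; rewrite lee_fin mulr_ge0 ?pker_ge0.
- apply/measurable_EFinP; apply: measurable_funM; first exact: measurable_pkerB.
  rewrite (_ : (fun u => _) = fun u => pker (1 - s) (1 * u + - y)).
    exact: measurable_pker_affine.
  by apply/funext => u; rewrite mul1r.
rewrite gtr0_norm// -ge0_integralZl//; first last.
- by rewrite lee_fin ltW.
- by move=> u _; rewrite lee_fin mulr_ge0 ?pker_ge0.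
- apply/measurable_EFinP; apply: measurable_funM.
    rewrite (_ : (fun u => _) = fun u => pker s (- (x - y) * u + (x - y))).
      exact: measurable_pker_affine.
    by apply/funext => u; congr pker; ring.
  rewrite (_ : (fun u => _) = fun u => pker (1 - s) ((x - y) * u + 0)).
    exact: measurable_pker_affine.
  by apply/funext => u; congr pker; ring.
have key (u : R) : (x - y) * (pker s (x - ((x - y) * u + y)) *
    pker (1 - s) ((x - y) * u + y - y)) = pker s (1 - u) * pker (1 - s) u.
  rewrite (_ : x - ((x - y) * u + y) = (x - y) * (1 - u)); last by ring.
  rewrite addrK !pkerM// mulrACA mulrA.
  rewrite -powRD; last by rewrite (gt_eqF l0) implybT.
  rewrite (_ : s - 1 + (1 - s - 1) = -1); last by ring.
  by rewrite powR_inv1 ?ltW// -mulrA mulVKf ?(gt_eqF l0).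
by apply: eq_integral => u _; rewrite -EFinM key.
Qed.

End abel.

Section abel_inversion.
Context {R : realType}.
Notation leb := (@lebesgue_measure R).
Implicit Types s u x l : R.

(* The Riemann-Liouville integral without the factor [1 / Gamma s]. *)
Definition fracint s (c : R) (f : R -> R) (x : R) : R :=
  \int[leb]_(y in `[c, x]) (pker s (x - y) * f y).

(** After exchanging the integrals, the inner one is [beta_cst s] for every [y < x]. Integrability
    on the plane is checked by Tonelli in that same order, where the absolute value of [f0] factors
    out. *)
Lemma abel_fubini s c x (f : R -> R) : 0 < s < 1 -> c < x ->
  leb.-integrable `[c, x] (EFin \o f) ->
  (forall y, c <= y <= x ->
    leb.-integrable `[c, y] (fun z => (pker (1 - s) (y - z) * f z)%:E)) ->
  fracint s c (fracint (1 - s) c f) x = fine (beta_cst s) * \int[leb]_(y in `[c, x]) f y.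
Proof.
move=> s01 cx intf intkf.
(* The end point [x] is dropped because the kernel integral jumps from [beta_cst s] to 0 there. *)
pose f0 := f \_ `[c, x[.
have m0 : measurable (`[c, x[%classic : set R) by exact: measurable_itv.
have intf0 : leb.-integrable setT (EFin \o f0).
  have h := (@integrable_mkcond _ _ _ leb _ (EFin \o f) m0).1.
  rewrite restrict_EFin in h; apply: h.
  apply: integrableS intf => //; apply: subset_itvl; by rewrite bnd_simp.
have mf0 : measurable_fun setT f0 by apply/measurable_EFinP; case/integrableP: intf0.
pose F (z : R * R) : \bar R :=
  (pker s (x - z.1) * pker (1 - s) (z.1 - z.2) * f0 z.2)%:E.
have beta_cst_num : beta_cst s \is a fin_num.
  by rewrite fin_numElt beta_cst_fin// (lt_le_trans _ (beta_cst_ge1 s01))// ltNyr.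
have mk : measurable_fun setT (fun z : R * R => pker s (x - z.1) * pker (1 - s) (z.1 - z.2)).
  apply: measurable_funM.
    apply: (@measurableT_comp _ _ _ _ _ _ (fun u => pker s (x - u))) => //.
    exact: measurable_pkerB.
  apply: measurableT_comp; first exact: measurable_pker.
  exact: measurable_funB.
have mF : measurable_fun setT F.
  by apply/measurable_EFinP; apply: measurable_funM => //; exact: measurableT_comp.
have kint y : (\int[leb]_u (pker s (x - u) * pker (1 - s) (u - y))%:E =
    if (y < x)%R then beta_cst s else 0)%E.
  case: ifPn => [yx|]; first exact: integral_pker_pker.
  rewrite -leNgt => xy; apply: integral0_eq => u _; congr EFin.
  have [xu|ux] := leP x u; first by rewrite pker_le0 ?mul0r ?subr_le0.
  by rewrite [X in _ * X]pker_le0 ?mulr0// subr_le0 (le_trans (ltW ux)).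
have f0x y : x <= y -> f0 y = 0.
  by move=> xy; rewrite /f0 patchE mem_setE in_itv/= [y < x]ltNge xy andbF.
have mky y : measurable_fun setT
    (fun u : R => (pker s (x - u) * pker (1 - s) (u - y))%:E).
  apply/measurable_EFinP; apply: measurable_funM; first exact: measurable_pkerB.
  rewrite (_ : (fun u => _) = fun u => pker (1 - s) (1 * u + - y)).
    exact: measurable_pker_affine.
  by apply/funext => u; rewrite mul1r.
have iF : (leb \x leb)%E.-integrable setT F.
  apply/integrable21ltyP => //.
  apply: (@le_lt_trans _ _ (\int[leb]_y (beta_cst s * `|(f0 y)%:E|))%E).
    apply: ge0_le_integral => //.
    - by move=> y _; exact: integral_ge0.
    - have h := @measurable_fun_fubini_tonelli_G _ _ _ _ R leb (abse \o F).
      refine (h _ _) => [|z]; last exact: abse_ge0.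
      have h2 : measurable_fun setT (abse \o F) by apply: measurableT_comp.
      exact h2.
    - by apply: measurable_funeM; apply: measurableT_comp => //; exact/measurable_EFinP.
    move=> y _; rewrite (_ : (\int[leb]_u _)%E = (`|f0 y|%:E * if (y < x)%R then beta_cst s else 0)%E).
      case: ifPn => [_|]; first by rewrite muleC.
      by rewrite -leNgt mule0 => _; rewrite mule_ge0// (le_trans _ (beta_cst_ge1 s01))//.
    rewrite -kint -ge0_integralZl//; first last.
    - by move=> u _; rewrite lee_fin mulr_ge0 ?pker_ge0.
    - exact: mky.
    apply: eq_integral => u _; rewrite /F/= normrM -EFinM mulrC.
    by rewrite (ger0_norm (mulr_ge0 (pker_ge0 _ _) (pker_ge0 _ _))).
  rewrite ge0_integralZl//; first last.
  - by rewrite (le_trans _ (beta_cst_ge1 s01)).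
  - by apply: measurableT_comp => //; exact/measurable_EFinP.
  by rewrite lte_mul_pinfty ?(le_trans _ (beta_cst_ge1 s01))//; case/integrableP: intf0.
have GE : (\int[leb]_y \int[leb]_u F (u, y) =
    (fine (beta_cst s))%:E * \int[leb]_y (f0 y)%:E)%E.
  rewrite -integralZl//; apply: eq_integral => y _.
  rewrite /F/=; under eq_integral do rewrite mulrC EFinM.
  rewrite integralZl//; last first.
    apply/integrableP; split; first exact: mky.
    under eq_integral do rewrite gee0_abs ?lee_fin ?mulr_ge0 ?pker_ge0//.
    by rewrite kint; case: ifPn => // _; exact: beta_cst_fin.
  rewrite kint; case: ifPn => [_|]; first by rewrite muleC fineK.
  by rewrite -leNgt => /f0x ->; rewrite mul0e mule0.
have FE u : (\int[leb]_y F (u, y) =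
    ((fun u => (pker s (x - u) * fracint (1 - s) c f u)%:E) \_ `[c, x]) u)%E.
  rewrite patchE; case: ifPn => [|]; last first.
    rewrite notin_setE/= in_itv/= => /negP; rewrite negb_and -!ltNge => ucx.
    apply: integral0_eq => y _; rewrite /F/=; congr EFin.
    case/orP: ucx => [uc|xu]; last by rewrite pker_le0 ?mul0r// subr_le0 ltW.
    have [cy|yc] := leP c y.
      by rewrite [X in _ * X * _]pker_le0 ?mulr0 ?mul0r// subr_le0 (le_trans (ltW uc)).
    by rewrite /f0 patchE mem_setE in_itv/= leNgt yc mulr0.
  rewrite inE/= in_itv/= => /andP[cu ux].
  have -> : (fun y => F (u, y)) = (fun y => (pker s (x - u))%:E *
      ((fun z => (pker (1 - s) (u - z) * f z)%:E) \_ `[c, u]) y)%E.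
    apply/funext => y; rewrite /F/= -mulrA EFinM; congr (_ * _)%E.
    rewrite patchE /f0 patchE !mem_setE !in_itv/=.
    have [uy|yu] := ltP u y; first by rewrite andbF pker_le0 ?mul0r// subr_le0 ltW.
    rewrite andbT; case: ifPn => [/andP[-> _]//|]; rewrite negb_and -leNgt.
    case/orP => [/negbTE ->|xy]; first by rewrite mulr0.
    by rewrite pker_le0 ?mul0r ?if_same// subr_le0 (le_trans ux).
  have icu := intkf _ (introT andP (conj cu ux)).
  rewrite integralZl//; last first.
    by apply: (@integrable_mkcond _ _ _ leb _ _ _).1 => //; exact: measurable_itv.
  by rewrite -integral_mkcond EFinM /fracint /Rintegral fineK//; exact: integrable_fin_num.
have := Fubini iF; rewrite GE.
under eq_integral do rewrite FE.
rewrite -integral_mkcond => e.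
rewrite /fracint /Rintegral [X in fine X]e fineM//; last first.
  by apply: integrable_fin_num.
congr (_ * fine _).
rewrite [RHS](_ : _ = (\int[leb]_(y in `[c, x[) (f y)%:E)%E).
  by rewrite [RHS]integral_mkcond restrict_EFin.
rewrite integral_itv_bndo_bndc//.
apply: (@measurable_funS _ _ _ _ `[c, x]%classic) => //.
  by apply: subset_itvl; rewrite bnd_simp.
by case/integrableP: intf.
Qed.

End abel_inversion.

(** * Functions whose derivative vanishes almost everywhere *)

Section zero_derivative.
Context {R : realType}.
Notation leb := (@lebesgue_measure R).
Implicit Types (f e : R -> R) (c d s v x y : R).

(** Peano's form without a quotient: it is one-sided at the end points and harmless at [y = s]. *)
Definition deriv_on c d f s v := forall eps, 0 < eps -> exists2 dlt, 0 < dlt &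
  forall y, c <= y <= d -> `|y - s| < dlt ->
    `|f y - f s - v * (y - s)| <= eps * `|y - s|.

Lemma real_induction c d (P : R -> Prop) :
  P c ->
  (forall s, c < s <= d -> (forall y, c <= y < s -> P y) -> P s) ->
  (forall s, c <= s < d -> P s ->
    exists2 dlt, 0 < dlt & forall y, s < y < s + dlt -> y <= d -> P y) ->
  forall x, c <= x <= d -> P x.
Proof.
move=> Pc Pleft Pright x /andP[cx xd].
pose S := [set s | c <= s <= d /\ forall y, c <= y <= s -> P y].
have Sc : S c.
  split; first by rewrite lexx (le_trans cx).
  by move=> y /andP[cy yc]; rewrite (_ : y = c)//; apply/eqP; rewrite eq_le yc.
have supS : has_sup S.
  by split; [exists c|exists d => s [/andP[]]].
set m := sup S.
have cm : c <= m by apply: ub_le_sup => //; case: supS.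
have md : m <= d by apply: ge_sup; [exists c|move=> s [/andP[]]].
have Pm : forall y, c <= y < m -> P y.
  move=> y /andP[cy ym]; have [|t [_ Pt] yt] := @sup_gt R S y _ ym; first by exists c.
  by apply: Pt; rewrite cy ltW.
have {}Pm : P m.
  move: (cm); rewrite le_eqVlt => /predU1P[<-//|cm'].
  by apply: Pleft => //; rewrite cm' md.
have Sm : forall y, c <= y <= m -> P y.
  move=> y /andP[cy]; rewrite le_eqVlt => /predU1P[->//|ym].
  have [|t [_ Pt] yt] := @sup_gt R S y _ ym; first by exists c.
  by apply: Pt; rewrite cy ltW.
suff dm : m = d by apply: Sm; rewrite cx dm.
apply/eqP; rewrite eq_le md leNgt; apply/negP => md'.
have [|dlt dlt0 hd] := Pright m _ Pm; first by rewrite cm md'.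
pose y := Num.min d (m + dlt / 2).
have my : m < y by rewrite lt_min md' ltrDl divr_gt0.
suff : S y by move=> /(ub_le_sup (proj2 supS)); rewrite leNgt my.
split; first by rewrite ge_min lexx (ltW (le_lt_trans cm my)).
move=> z /andP[cz zy]; have [zm|mz] := leP z m; first by apply: Sm; rewrite cz.
move: zy; rewrite le_min => /andP[zd zm]; apply: hd => //; rewrite mz/=.
by apply: (le_lt_trans zm); rewrite ltrD2l; lra.
Qed.

(* The exceptional set is covered by open sets [U k] of measure less than [w k].
   The function [H] stays below [eps], but inside [U k] it grows with slope at
   least [k.+2], which outweighs any derivative smaller than [k]. *)
Lemma zero_derive_ae_le c d (D e : R -> R) (eps : R) : 0 < eps ->
  (forall s, c <= s <= d -> deriv_on c d D s (e s)) ->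
  leb.-negligible [set s | c <= s <= d /\ e s != 0] ->
  forall x, c <= x <= d -> D x - D c <= eps * (x - c) + eps.
Proof.
move=> eps0 hD [B [mB B0 NB]].
(* Chosen so that [k.+2 * w k = eps / 2^(k + 1)], a series of sum [eps]. *)
pose w (k : nat) : R := eps / 2 ^+ k.+1 / k.+2%:R.
have w0 k : 0 < w k by rewrite !divr_gt0 ?exprn_gt0.
have /choice[U hU] (k : nat) : exists U : set R,
    [/\ open U, B `<=` U & (leb U < (w k)%:E)%E].
  have [|U [oU BU lU]] := @lebesgue_regularity_outer R B (w k) mB _ (w0 k).
    by apply: le_lt_trans (ltry 0); rewrite le_eqVlt; apply/orP; left; apply/eqP; exact: B0.
  exists U; split => //; apply: le_lt_trans lU.
  rewrite (measureDI lebesgue_measure (open_measurable oU) mB).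
  rewrite setIidr// -[leRHS]adde0; apply: leeD => //.
  by rewrite le_eqVlt; apply/orP; left; apply/eqP; exact: B0.
have mU k : measurable (U k) by have [/open_measurable] := hU k.
pose g (k : nat) (x : R) : R := fine (leb (U k `&` `[c, x])).
have mUi k (i : interval R) : measurable (U k `&` [set` i]).
  by apply: measurableI => //; exact: measurable_itv.
have gw' k x : (leb (U k `&` `[c, x]) <= (w k)%:E)%E.
  have [_ _ /ltW] := hU k; apply: le_trans.
  by apply: le_measure; [apply: mem_set; exact: mUi|apply: mem_set; exact: mU|exact: subIsetl].
have g_fin k x : leb (U k `&` `[c, x]) \is a fin_num.
  by rewrite ge0_fin_numE// (le_lt_trans (gw' k x))// ltry.
have gw k x : g k x <= w k by rewrite -lee_fin fineK.
have g_mono k x y : x <= y -> g k x <= g k y.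
  move=> xy; rewrite -lee_fin !fineK//.
  apply: le_measure; [apply: mem_set; exact: mUi|apply: mem_set; exact: mUi|].
  by apply: setIS; apply: subset_itvl; rewrite bnd_simp.
have g_slope k s y : c <= s -> s <= y -> `[s, y] `<=` U k -> g k s + (y - s) <= g k y.
  move=> cs sy sub; rewrite -lee_fin EFinD !fineK//.
  have -> : (y - s)%:E = leb `]s, y]%classic.
    rewrite [RHS]lebesgue_measure_itv/= lte_fin; case: ltgtP sy => // -> _.
    by rewrite subrr.
  rewrite -measureU; [|exact: mUi|exact: measurable_itv|]; last first.
    apply/seteqP; split => z //= [[_]]; rewrite !in_itv/= => /andP[_ zs].
    by rewrite ltNge zs.
  apply: le_measure; [apply: mem_set|apply: mem_set; exact: mUi|].
    by apply: measurableU; [exact: mUi|exact: measurable_itv].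
  move=> z /= [[Uz]|]; rewrite !in_itv/= => /andP[h1 h2].
    by split => //; rewrite h1 (le_trans h2).
  by rewrite h2 (le_trans cs (ltW h1)); split => //; apply: sub; rewrite /= in_itv/= h2 ltW.
have g0 k x : 0 <= g k x by rewrite fine_ge0.
pose Hn (n : nat) (x : R) : R := \sum_(k < n) k.+2%:R * g k x.
have Hn_eps n x : Hn n x <= eps.
  suff : Hn n x <= eps * (1 - 2^-1 ^+ n).
    by move=> /le_trans; apply; rewrite ler_piMr ?ltW// gerBl exprn_ge0.
  rewrite /Hn; elim: n => [|n IH]; first by rewrite big_ord0 expr0 subrr mulr0.
  rewrite big_ord_recr/=; apply: (le_trans (lerD IH (ler_wpM2l _ (gw n x)))) => //.
  have -> : n.+2%:R * w n = eps / 2 ^+ n.+1 by rewrite /w mulrC divfK ?pnatr_eq0.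
  rewrite !exprS exprVn invfM; move: (2 ^+ n)^-1 => z.
  rewrite le_eqVlt; apply/orP; left; apply/eqP; by field.
have Hn_mono n m x : (n <= m)%N -> Hn n x <= Hn m x.
  move=> gridnorm; rewrite /Hn (big_ord_widen m (fun k => k.+2%:R * g k x) gridnorm).
  rewrite [leRHS](bigID (fun k : 'I_m => (k < n)%N))/= lerDl.
  by apply: sumr_ge0 => k _; rewrite mulr_ge0.
pose H (x : R) : R := sup (range (fun n => Hn n x)).
have supH x : has_sup (range (fun n => Hn n x)).
  by split; [exists (Hn 0 x), 0|exists eps => _ [n _ <-]].
have HnH n x : Hn n x <= H x by apply: ub_le_sup; [case: (supH x)|exists n].
have H_eps x : H x <= eps by apply: ge_sup; [case: (supH x)|move=> _ [n _ <-]].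
have H_mono x y : x <= y -> H x <= H y.
  move=> xy; apply: ge_sup; first by case: (supH x).
  move=> _ [n _ <-]; apply: le_trans (HnH n y).
  by apply: ler_sum => k _; rewrite ler_wpM2l// g_mono.
have H_slope k s y : c <= s -> s <= y -> `[s, y] `<=` U k ->
    H s + k.+2%:R * (y - s) <= H y.
  move=> cs sy sub; rewrite -lerBrDr; apply: ge_sup; first by case: (supH s).
  move=> _ [n _ <-]; rewrite lerBrDr; apply: le_trans (HnH (maxn n k.+1) y).
  apply: (@le_trans _ _ (Hn (maxn n k.+1) s + k.+2%:R * (y - s))).
    by rewrite lerD2r Hn_mono// leq_maxl.
  move: (maxn _ _) (leq_maxr n k.+1) => N kN; rewrite /Hn.
  rewrite (bigD1 (Ordinal kN))//= [leRHS](bigD1 (Ordinal kN))//= addrAC -mulrDr.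
  apply: lerD; first by rewrite ler_wpM2l// g_slope.
  by apply: ler_sum => j _; rewrite ler_wpM2l// g_mono.
have H0 x : 0 <= H x by apply: le_trans (HnH 0 x); rewrite /Hn big_ord0.
suff hP x : c <= x <= d -> D x - D c <= eps * (x - c) + H x.
  by move=> x hx; apply: (le_trans (hP x hx)); rewrite lerD2l.
move: x; apply: (@real_induction c d (fun x => D x - D c <= eps * (x - c) + H x)).
  by rewrite !subrr mulr0 add0r.
(* Passage to the limit from the left uses only the continuity of [D] at [s]: a step back of length
   [r] costs at most [(|e s| + 1) * r <= eta], and [H] is nondecreasing. *)
- move=> s /andP[cs sd] hs; apply/ler_addgt0Pr => eta eta0.
  have [|dlt dlt0 hd] := hD s _ 1 ltr01; first by rewrite sd ltW.
  pose M := `|e s| + 1.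
  have M0 : 0 < M by rewrite ltr_wpDl.
  pose r := Num.min (s - c) (Num.min (dlt / 2) (eta / M)).
  have r0 : 0 < r by rewrite !lt_min subr_gt0 cs !divr_gt0.
  have [rc [rd re]] : r <= s - c /\ r <= dlt / 2 /\ r <= eta / M.
    by rewrite !ge_min !lexx ?orbT.
  have cy : c <= s - r by rewrite lerBrDr -lerBrDl.
  have := hs (s - r); rewrite cy ltrBlDr ltrDl r0 => /(_ isT) Py.
  have := hd (s - r); rewrite cy lerBlDr (le_trans sd) ?lerDl ?(ltW r0)//.
  rewrite addrAC subrr add0r normrN gtr0_norm// => /(_ isT).
  have rd' : r < dlt by apply: le_lt_trans rd _; lra.
  move=> /(_ rd'); rewrite mul1r => hh.
  have rM : M * r <= eta by rewrite mulrC -ler_pdivlMr.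
  have Hy : H (s - r) <= H s by apply: H_mono; rewrite lerBlDr lerDl ltW.
  have her : `|e s * - r| = `|e s| * r by rewrite normrM normrN (gtr0_norm r0).
  have h1 : D s - D (s - r) <= M * r.
    move: hh; rewrite ler_norml => /andP[hh _].
    have := le_trans (ler_norm _) (lexx `|e s * - r|); rewrite her => he.
    have := ler_norm (- (e s * - r)); rewrite normrN her => he2.
    by rewrite mulrDl mul1r; clear -hh he2; lra.
  have h2 : eps * (s - r - c) <= eps * (s - c) by rewrite ler_pM2l// lerD2r lerBlDr lerDl ltW.
  clear -h1 h2 rM Hy Py; lra.
- move=> s /andP[cs sd] Ps.
  have hs : c <= s <= d by rewrite cs ltW.
  have [es|es] := eqVneq (e s) 0.
    have [dlt dlt0 hd] := hD s hs eps eps0.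
    exists dlt => // y /andP[sy yd'] yd.
    have cy : c <= y by rewrite (le_trans cs) ?ltW.
    have := hd y; rewrite cy yd gtr0_norm ?subr_gt0// ltrBlDl => /(_ isT yd').
    rewrite es mul0r subr0 => /(le_trans (ler_norm _)) h.
    have Hy := H_mono _ _ (ltW sy).
    clear -h Hy Ps; lra.
  have sB : B s by apply: NB; split.
  (* With [|e s| < k], the increment of [D] to the right of [s] has slope at most [k + 1], the extra
     1 being the differentiability error, and [H] gains [k + 2] inside [U k]. *)
  pose k := Num.bound `|e s|.
  have hk : `|e s| < k%:R by apply: archimedean.Num.Theory.archi_boundP.
  have [oU BU _] := hU k.
  have [dlt dlt0 hd] := hD s hs 1 ltr01.
  have [r r0 hr] : exists2 r, 0 < r & forall y, `|y - s| < r -> U k y.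
    have : nbhs s (U k) by apply: open_nbhs_nbhs; split => //; exact: BU.
    move=> /nbhs_ballP[r /= r0 hr]; exists r => // y ys; apply: hr.
    by rewrite /ball/= distrC.
  exists (Num.min dlt r); first by rewrite lt_min dlt0.
  move=> y /andP[sy]; rewrite -ltrBlDl lt_min => /andP[yd' yr] yd.
  have cy : c <= y by rewrite (le_trans cs) ?ltW.
  have := hd y; rewrite cy yd gtr0_norm ?subr_gt0// => /(_ isT yd').
  rewrite mul1r => /(le_trans (ler_norm _)) h.
  have sub : `[s, y] `<=` U k.
    move=> z /=; rewrite in_itv/= => /andP[sz zy]; apply: hr.
    by rewrite ger0_norm ?subr_ge0//; apply: le_lt_trans yr; rewrite lerD2r.
  have Hy := H_slope k s y cs (ltW sy) sub.
  have h3 : e s * (y - s) <= k%:R * (y - s).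
    by rewrite ler_pM2r ?subr_gt0// (le_trans (ler_norm _))// ltW.
  have h4 : k.+2%:R * (y - s) = k%:R * (y - s) + 2 * (y - s) by rewrite -addn2 natrD mulrDl.
  have h5 : eps * (s - c) <= eps * (y - c) by rewrite ler_pM2l// lerD2r ltW.
  have h6 : 0 < y - s by rewrite subr_gt0.
  clear -h h3 h4 h5 h6 Hy Ps; lra.
Qed.

Lemma deriv_onN c d f s v : deriv_on c d f s v ->
  deriv_on c d (fun x => - f x) s (- v).
Proof.
move=> h eps e0; have [dlt d0 hd] := h _ e0; exists dlt => // y hy ys.
apply: le_trans (hd y hy ys); rewrite -[leRHS]normrN.
by rewrite le_eqVlt; apply/orP; left; apply/eqP; congr `|_|; ring.
Qed.

(** A derivative is assumed at every point and only its vanishing is almost everywhere; this is what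
    excludes the Cantor function. *)
Lemma zero_derive_ae_cst c d (D e : R -> R) :
  (forall s, c <= s <= d -> deriv_on c d D s (e s)) ->
  leb.-negligible [set s | c <= s <= d /\ e s != 0] ->
  forall x, c <= x <= d -> D x = D c.
Proof.
move=> hD hN x hx; have /andP[cx xd] := hx.
have limit0 (u M : R) : 0 <= M -> (forall eps, 0 < eps -> u <= eps * M + eps) -> u <= 0.
  move=> M0 h; rewrite leNgt; apply/negP => u0.
  have M1 : 0 < M + 1 by rewrite ltr_wpDl.
  have := h (u / 2 / (M + 1)); rewrite !divr_gt0// => /(_ isT).
  rewrite -[X in _ <= _ + X]mulr1 -mulrDr divfK ?gt_eqF// => hu.
  by clear -hu u0; lra.
have xc : 0 <= x - c by rewrite subr_ge0.
apply/eqP; rewrite eq_le; apply/andP; split; rewrite -subr_le0.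
  apply: (limit0 _ _ xc) => eps e0; exact: (zero_derive_ae_le e0 hD hN hx).
apply: (limit0 _ _ xc) => eps e0.
rewrite (_ : D c - D x = - D x - (- D c)); last by ring.
apply: (zero_derive_ae_le (D := fun x => - D x) (e := fun x => - e x) e0 _ _ hx).
  by move=> s hs; apply: deriv_onN; exact: hD.
apply: negligibleS hN => s /= [hs]; rewrite oppr_eq0 => es; by split.
Qed.

End zero_derivative.

(** * Fractional integrals of continuous functions *)

Section within_continuity.
Context {R : realType}.

Lemma within_continuousP (X : pseudoMetricType R) (A : set X) (f : X -> R) :
  {within A, continuous f} <->
  forall x, A x -> forall eps, 0 < eps -> exists2 dlt, 0 < dlt &
    forall y, A y -> ball x dlt y -> `|f x - f y| <= eps.
Proof.
split.
  move=> /subspace_continuousP cf x Ax eps e0.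
  have /cvgrPdist_le/(_ _ e0) := cf x Ax.
  move=> /nbhs_ballP[d /= d0 hd]; exists d => // y Ay xy; exact: hd.
move=> h; apply/subspace_continuousP => x Ax; apply/cvgrPdist_le => eps e0.
have [d d0 hd] := h x Ax eps e0.
by apply/nbhs_ballP; exists d => //= y xy Ay; exact: hd.
Qed.

Lemma compact_within_uniform (X : pseudoMetricType R) (A : set X) (f : X -> R) :
  compact A -> {within A, continuous f} ->
  forall eps, 0 < eps -> exists2 dlt, 0 < dlt &
    forall x y, A x -> A y -> ball x dlt y -> `|f x - f y| <= eps.
Proof.
move=> /compact_near_coveringP cA /within_continuousP cf eps e0.
pose P (dlt : R) (x : X) := A x -> forall y, A y -> ball x dlt y -> `|f x - f y| <= eps.
have [] := cA R (0^'+) P _.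
  move=> x Ax; have e2 : 0 < eps / 2 by rewrite divr_gt0.
  have [r r0 hr] := cf x Ax _ e2; have r2 : 0 < r / 2 by rewrite divr_gt0.
  exists (ball x (r / 2), [set d | d <= r / 2]); first split => /=.
  - exact: nbhsx_ballx.
  - by apply: nbhs_right_le.
  move=> [x' d] /= [xx' dr] Ax' y Ay x'y.
  have h1 : `|f x - f x'| <= eps / 2.
    by apply: hr => //; apply: le_ball xx'; rewrite ler_pdivrMr// ler_pMr// ler1n.
  have h2 : `|f x - f y| <= eps / 2.
    apply: hr => //; rewrite (splitr r); apply: ball_triangle xx' _.
    exact: le_ball x'y.
  rewrite (_ : f x' - f y = (f x - f y) - (f x - f x')); last by ring.
  by rewrite (le_trans (ler_normB _ _))// [leRHS]splitr lerD.
move=> d /= d0 hd; exists (d / 2); first by rewrite divr_gt0.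
move=> x y Ax Ay xy; apply: (hd (d / 2)) => //=.
- by rewrite /ball/= sub0r normrN gtr0_norm ?divr_gt0// ltr_pdivrMr// ltr_pMr// ltr1n.
- by rewrite divr_gt0.
Qed.

Lemma compact_within_bounded (X : pseudoMetricType R) (A : set X) (f : X -> R) :
  compact A -> {within A, continuous f} ->
  exists2 M, 0 <= M & forall x, A x -> `|f x| <= M.
Proof.
move=> cA cf; have /compact_bounded[M [_ hM]] := continuous_compact cf cA.
exists (`|M| + 1); first by rewrite addr_ge0.
by move=> x Ax; apply: (hM (`|M| + 1)); [rewrite (le_lt_trans (ler_norm _))// ltrDl|exists x].
Qed.

Implicit Types (c d : R) (f g h : R -> R).
Notation leb := (@lebesgue_measure R).

Lemma itv_within_integrable c d f : {within `[c, d], continuous f} ->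
  leb.-integrable `[c, d] (EFin \o f).
Proof. by move=> cf; apply: continuous_compact_integrable => //; exact: segment_compact. Qed.

Lemma itv_within_measurable c d f : {within `[c, d], continuous f} ->
  measurable_fun `[c, d] f.
Proof.
by move=> cf; apply: subspace_continuous_measurable_fun => //; exact: measurable_itv.
Qed.

Lemma itv_within_bounded c d f : {within `[c, d], continuous f} ->
  exists2 M, 0 <= M & forall x, c <= x <= d -> `|f x| <= M.
Proof.
move=> cf; have [M M0 hM] := compact_within_bounded (@segment_compact _ c d) cf.
by exists M => // x hx; apply: hM; rewrite /= in_itv.
Qed.

Lemma Rintegral_cst_itv c d M : c <= d -> \int[leb]_(x in `[c, d]) M = M * (d - c).
Proof.
move=> cd; have mI : measurable (`[c, d]%classic : set R) by exact: measurable_itv.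
rewrite /Rintegral integral_cst//= lebesgue_measure_itv/= lte_fin.
by case: (ltgtP c d) cd => [cd _|//|-> _]; rewrite ?subrr ?mule0 ?mulr0.
Qed.

Lemma Rintegral_bound c d f M : c <= d -> leb.-integrable `[c, d] (EFin \o f) ->
  (forall x, c <= x <= d -> `|f x| <= M) ->
  `|\int[leb]_(x in `[c, d]) f x| <= M * (d - c).
Proof.
move=> cd fi fM; have mI : measurable (`[c, d]%classic : set R) by exact: measurable_itv.
have h : `|\int[leb]_(x in `[c, d]) f x| <= \int[leb]_(x in `[c, d]) `|f x|.
  by apply: le_normr_Rintegral.
apply: (le_trans h).
apply: (@le_trans _ _ (\int[leb]_(x in `[c, d]) M)).
  apply: le_Rintegral => //.
  - by have := integrable_norm fi; exact.
  - apply: (@itv_within_integrable c d (cst M)); apply: continuous_subspaceT; exact: cst_continuous.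
have <- := Rintegral_cst_itv M cd; exact: lexx.
Qed.

Lemma Rintegral_itvB_bnd c s y f : c <= s -> s <= y ->
  leb.-integrable `[c, y] (EFin \o f) ->
  \int[leb]_(x in `[c, y]) f x - \int[leb]_(x in `[c, s]) f x =
  \int[leb]_(x in `[s, y]) f x.
Proof.
move=> cs sy fi.
apply: etrans (Rintegral_itv_obnd_cbnd _); last first.
  apply: integrableS fi => //.
  by apply: subset_itvr; rewrite bnd_simp.
by apply: Rintegral_itvB => //; rewrite bnd_simp.
Qed.

Lemma integrable_sub_itv c d c' d' f : c <= c' -> d' <= d ->
  leb.-integrable `[c, d] (EFin \o f) -> leb.-integrable `[c', d'] (EFin \o f).
Proof.
move=> cc dd; apply: integrableS => //; try exact: measurable_itv.
by apply: subset_itv; rewrite bnd_simp.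
Qed.

Lemma deriv_on_Rintegral c d f : {within `[c, d], continuous f} ->
  forall s, c <= s <= d ->
  deriv_on c d (fun x => \int[leb]_(y in `[c, x]) f y) s (f s).
Proof.
move=> cf s hs eps e0; have /andP[cs sd] := hs.
have Is : s \in `[c, d] by rewrite in_itv.
have fi := itv_within_integrable cf.
have [dlt d0 hd] := (within_continuousP _ _).1 cf s Is eps e0.
have key (u v : R) : c <= u -> u <= v -> v <= d -> `|u - s| < dlt -> `|v - s| < dlt ->
    (u = s) \/ (v = s) ->
    `|\int[leb]_(y in `[c, v]) f y - \int[leb]_(y in `[c, u]) f y - f s * (v - u)|
      <= eps * `|v - u|.
  move=> cu uv vd us vs _.
  have fuv := integrable_sub_itv cu vd fi.
  rewrite Rintegral_itvB_bnd//; last exact: integrable_sub_itv fi.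
  have ci : leb.-integrable `[u, v] (EFin \o (fun=> f s)).
    by apply: (@itv_within_integrable u v (cst (f s))); apply: continuous_subspaceT; exact: cst_continuous.
  have -> : f s * (v - u) = \int[leb]_(y in `[u, v]) f s.
    by have <- := Rintegral_cst_itv (f s) uv.
  rewrite -RintegralB//.
  rewrite (@ger0_norm _ (v - u)) ?subr_ge0//.
  apply: (@Rintegral_bound u v (fun x => f x - f s)) => //.
    by have := integrableB _ fuv ci; exact.
  move=> x /andP[ux xv]; rewrite distrC; apply: hd.
    by rewrite /= in_itv/= (le_trans cu)// (le_trans xv).
  move: us vs; rewrite !ltr_norml => /andP[h1 h2] /andP[h3 h4].
  by rewrite /ball/= ltr_norml; clear -h1 h2 h3 h4 ux xv; lra.
exists dlt => // y /andP[cy yd] ys.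
have s0 : `|s - s| < dlt by rewrite subrr normr0.
have [sy|ys'] := leP s y; first by apply: key => //; left.
have := key y s cy (ltW ys') sd ys s0 (or_intror erefl).
rewrite -normrN (distrC s y) => /(le_trans _); apply.
by rewrite le_eqVlt; apply/orP; left; apply/eqP; congr `|_|; ring.
Qed.

Lemma deriv_on_uniq c d f s v v' : c < d -> c <= s <= d ->
  deriv_on c d f s v -> deriv_on c d f s v' -> v = v'.
Proof.
move=> cd /andP[cs sd] h h'; apply/eqP; rewrite -subr_eq0 -normr_le0 leNgt.
apply/negP => p; pose e := `|v - v'| / 4.
have e0 : 0 < e by rewrite divr_gt0.
have [d1 d10 h1] := h _ e0; have [d2 d20 h2] := h' _ e0.
have [y [hy yd ys]] : exists y, [/\ c <= y <= d, `|y - s| < Num.min d1 d2 & y != s].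
  pose r := Num.min d1 d2 / 2.
  have r0 : 0 < r by rewrite divr_gt0// lt_min d10.
  have rm : r < Num.min d1 d2 by rewrite /r ltr_pdivrMr// ltr_pMr ?ltr1n// lt_min d10.
  have [sd'|ds] := ltP s d.
    have [m0 mr ms] : [/\ 0 < Num.min r (d - s), Num.min r (d - s) <= r & Num.min r (d - s) <= d - s].
      by rewrite lt_min r0 subr_gt0 sd' !ge_min !lexx orbT.
    exists (s + Num.min r (d - s)); move: (Num.min r (d - s)) m0 mr ms => m m0 mr ms.
    split.
    - by apply/andP; clear -cs sd m0 mr ms; split; lra.
    - by rewrite addrAC subrr add0r gtr0_norm// (le_lt_trans mr).
    - by rewrite -subr_eq0 addrAC subrr add0r gt_eqF.
  have [m0 mr ms] : [/\ 0 < Num.min r (s - c), Num.min r (s - c) <= r & Num.min r (s - c) <= s - c].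
    by rewrite lt_min r0 subr_gt0 (lt_le_trans cd ds) !ge_min !lexx orbT.
  exists (s - Num.min r (s - c)); move: (Num.min r (s - c)) m0 mr ms => m m0 mr ms.
  split.
  - by apply/andP; clear -cs sd m0 mr ms; split; lra.
  - by rewrite addrAC subrr add0r normrN gtr0_norm// (le_lt_trans mr).
  - by rewrite -subr_eq0 addrAC subrr add0r oppr_eq0 gt_eqF.
move: yd; rewrite lt_min => /andP[/(h1 _ hy) a1 /(h2 _ hy) a2].
have ys0 : 0 < `|y - s| by rewrite normr_gt0 subr_eq0.
have : `|(v - v') * (y - s)| <= 2 * e * `|y - s|.
  rewrite (_ : (v - v') * _ = (f y - f s - v' * (y - s)) - (f y - f s - v * (y - s))); last by ring.
  by rewrite (le_trans (ler_normB _ _))// -mulrA mulrDl mul1r lerD.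
rewrite normrM ler_pM2r// /e; clear -p; lra.
Qed.

Lemma deriv_on_cst c d k s : deriv_on c d (fun=> k) s 0.
Proof. by move=> eps e0; exists 1 => // y _ _; rewrite subrr mul0r subr0 normr0 mulr_ge0// ltW. Qed.

Lemma deriv_onB c d f g s v v' : deriv_on c d f s v -> deriv_on c d g s v' ->
  deriv_on c d (fun x => f x - g x) s (v - v').
Proof.
move=> h h' eps e0; have e2 : 0 < eps / 2 by rewrite divr_gt0.
have [d1 d10 h1] := h _ e2; have [d2 d20 h2] := h' _ e2.
exists (Num.min d1 d2); first by rewrite lt_min d10.
move=> y hy; rewrite lt_min => /andP[/(h1 _ hy) a1 /(h2 _ hy) a2].
rewrite [X in `|X|](_ : _ = (f y - f s - v * (y - s)) - (g y - g s - v' * (y - s))); last by ring.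
by rewrite (le_trans (ler_normB _ _))// [eps]splitr mulrDl lerD.
Qed.

Lemma deriv_on_eq c d f g s v : c <= s <= d -> (forall x, c <= x <= d -> f x = g x) ->
  deriv_on c d f s v -> deriv_on c d g s v.
Proof.
move=> hs fg h eps e0; have [d1 d10 h1] := h _ e0; exists d1 => // y hy ys.
by rewrite -!fg//; exact: h1.
Qed.

Lemma Rintegral_eq0 c d f : c < d -> {within `[c, d], continuous f} ->
  (forall x, c <= x <= d -> \int[leb]_(y in `[c, x]) f y = 0) ->
  forall x, c <= x <= d -> f x = 0.
Proof.
move=> cd cf f0 x hx; apply: (deriv_on_uniq cd hx (deriv_on_Rintegral cf hx)).
by apply: deriv_on_eq (deriv_on_cst c d 0 x) => // y hy; rewrite f0.
Qed.

End within_continuity.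

Section fractional_integral.
Context {R : realType}.
Notation leb := (@lebesgue_measure R).
Implicit Types (c d s x y M : R) (f g h : R -> R).

Lemma le_normr_Rintegral_itv c x f k : c <= x ->
  leb.-integrable `[c, x] (EFin \o f) -> leb.-integrable `[c, x] (EFin \o k) ->
  (forall y, c <= y < x -> `|f y| <= k y) ->
  `|\int[leb]_(y in `[c, x]) f y| <= \int[leb]_(y in `[c, x]) k y.
Proof.
move=> cx fi ki fk.
have sub : `[c, x[ `<=` `[c, x] by apply: subset_itvl; rewrite bnd_simp.
have fi' : leb.-integrable `[c, x[ (EFin \o f) by apply: integrableS fi.
have ki' : leb.-integrable `[c, x[ (EFin \o k) by apply: integrableS ki.
have <- := Rintegral_itv_bndo_bndc fi'; have <- := Rintegral_itv_bndo_bndc ki'.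
have mI : measurable (`[c, x[%classic : set R) by exact: measurable_itv.
have h : `|\int[leb]_(x in `[c, x[) f x| <= \int[leb]_(x in `[c, x[) `|f x|.
  by apply: le_normr_Rintegral.
apply: (le_trans h); apply: le_Rintegral => //.
by have := integrable_norm fi'; exact.
Qed.

Lemma itv_integrableZ c x (k : R) f : leb.-integrable `[c, x] (EFin \o f) ->
  leb.-integrable `[c, x] (EFin \o (fun y => k * f y)).
Proof. by move=> fi; have := integrableZl _ k fi; exact. Qed.

Lemma itv_integrableB c x f g : leb.-integrable `[c, x] (EFin \o f) ->
  leb.-integrable `[c, x] (EFin \o g) ->
  leb.-integrable `[c, x] (EFin \o (fun y => f y - g y)).
Proof. by move=> fi gi; have := integrableB _ fi gi; exact. Qed.

Lemma Rintegral_pkerB s c x : 0 < s -> c <= x ->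
  \int[leb]_(y in `[c, x]) pker s (x - y) = (x - c) `^ s / s.
Proof. by move=> s0 cx; rewrite /Rintegral integral_pkerB. Qed.

Lemma integrable_pker_mul s c d x g : 0 < s -> {within `[c, d], continuous g} ->
  x <= d -> leb.-integrable `[c, x] (EFin \o (fun y => pker s (x - y) * g y)).
Proof.
move=> s0 cg xd; have [cx|xc] := leP c x; last first.
  by rewrite set_itv_ge ?bnd_simp -?ltNge//; exact: integrable_set0.
have mI : measurable (`[c, x]%classic : set R) by exact: measurable_itv.
have [M M0 hM] := itv_within_bounded cg.
have gb : [bounded g y | y in `[c, x]].
  exists M; split; first exact: num_real.
  move=> K MK y /=; rewrite in_itv/= => /andP[cy yx].
  by rewrite (le_trans (hM _ _) (ltW MK))// cy (le_trans yx).
have mg : measurable_fun `[c, x] g.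
  apply: measurable_funS (itv_within_measurable cg) => //.
  by apply: subset_itvl; rewrite bnd_simp.
have h : leb.-integrable `[c, x] ((fun y => (pker s (x - y))%:E) \* (EFin \o g))%E.
  by apply: integrableMl => //; exact: integrable_pkerB.
exact: h.
Qed.

(** Split at [x]. The new piece costs [M (x' - x)^s / s]. On [[c, x]] the kernel decreases when [x]
    moves to [x'], so its total change is an explicit integral, again at most [(x' - x)^s / s];
    hence the factor 2. *)
Lemma fracint_holder s c d x x' g M : 0 < s <= 1 -> {within `[c, d], continuous g} ->
  (forall y, c <= y <= d -> `|g y| <= M) -> c <= x -> x <= x' -> x' <= d ->
  `|fracint s c g x' - fracint s c g x| <= 2 * M / s * (x' - x) `^ s.
Proof.
move=> /andP[s0 s1] cg gM cx xx xd.
have cx' := le_trans cx xx; have xd' := le_trans xx xd.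
have ki' : leb.-integrable `[c, x'] (EFin \o (fun y => pker s (x' - y))) by exact: integrable_pkerB.
have ki : leb.-integrable `[c, x] (EFin \o (fun y => pker s (x - y))) by exact: integrable_pkerB.
have gi' : leb.-integrable `[c, x'] (EFin \o (fun y => pker s (x' - y) * g y)).
  exact: integrable_pker_mul cg xd.
have gi : leb.-integrable `[c, x] (EFin \o (fun y => pker s (x - y) * g y)).
  exact: integrable_pker_mul cg xd'.
have gi2 := integrable_sub_itv (lexx c) xx gi'.
have ki2 := integrable_sub_itv (lexx c) xx ki'.
have mI : measurable (`[c, x]%classic : set R) by exact: measurable_itv.
have mJ : measurable (`[x, x']%classic : set R) by exact: measurable_itv.
pose A := \int[leb]_(y in `[c, x]) (pker s (x' - y) * g y - pker s (x - y) * g y).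
pose B := \int[leb]_(y in `[x, x']) (pker s (x' - y) * g y).
have -> : fracint s c g x' - fracint s c g x = A + B.
  have eA : A = \int[leb]_(y in `[c, x]) (pker s (x' - y) * g y) - fracint s c g x.
    by apply: RintegralB.
  have eB := Rintegral_itvB_bnd cx xx gi'.
  rewrite eA /B -eB; have alg (X Y Z : R) : X - Z = Y - Z + (X - Y) by ring.
  exact: alg.
have hB : `|B| <= M * ((x' - x) `^ s / s).
  rewrite -Rintegral_pkerB//.
  have kj : leb.-integrable `[x, x'] (EFin \o (fun y => pker s (x' - y))) by exact: integrable_pkerB.
  have <- : \int[leb]_(y in `[x, x']) (M * pker s (x' - y)) =
    M * \int[leb]_(y in `[x, x']) pker s (x' - y) by apply: RintegralZl.
  apply: le_normr_Rintegral_itv => //.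
  - exact: integrable_sub_itv gi'.
  - exact: itv_integrableZ.
  move=> y /andP[xy yx]; rewrite normrM mulrC (ger0_norm (pker_ge0 _ _)).
  by apply: ler_wpM2r; rewrite ?pker_ge0// gM// (le_trans cx xy) (le_trans (ltW yx)).
have hA : `|A| <= M * (((x - c) `^ s - ((x' - c) `^ s - (x' - x) `^ s)) / s).
  have kd : leb.-integrable `[c, x] (EFin \o (fun y => pker s (x - y) - pker s (x' - y))).
    exact: itv_integrableB.
  have <- : \int[leb]_(y in `[c, x]) (M * (pker s (x - y) - pker s (x' - y))) =
      M * (((x - c) `^ s - ((x' - c) `^ s - (x' - x) `^ s)) / s).
    have -> : \int[leb]_(y in `[c, x]) (M * (pker s (x - y) - pker s (x' - y))) =
      M * \int[leb]_(y in `[c, x]) (pker s (x - y) - pker s (x' - y)) by apply: RintegralZl.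
    have -> : \int[leb]_(y in `[c, x]) (pker s (x - y) - pker s (x' - y)) =
      \int[leb]_(y in `[c, x]) pker s (x - y) - \int[leb]_(y in `[c, x]) pker s (x' - y).
      by apply: RintegralB.
    have e := Rintegral_itvB_bnd cx xx ki'; rewrite !Rintegral_pkerB// in e *.
    congr (_ * _); rewrite !mulrBl -[in RHS]e; ring.
  apply: le_normr_Rintegral_itv => //.
  - exact: itv_integrableB.
  - exact: itv_integrableZ.
  move=> y /andP[cy yx]; rewrite -mulrBl normrM mulrC.
  have yx' := lt_le_trans yx xx.
  have pkd : pker s (x' - y) <= pker s (x - y).
    rewrite !pkerE ?subr_gt0//.
    have e (w : R) : w `^ (s - 1) = (w `^ (1 - s))^-1 by rewrite -powRN opprB.
    rewrite !e lef_pV2 ?posrE ?powR_gt0 ?subr_gt0//.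
    apply: ge0_ler_powR; [by rewrite subr_ge0|by rewrite nnegrE subr_ge0 ltW..|].
    by rewrite lerD2r.
  rewrite distrC (@ger0_norm _ (_ - _)) ?subr_ge0//.
  apply: ler_wpM2r; first by rewrite subr_ge0.
  by rewrite gM// cy ltW// (lt_le_trans yx').
have M0 : 0 <= M by apply: le_trans (gM x _); rewrite ?cx.
have hp : (x - c) `^ s <= (x' - c) `^ s.
  apply: ge0_ler_powR; [exact: ltW|by rewrite nnegrE subr_ge0..|].
  by rewrite lerD2r.
apply: (le_trans (ler_normD _ _)); apply: (le_trans (lerD hA hB)).
rewrite -mulrDr (_ : 2 * M / s * _ = M * (2 * (x' - x) `^ s / s)); last by ring.
rewrite ler_wpM2l// -mulrDl ler_pM2r ?invr_gt0//; clear -hp; lra.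
Qed.

Lemma fracint_within_continuous s c d g : 0 < s <= 1 -> {within `[c, d], continuous g} ->
  {within `[c, d], continuous (fracint s c g)}.
Proof.
move=> /andP[s0 s1] cg; have [M M0 gM] := itv_within_bounded cg.
apply/within_continuousP => x /=; rewrite in_itv/= => /andP[cx xd] eps e0.
pose K := 2 * M / s + 1.
have K0 : 0 < K by rewrite ltr_wpDl// divr_ge0 ?mulr_ge0// ltW.
have Ke : 0 < eps / K by rewrite divr_gt0.
exists ((eps / K) `^ s^-1); first by rewrite powR_gt0.
move=> y /=; rewrite in_itv/= /ball/= => /andP[cy yd] xy.
have key (u v : R) : c <= u -> u <= v -> v <= d -> `|v - u| < (eps / K) `^ s^-1 ->
    `|fracint s c g v - fracint s c g u| <= eps.
  move=> cu uv vd uvd; rewrite (le_trans (fracint_holder _ cg gM cu uv vd)) ?s0//.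
  move: uvd; rewrite ger0_norm ?subr_ge0// => uvd.
  have : (v - u) `^ s <= eps / K.
    rewrite (_ : eps / K = ((eps / K) `^ s^-1) `^ s); last first.
      by rewrite -powRrM mulVf ?gt_eqF// powRr1// ltW.
    by apply: ge0_ler_powR; [exact: ltW|rewrite nnegrE subr_ge0|rewrite nnegrE powR_ge0|exact: ltW].
  rewrite ler_pdivlMr// mulrC; apply: le_trans; rewrite ler_wpM2r ?powR_ge0//.
  by rewrite /K lerDl.
have [xley|yltx] := leP x y; first by rewrite distrC; apply: key => //; rewrite distrC.
by apply: key => //; exact: ltW.
Qed.

Lemma fracint1 c d x g : {within `[c, d], continuous g} -> x <= d ->
  fracint 1 c g x = \int[leb]_(y in `[c, x]) g y.
Proof.
move=> cg xd.
have sub : `[c, x[ `<=` `[c, x] by apply: subset_itvl; rewrite bnd_simp.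
have i1 := integrable_pker_mul ltr01 cg xd.
have i2 := integrable_sub_itv (lexx c) xd (itv_within_integrable cg).
have j1 : leb.-integrable `[c, x[ (EFin \o (fun y => pker 1 (x - y) * g y)).
  by apply: integrableS i1.
have j2 : leb.-integrable `[c, x[ (EFin \o g) by apply: integrableS i2.
have <- := Rintegral_itv_bndo_bndc j2; rewrite /fracint.
have <- := Rintegral_itv_bndo_bndc j1.
apply: eq_Rintegral => y; rewrite inE/= in_itv/= => /andP[_ yx].
by rewrite pkerE ?subr_gt0// subrr powRr0 mul1r.
Qed.

Lemma fracint_sub s c x f g k :
  leb.-integrable `[c, x] (EFin \o (fun y => pker s (x - y) * f y)) ->
  leb.-integrable `[c, x] (EFin \o (fun y => pker s (x - y) * g y)) ->
  fracint s c (fun y => f y - k * g y) x = fracint s c f x - k * fracint s c g x.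
Proof.
move=> fi gi.
have mI : measurable (`[c, x]%classic : set R) by exact: measurable_itv.
have kgi : leb.-integrable `[c, x] (EFin \o (fun y => k * (pker s (x - y) * g y))).
  exact: itv_integrableZ.
have <- : \int[leb]_(y in `[c, x]) (k * (pker s (x - y) * g y)) = k * fracint s c g x.
  by apply: RintegralZl.
have <- : \int[leb]_(y in `[c, x]) (pker s (x - y) * f y - k * (pker s (x - y) * g y)) =
   fracint s c f x - \int[leb]_(y in `[c, x]) (k * (pker s (x - y) * g y)).
  by apply: RintegralB.
by apply: eq_Rintegral => y _; ring.
Qed.

Lemma fracint_set1 s c g : fracint s c g c = 0.
Proof. by rewrite /fracint set_itv1 Rintegral_set1. Qed.

End fractional_integral.

(** * Inversion of Caputo derivatives *)

Section caputo_inversion.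
Context {R : realType}.
Notation leb := (@lebesgue_measure R).
Implicit Types (c d s x y M : R) (f g h v phi : R -> R).

(** [Gamma] is a real number extracted from an extended integral, with value 0 if that integral is
    infinite, so positivity requires finiteness too. The integrand is dominated by [t^(z - 1)] up to
    1 and by the exponential density beyond. *)
Lemma Gamma_gt0 z : 0 < z < 1 -> 0 < Gamma z :> R.
Proof.
move=> /andP[z0 z1]; rewrite /Gamma /Rintegral.
pose f (t : R) : \bar R := (t `^ (z - 1) * expR (- t))%:E.
have f0 t : (0 <= f t)%E by rewrite lee_fin mulr_ge0 ?powR_ge0 ?expR_ge0.
have mexp D : measurable_fun D (fun t : R => expR (- t)).
  apply: (@measurable_funS _ _ _ _ setT) => //; apply: measurableT_comp => //.
have mf D : measurable_fun D f.
  apply/measurable_EFinP; apply: measurable_funM; last exact: mexp.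
  apply: (@measurable_funS _ _ _ _ setT) => //; exact: measurable_powR.
have mI : measurable (`]0%R, +oo[%classic : set R) by exact: measurable_itv.
have mJ : measurable (`]0%R, 1%R]%classic : set R) by exact: measurable_itv.
have lo : ((expR (- 1))%:E <= \int[leb]_(t in `]0%R, +oo[) f t)%E.
  apply: (@le_trans _ _ (\int[leb]_(t in `]0%R, 1%R]) f t)%E).
    apply: (@le_trans _ _ (\int[leb]_(t in `]0%R, 1%R]) (expR (- 1))%:E)%E).
      rewrite integral_cst//= [X in (_ <= _ * X)%E](_ : _ = 1%E) ?mule1//.
      by apply: etrans (lebesgue_measure_itv _) _; rewrite /= lte_fin ltr01 sube0.
    apply: ge0_le_integral => //.
    - exact: mf.
    move=> t /=; rewrite in_itv/= => /andP[t0 t1]; rewrite lee_fin -[leLHS]mul1r.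
    apply: ler_pM => //.
      by rewrite -[leLHS](powRr0 t); apply: ger_powR; [rewrite t0|rewrite subr_le0 ltW].
    by rewrite ler_expR lerN2.
  apply: ge0_subset_integral => //; first exact: mf.
  by move=> t /=; rewrite !in_itv/= => /andP[->].
have hi : (\int[leb]_(t in `]0%R, +oo[) f t < +oo)%E.
  pose f1 t : \bar R := (((fun u => (pker z u)%:E) \_ `[0%R, 1%R]) t).
  pose f2 t : \bar R := (exponential_pdf 1 t)%:E.
  have f10 t : (0 <= f1 t)%E by rewrite erestrict_ge0// => ? _; rewrite lee_fin pker_ge0.
  have f20 t : (0 <= f2 t)%E by rewrite lee_fin exponential_pdf_ge0.
  have mf1 : measurable_fun setT f1.
    apply: (measurable_restrictT _ _).1 => //; apply/measurable_EFinP.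
    exact: measurable_pker.
  have mf2 : measurable_fun setT f2.
    by apply/measurable_EFinP; exact: measurable_exponential_pdf.
  apply: (@le_lt_trans _ _ (\int[leb]_t (f1 t + f2 t))%E).
    rewrite [leLHS]integral_mkcond; apply: ge0_le_integral => //.
    - by move=> t _; rewrite erestrict_ge0// => ? _; exact: f0.
    - by apply: (measurable_restrictT _ _).1 => //; exact: mf.
    - exact: emeasurable_funD.
    move=> t _; rewrite patchE; case: ifPn => [|_]; last exact: adde_ge0.
    rewrite inE/= in_itv/= andbT => t0.
    have [t1|t1] := leP t 1.
      rewrite -[leLHS]adde0; apply: leeD => //.
      rewrite /f1 patchE mem_set/= ?in_itv/= ?(ltW t0)// lee_fin pkerE//.
      by rewrite ler_piMr ?powR_ge0// -expR0 ler_expR oppr_le0 ltW.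
    rewrite -[leLHS]add0e; apply: leeD => //.
    rewrite /f2 exponential_pdfE ?(ltW t0)// lee_fin mul1r mulN1r.
    rewrite ler_piMl ?expR_ge0// -[leRHS](powRr0 t); apply: ler_powR; first exact: ltW.
    by rewrite subr_le0 ltW.
  rewrite ge0_integralD// /f1 -!integral_mkcond integral_pker//.
  by rewrite /f2 [X in (_ + X < _)%E](_ : _ = 1%E) ?ltry//; exact: integral_exponential_pdf.
rewrite fine_gt0// hi andbT; apply: lt_le_trans lo; by rewrite lte_fin expR_gt0.
Qed.

Lemma has_deriv_within_deriv_on c d f s (l : R) : has_deriv_within `[c, d] f s l ->
  deriv_on c d f s l.
Proof.
move=> /cvgrPdist_le h eps e0; have := h eps e0.
move=> /nbhs_ballP[dlt /= d0 hd]; exists dlt => // y hy ys.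
have [->|ys0] := eqVneq y s; first by rewrite !subrr mulr0 subr0 normr0 mulr0.
have := hd (y - s); rewrite /ball/= sub0r normrN => /(_ ys).
rewrite subr_eq0 addrC subrK in_itv/= => /(_ (conj ys0 hy)) hh.
have p : y - s != 0 by rewrite subr_eq0.
rewrite (_ : _ - _ = - ((l - (y - s)^-1 * (f y - f s)) * (y - s))); last by field.
by rewrite normrN normrM ler_wpM2r.
Qed.

Lemma caputo_intE gam c g s : 0 < gam < 1 ->
  caputo_int gam c g s = (Gamma (1 - gam))^-1 * fracint (1 - gam) c (fun y => g y - g c) s.
Proof.
move=> /andP[g0 g1]; congr (_ * _); apply: eq_Rintegral => y.
rewrite inE/= in_itv/= /caputo_integrand => /andP[_].
(* At [y = s] both kernels take the default value 0, a nonzero power of 0 on one side and [pker] at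
   0 on the other. *)
rewrite le_eqVlt => /predU1P[->|ys].
  by rewrite subrr pker_le0// powR0 ?mul0r// oppr_eq0 gt_eqF.
by rewrite pkerE ?subr_gt0// (_ : 1 - gam - 1 = - gam)//; ring.
Qed.

Definition caputo_arg gam c g x := if gam == 1 then g x else caputo_int gam c g x.

Lemma is_caputo_deriv_on gam c d g s (l : R) : is_caputo gam c d g s l ->
  deriv_on c d (caputo_arg gam c g) s l.
Proof.
rewrite /is_caputo /caputo_arg; case: ifP => _; first exact: has_deriv_within_deriv_on.
by case=> _; exact: has_deriv_within_deriv_on.
Qed.

(** The difference [D] has derivative [v - v0] at every point, zero almost everywhere, so it is
    constant. Its derivative then vanishes everywhere, which upgrades the almost everywhere identity
    [v = v0]. *)
Lemma caputo_primitive gam c d phi v v0 : c < d ->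
  (forall s, c <= s <= d -> is_caputo gam c d phi s (v s)) ->
  {within `[c, d], continuous v0} ->
  leb.-negligible [set s | c <= s <= d /\ v s != v0 s] ->
  (forall s, c <= s <= d -> v s = v0 s) /\
  (forall x, c <= x <= d -> caputo_arg gam c phi x - caputo_arg gam c phi c =
     \int[leb]_(y in `[c, x]) v0 y).
Proof.
move=> cd hc contv0 neg; set J := caputo_arg gam c phi.
pose D x := J x - \int[leb]_(y in `[c, x]) v0 y.
have hD s : c <= s <= d -> deriv_on c d D s (v s - v0 s).
  move=> hs; apply: deriv_onB; last exact: deriv_on_Rintegral.
  by apply: is_caputo_deriv_on; exact: hc.
have DE x : c <= x <= d -> D x = J c.
  move=> hx; rewrite (@zero_derive_ae_cst R c d D (fun s => v s - v0 s) hD _ x hx).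
    by rewrite /D set_itv1 Rintegral_set1 subr0.
  by apply: negligibleS neg => s /= [hs]; rewrite subr_eq0.
split=> [s hs|x hx]; last by rewrite -(DE x hx) /D; ring.
apply: subr0_eq; apply: (deriv_on_uniq cd hs (hD s hs)).
apply: deriv_on_eq (deriv_on_cst c d (J c) s) => // y hy; by rewrite DE.
Qed.

(** Lebesgue's differentiation theorem for the extension of [f] by zero, whose primitive on the
    whole line vanishes. *)
Lemma Rintegral_eq0_ae c d f : c < d -> leb.-integrable `[c, d] (EFin \o f) ->
  (forall x, c <= x <= d -> \int[leb]_(y in `[c, x]) f y = 0) ->
  leb.-negligible [set x | c <= x <= d /\ f x != 0].
Proof.
move=> cd fi f0; pose f1 := f \_ `[c, d].
have mI : measurable (`[c, d]%classic : set R) by exact: measurable_itv.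
have f1i : leb.-integrable setT (EFin \o f1).
  by have := (@integrable_mkcond _ _ _ leb _ (EFin \o f) mI).1 fi; rewrite restrict_EFin.
have fl : locally_integrable [set: R] f1 by apply: integrable_locally.
have F0 x : \int[leb]_(t in `]-oo, x]) f1 t = 0.
  have [xc|cx] := ltP x c.
    have <- := Rintegral_set0 leb f1; rewrite Rintegral_mkcond [RHS]Rintegral_mkcond.
    apply: eq_Rintegral => y _; rewrite patchE [RHS]patchE in_set0.
    case: ifPn => //; rewrite inE/= in_itv/= => yx.
    rewrite /f1 patchE memNset//= in_itv/= => /andP[cy _].
    by move: (le_lt_trans (le_trans cy yx) xc); rewrite ltxx.
  have hm : c <= Num.min x d <= d by rewrite le_min cx (ltW cd) ge_min lexx orbT.
  rewrite -[RHS](f0 _ hm) Rintegral_mkcond [RHS]Rintegral_mkcond.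
  apply: eq_Rintegral => y _; rewrite !patchE !mem_setE !in_itv/= le_min.
  rewrite /f1 patchE mem_setE in_itv/=.
  by case: (y <= x); case: (c <= y); case: (y <= d).
have := @FTC1Ny R f1 _ fl; case.
  by move=> y; apply: integrableS f1i => //.
move=> N [mN N0 hN]; exists N; split => // x [/= hx fx]; apply: hN => /= -[_].
rewrite (_ : (fun x => _) = cst 0); last by apply/funext => y; exact: F0.
rewrite derive1_cst /f1 patchE mem_setE in_itv/= hx => e.
by rewrite -e eqxx in fx.
Qed.

Lemma integrable_itv_bndo_bndc c x f : leb.-integrable `[c, x[ (EFin \o f) ->
  leb.-integrable `[c, x] (EFin \o f).
Proof.
move=> /integrableP[mf lf]; apply/integrableP; split.
  exact/emeasurable_fun_itv_bndo_bndcP.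
by rewrite -integral_itv_bndo_bndc//; exact: measurableT_comp.
Qed.

(** The inverse kernel [(x - y)^(1 - s)] is bounded, so multiplying by it preserves integrability.
    The two kernels cancel only for [y < x], hence the detour through [[c, x[]. *)
Lemma integrable_pker_mul_inv s c x f : 0 < s < 1 ->
  leb.-integrable `[c, x] (EFin \o (fun y => pker s (x - y) * f y)) ->
  leb.-integrable `[c, x] (EFin \o f).
Proof.
move=> /andP[s0 s1] fi; have [cx|xc] := leP c x; last first.
  by rewrite set_itv_ge ?bnd_simp -?ltNge//; exact: integrable_set0.
apply: integrable_itv_bndo_bndc.
have mI : measurable (`[c, x[%classic : set R) by exact: measurable_itv.
have fi' : leb.-integrable `[c, x[ (EFin \o (fun y => pker s (x - y) * f y)).
  by apply: integrableS fi => //; apply: subset_itvl; rewrite bnd_simp.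
pose k y := (x - y) `^ (1 - s).
have mk : measurable_fun `[c, x[ k.
  apply: (@measurable_funS _ _ _ _ setT) => //.
  apply: (@measurableT_comp _ _ _ _ _ _ (fun u : R => u `^ (1 - s))).
    exact: measurable_powR.
  by apply: measurable_funB => //; exact: measurable_cst.
have kb : [bounded k y | y in `[c, x[].
  exists ((x - c) `^ (1 - s)); split; first exact: num_real.
  move=> K /ltW MK y /=; rewrite in_itv/= => /andP[cy yx].
  rewrite ger0_norm ?powR_ge0// (le_trans _ MK)//.
  apply: ge0_ler_powR; rewrite ?nnegrE ?subr_ge0 ?(ltW s1) ?(ltW yx)//.
  by rewrite lerD2l lerN2.
have h : leb.-integrable `[c, x[ ((EFin \o (fun y => (pker s (x - y) * f y)%R)) \* (EFin \o k))%E.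
  by apply: integrableMl.
apply: eq_integrable h => // y; rewrite inE/= in_itv/= => /andP[cy yx].
rewrite -EFinM /k pkerE ?subr_gt0// mulrAC -powRD; last first.
  by rewrite subr_eq0 [_ == y]gt_eqF ?implybT.
by rewrite (_ : s - 1 + (1 - s) = 0) ?powRr0 ?mul1r//; ring.
Qed.

(** Equal to [1 / Gamma gam] by the relation between Beta and Gamma; this is the form in which
    Abel's identity produces it. *)
Definition caputo_cst gam : R :=
  if gam == 1 then 1 else Gamma (1 - gam) / fine (beta_cst (1 - gam)).

Lemma caputo_cst_gt0 gam : 0 < gam <= 1 -> 0 < caputo_cst gam.
Proof.
move=> /andP[g0 g1]; rewrite /caputo_cst; case: ifPn => // gn1.
have g01 : 0 < 1 - gam < 1.
  rewrite subr_gt0 lt_neqAle gn1 g1/=; clear -g0; lra.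
rewrite divr_gt0 ?Gamma_gt0// fine_gt0// beta_cst_fin// andbT.
by rewrite (lt_le_trans _ (beta_cst_ge1 g01)).
Qed.

Section inv.
Variables (gam c d : R) (phi v : R -> R).
Hypotheses (gam01 : 0 < gam <= 1) (cd : c < d).
Hypothesis hc : forall s, c <= s <= d -> is_caputo gam c d phi s (v s).
Hypothesis vcont : {within `[c, d], continuous v}.

Let phi0 x := phi c + caputo_cst gam * fracint gam c v x.

Let prim x : c <= x <= d -> caputo_arg gam c phi x - caputo_arg gam c phi c =
     \int[leb]_(y in `[c, x]) v y.
Proof.
apply: (@caputo_primitive gam c d phi v v cd hc vcont _).2.
apply: negligibleS (negligible_set0 leb) => s /= [_]; by rewrite eqxx.
Qed.

Let e x := phi x - phi c - caputo_cst gam * fracint gam c v x.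

Lemma caputo_inv_fracint_continuous : {within `[c, d], continuous phi0}.
Proof.
move=> x; apply: cvgD; first exact: cvg_cst.
by apply: cvgMl_tmp; exact: (fracint_within_continuous gam01 vcont).
Qed.

Let inv1 x : gam = 1 -> c <= x <= d -> e x = 0.
Proof.
move=> g1 /[dup] hx /andP[cx xd]; have := prim hx; rewrite /caputo_arg /e /caputo_cst g1 eqxx => ->.
by rewrite (fracint1 vcont)//; ring.
Qed.

(* By Abel's identity for [v], the integral of order [1 - gam] of [e] vanishes;
   by the same identity for [e], so does its primitive. *)
Let inv_integral : gam < 1 -> leb.-integrable `[c, d] (EFin \o e) /\
  forall x, c <= x <= d -> \int[leb]_(y in `[c, x]) e y = 0.
Proof.
move=> g1; have /andP[g0 _] := gam01.
have g01 : 0 < gam < 1 by rewrite g0.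
have g01' : 0 < 1 - gam < 1 by rewrite subr_gt0 g1 ltrBlDr ltrDl.
have [g0' g1'] := andP g01'.
pose f y := phi y - phi c.
have fki y : c <= y <= d ->
    leb.-integrable `[c, y] (EFin \o (fun z => pker (1 - gam) (y - z) * f z)).
  move=> hy; have := hc hy; rewrite /is_caputo lt_eqF// => -[+ _] => /(_ y hy).
  apply: eq_integrable => // z; rewrite inE/= in_itv/= /caputo_integrand => /andP[_].
  rewrite le_eqVlt => /predU1P[->|ys].
    by rewrite subrr pker_le0// powR0 ?mul0r// oppr_eq0 gt_eqF.
  by rewrite pkerE ?subr_gt0// (_ : 1 - gam - 1 = - gam)//; ring.
have cw : {within `[c, d], continuous (fracint gam c v)} := fracint_within_continuous gam01 vcont.
have wki y : c <= y <= d ->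
    leb.-integrable `[c, y] (EFin \o (fun z => pker (1 - gam) (y - z) * fracint gam c v z)).
  by move=> /andP[_ yd]; exact: integrable_pker_mul cw yd.
have fi : leb.-integrable `[c, d] (EFin \o f).
  by apply: (integrable_pker_mul_inv g01'); apply: fki; rewrite lexx ltW.
have ei : leb.-integrable `[c, d] (EFin \o e).
  apply: itv_integrableB => //; apply: itv_integrableZ.
  exact: itv_within_integrable.
have eki y : c <= y <= d ->
    leb.-integrable `[c, y] (EFin \o (fun z => pker (1 - gam) (y - z) * e z)).
  move=> hy; have h := itv_integrableB (fki _ hy) (itv_integrableZ (caputo_cst gam) (wki _ hy)).
  apply: eq_integrable h => // z _; congr EFin; rewrite /e /f; ring.
have bn0 : fine (beta_cst (1 - gam)) != 0.
  rewrite gt_eqF// fine_gt0// beta_cst_fin// andbT.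
  by rewrite (lt_le_trans _ (beta_cst_ge1 g01')).
have bn0' : fine (beta_cst gam) != 0.
  rewrite gt_eqF// fine_gt0// beta_cst_fin// andbT.
  by rewrite (lt_le_trans _ (beta_cst_ge1 g01)).
have Gn0 : Gamma (1 - gam) != 0 by rewrite gt_eqF// Gamma_gt0.
have e0 x : c <= x <= d -> fracint (1 - gam) c e x = 0.
  move=> hx; have /andP[cx xd] := hx.
  rewrite fracint_sub; [|exact: fki|exact: wki].
  have := prim hx; rewrite /caputo_arg lt_eqF// !caputo_intE// fracint_set1 mulr0 subr0 -/f => h.
  move: cx; rewrite le_eqVlt => /predU1P[<-|cx]; first by rewrite !fracint_set1 mulr0 subrr.
  have := @abel_fubini R (1 - gam) c x v g01' cx.
  rewrite (_ : 1 - (1 - gam) = gam); last by ring.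
  move=> ->; first last.
  - by move=> y /andP[_ yx]; apply: (integrable_pker_mul g0 vcont); exact: le_trans xd.
  - exact: integrable_sub_itv (itv_within_integrable vcont).
  rewrite -h /caputo_cst lt_eqF//.
  have alg (A B C : R) : A != 0 -> B != 0 -> C - A / B * (B * (A^-1 * C)) = 0.
    by move=> A0 B0; field; exact/andP.
  exact: alg.
split => // x /andP[cx xd].
move: cx; rewrite le_eqVlt => /predU1P[<-|cx]; first by rewrite set_itv1 Rintegral_set1.
have := @abel_fubini R gam c x e g01 cx.
have -> : fracint gam c (fracint (1 - gam) c e) x = 0.
  apply: (etrans (y := \int[leb]_(y in `[c, x]) 0)); last first.
    by have -> := @Rintegral_cst_itv R c x 0 (ltW cx); rewrite mul0r.
  apply: eq_Rintegral => y; rewrite inE/= in_itv/= => /andP[cy yx].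
  by rewrite e0 ?mulr0// cy (le_trans yx).
move=> h; apply/eqP; rewrite -(mulrI_eq0 _ (mulfI bn0')); apply/eqP.
rewrite -h//; first exact: integrable_sub_itv ei.
by move=> y /andP[cy yx]; apply: eki; rewrite cy (le_trans yx).
Qed.

(** For a [phi] that is not known to be continuous, such as an inner space derivative, the primitive
    of [e] determines [e] only almost everywhere. *)
Lemma caputo_inv_ae : leb.-negligible [set x | c <= x <= d /\ phi x != phi0 x].
Proof.
have eq x : (phi x != phi0 x) = (e x != 0).
  by rewrite /e /phi0 -subr_eq0 opprD addrA.
under eq_set do rewrite eq.
have [g1|g1] := eqVneq gam 1.
  apply: negligibleS (negligible_set0 leb) => x /= [hx].
  by rewrite inv1// eqxx.
have [] := inv_integral; first by rewrite lt_neqAle g1; case/andP: gam01.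
exact: Rintegral_eq0_ae.
Qed.

Lemma caputo_inv : {within `[c, d], continuous phi} ->
  forall x, c <= x <= d -> phi x = phi0 x.
Proof.
move=> cphi x hx; apply: subr0_eq; rewrite /phi0 opprD addrA -/(e x).
have [g1|g1] := eqVneq gam 1; first exact: inv1.
have [] := inv_integral; first by rewrite lt_neqAle g1; case/andP: gam01.
move=> _ h; apply: (Rintegral_eq0 cd _ h hx).
move=> y; apply: cvgB.
  by apply: cvgB; [exact: cphi|exact: cvg_cst].
by apply: cvgMl_tmp; exact: (fracint_within_continuous gam01 vcont).
Qed.

End inv.

End caputo_inversion.

(** * Convolution quadrature *)

Section quadrature.
Context {R : realType}.
Notation leb := (@lebesgue_measure R).
Implicit Types (c d s x y M h C eps : R) (phi : R -> R).

Lemma powR_succ_le s (k : nat) : 0 < s <= 1 -> k.+1%:R `^ s <= k%:R `^ s + 1 :> R.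
Proof.
move=> s01; have /andP[s0 s1] := s01; case: k => [|k].
  by rewrite powR0 ?gt_eqF// add0r powR1.
have k0 : 0 < k.+1%:R :> R by [].
have := powR_le_affine s01 (ltW (divr_gt0 (ltr0n R k.+2) k0)).
rewrite -(ler_pM2l (powR_gt0 s k0)) -powRM// ?divr_ge0//.
rewrite mulrC divfK ?gt_eqF// => /le_trans; apply.
rewrite mulrDr mulr1 lerD2l mulrCA.
have -> : k.+2%:R / k.+1%:R - 1 = k.+1%:R^-1 :> R.
  by rewrite -[k.+2]add1n natrD mulrDl mul1r divff ?gt_eqF//; ring.
rewrite mulr_ile1 ?mulr_ge0 ?powR_ge0 ?(ltW s0)//.
rewrite ler_pdivrMr// mul1r -[leRHS](powRr1 (ltW k0)).
by apply: ler_powR; rewrite ?ler1n.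
Qed.

(** Summation by parts: when [a] varies slowly, the cumulated quantity [E] matters and not the size
    of its increments. *)
Lemma abel_sum_le (a E : nat -> R) eps (i : nat) : E 0%N = 0 ->
  (forall j, 0 <= E j) -> (forall j, (j < i)%N -> `|a j - a j.+1| <= eps) ->
  `|\sum_(j < i) a j * (E j.+1 - E j) - a i * E i| <= eps * \sum_(j < i) E j.+1.
Proof.
move=> E0 Ep; elim: i => [|i IH] ha; first by rewrite !big_ord0 E0 !mulr0 subr0 normr0.
rewrite !big_ord_recr/=.
rewrite (_ : _ - _ = (\sum_(j < i) a j * (E j.+1 - E j) - a i * E i) +
    (a i - a i.+1) * E i.+1); last by ring.
apply: (le_trans (ler_normD _ _)); rewrite [leRHS]mulrDr; apply: lerD.
  by apply: IH => j ji; apply: ha; rewrite ltnS ltnW.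
by rewrite normrM (ger0_norm (Ep _)) ler_wpM2r// ha.
Qed.

(** The kernel is integrated exactly on each cell and only [phi] is frozen, at the right end. The
    singularity therefore costs nothing, and the error is [eps] times the full kernel integral. The
    index [j] counts cells backwards from the end point. *)
Lemma fracint_cells s c d h eps phi (i : nat) : 0 < s -> 0 < h -> c + h * i%:R <= d ->
  {within `[c, d], continuous phi} ->
  (forall x y, c <= x <= d -> c <= y <= d -> `|x - y| <= h -> `|phi x - phi y| <= eps) ->
  `|s * fracint s c phi (c + h * i%:R) -
    \sum_(j < i) phi (c + h * (i - j)%:R) * (h `^ s * (j.+1%:R `^ s - j%:R `^ s))|
  <= eps * (h * i%:R) `^ s.
Proof.
move=> s0 h0 xd cphi osc; set x := c + h * i%:R in xd *.
pose g (k : nat) := c + h * k%:R.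
have gmono k l : (k <= l)%N -> g k <= g l.
  by move=> kl; rewrite lerD2l ler_wpM2l ?(ltW h0)// ler_nat.
have cg k : c <= g k by rewrite lerDl mulr_ge0 ?(ltW h0).
have pi := integrable_pker_mul s0 cphi xd.
have ki : leb.-integrable `[c, x] (EFin \o (fun y => pker s (x - y))).
  exact: (integrable_pkerB s0 (cg i)).
pose P k := \int[leb]_(y in `[c, g k]) (pker s (x - y) * phi y).
pose K k := \int[leb]_(y in `[c, g k]) pker s (x - y).
have KE k : (k <= i)%N -> K k = (x - c) `^ s / s - (x - g k) `^ s / s.
  move=> kx; have := Rintegral_itvB_bnd (cg k) (gmono _ _ kx) ki.
  have gx : g k <= x := gmono _ _ kx.
  rewrite Rintegral_pkerB ?cg// Rintegral_pkerB// -/(K k) => <-; ring.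
have cell k : (k < i)%N -> `|P k.+1 - P k - phi (g k.+1) * (K k.+1 - K k)| <= eps * (K k.+1 - K k).
  move=> kx; have gk1 := gmono _ _ kx; have gk := gmono _ _ (leqnSn k).
  have pik := integrable_sub_itv (lexx c) gk1 pi.
  have kik := integrable_sub_itv (lexx c) gk1 ki.
  have pik' := integrable_sub_itv (cg k) (lexx _) pik.
  have kik' := integrable_sub_itv (cg k) (lexx _) kik.
  rewrite /P /K (Rintegral_itvB_bnd (cg k) gk pik) (Rintegral_itvB_bnd (cg k) gk kik).
  have mI : measurable (`[g k, g k.+1]%classic : set R) by exact: measurable_itv.
  have <- : \int[leb]_(y in `[g k, g k.+1]) (eps * pker s (x - y)) =
      eps * \int[leb]_(y in `[g k, g k.+1]) pker s (x - y) by apply: RintegralZl.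
  have <- : \int[leb]_(y in `[g k, g k.+1]) (phi (g k.+1) * pker s (x - y)) =
      phi (g k.+1) * \int[leb]_(y in `[g k, g k.+1]) pker s (x - y) by apply: RintegralZl.
  have <- : \int[leb]_(y in `[g k, g k.+1]) (pker s (x - y) * phi y - phi (g k.+1) * pker s (x - y)) =
      \int[leb]_(y in `[g k, g k.+1]) (pker s (x - y) * phi y) -
      \int[leb]_(y in `[g k, g k.+1]) (phi (g k.+1) * pker s (x - y)).
    by apply: RintegralB => //; exact: itv_integrableZ.
  apply: le_normr_Rintegral_itv => //.
  - by apply: itv_integrableB => //; exact: itv_integrableZ.
  - exact: itv_integrableZ.
  move=> y /andP[ky yk]; rewrite (mulrC (phi _)) -mulrBr normrM mulrC (ger0_norm (pker_ge0 _ _)).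
  apply: ler_wpM2r; first exact: pker_ge0.
  apply: osc.
  - by rewrite (le_trans (cg k) ky) (le_trans (ltW yk))// (le_trans gk1).
  - by rewrite cg (le_trans gk1).
  rewrite distrC gtr0_norm ?subr_gt0// lerBlDr -lerBlDl; apply: le_trans ky.
  by rewrite /g -natr1 mulrDr mulr1 addrA addrK.
have tele : forall n, (n <= i)%N ->
    `|P n - \sum_(k < n) phi (g k.+1) * (K k.+1 - K k)| <= eps * K n.
  elim=> [_|n IH ni].
    have g0 : g 0%N = c by rewrite /g mulr0 addr0.
    by rewrite big_ord0 subr0 /P /K g0 set_itv1 !Rintegral_set1 normr0 mulr0.
  rewrite big_ord_recr/=.
  rewrite (_ : _ - _ = (P n - \sum_(k < n) phi (g k.+1) * (K k.+1 - K k)) +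
    (P n.+1 - P n - phi (g n.+1) * (K n.+1 - K n))); last by ring.
  apply: (le_trans (ler_normD _ _)).
  have -> : eps * K n.+1 = eps * K n + eps * (K n.+1 - K n) by ring.
  by apply: lerD; [apply: IH; exact: ltnW|exact: cell].
have := tele i (leqnn i).
have Ki : K i = (h * i%:R) `^ s / s.
  rewrite KE// /g -/x subrr powR0 ?gt_eqF// mul0r subr0; congr (_ `^ _ / _).
  by rewrite /x addrAC subrr add0r.
rewrite Ki -[P i]/(fracint s c phi x) => hh.
have -> : \sum_(j < i) phi (c + h * (i - j)%:R) * (h `^ s * (j.+1%:R `^ s - j%:R `^ s)) =
    s * \sum_(k < i) phi (g k.+1) * (K k.+1 - K k).
  rewrite (reindex_inj rev_ord_inj)/= mulr_sumr; apply: eq_bigr => k _.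
  rewrite subKn// subnSK// [RHS]mulrCA; congr (_ * _).
  have ek (l : nat) : (l <= i)%N -> (x - g l) `^ s = h `^ s * (i - l)%:R `^ s.
    move=> li; rewrite -powRM ?(ltW h0)//; congr (_ `^ _).
    by rewrite /x /g natrB//; ring.
  rewrite !KE ?(ltnW (ltn_ord k))// !ek ?(ltnW (ltn_ord k))//.
  by field; rewrite gt_eqF.
rewrite -mulrBr normrM (gtr0_norm s0).
rewrite -(ler_pM2l s0) in hh; apply: (le_trans hh).
by rewrite le_eqVlt; apply/orP; left; apply/eqP; field; rewrite gt_eqF.
Qed.

(** The exact cell weights are now replaced by the coefficients of [(1 - z)^(- s)]. Term by term the
    two may differ, but by the sandwich their partial sums stay within [C] of each other, and
    summation by parts exploits the small oscillation of [phi]. *)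
Lemma convn_bcoef_fracint s C c d h eps M phi (i : nat) : 0 < s <= 1 -> 0 < C ->
  (forall k, C * k%:R `^ s <= bcoef (1 + s) k <= C * k.+1%:R `^ s) ->
  0 < h -> c + h * i%:R <= d ->
  {within `[c, d], continuous phi} ->
  (forall x, c <= x <= d -> `|phi x| <= M) ->
  (forall x y, c <= x <= d -> c <= y <= d -> `|x - y| <= h -> `|phi x - phi y| <= eps) ->
  `|s * C * fracint s c phi (c + h * i%:R) -
    h `^ s * convn (bcoef s) (fun j => phi (c + h * j%:R)) i|
  <= 2 * C * (h * i%:R) `^ s * eps + h `^ s * (M * (C + 1)).
Proof.
move=> s01 C0 sand h0 xd cphi phiM osc; have /andP[s0 s1] := s01.
have hi (k : nat) : (k <= i)%N -> c <= c + h * k%:R <= d.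
  move=> ki; rewrite lerDl mulr_ge0 ?(ltW h0)//=; apply: le_trans xd.
  by rewrite lerD2l ler_wpM2l ?(ltW h0)// ler_nat.
have cells := fracint_cells s0 h0 xd cphi osc.
(* The cumulated difference of the first [j] weights; the sandwich gives its sign and its bound. *)
pose E (j : nat) : R := if j is k.+1 then C * k.+1%:R `^ s - bcoef (1 + s) k else 0.
have E0 j : 0 <= E j.
  by case: j => //= k; rewrite subr_ge0; case/andP: (sand k).
have EU j : E j.+1 <= C * (j.+1%:R `^ s - j%:R `^ s).
  by rewrite /= mulrBr lerD2l lerN2; case/andP: (sand j).
have Ed j : E j.+1 - E j = C * (j.+1%:R `^ s - j%:R `^ s) - bcoef s j.
  case: j => [|j] /=; first by rewrite !bcoef0 subr0 powR0 ?gt_eqF// subr0.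
  rewrite -(sum_bcoef s j.+1) -(sum_bcoef s j) big_ord_recr/=; ring.
have E1 j : E j <= C.
  case: j => [|j]; first exact: ltW.
  apply: (le_trans (EU j)); rewrite ler_piMr ?(ltW C0)// lerBlDl.
  exact: powR_succ_le.
pose a (j : nat) := phi (c + h * (i - j)%:R).
have osca j : (j < i)%N -> `|a j - a j.+1| <= eps.
  move=> ji; apply: osc; try exact: hi (leq_subr _ _).
  have -> : c + h * (i - j)%:R - (c + h * (i - j.+1)%:R) = h.
    by rewrite -(subnSK ji) -natr1; ring.
  by rewrite gtr0_norm.
have ab := @abel_sum_le a E eps i erefl E0 osca.
have SE : \sum_(j < i) E j.+1 <= C * i%:R `^ s.
  elim: (i) => [|n IH]; first by rewrite big_ord0 powR0 ?gt_eqF// mulr0.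
  rewrite big_ord_recr/=; apply: (le_trans (lerD IH (EU n))).
  by rewrite -mulrDr addrC subrK.
have eps0 : 0 <= eps by apply: le_trans (osc c c _ _ _) => //; rewrite ?subrr ?normr0 ?(ltW h0)//;
  have := hi 0%N isT; rewrite mulr0 addr0.
pose X := s * fracint s c phi (c + h * i%:R) -
    \sum_(j < i) phi (c + h * (i - j)%:R) * (h `^ s * (j.+1%:R `^ s - j%:R `^ s)).
pose Y := \sum_(j < i) a j * (E j.+1 - E j) - a i * E i.
(* The convolution has one term more than there are cells, the value of [phi] at [c]; together with
   the end term of the summation by parts it makes the error of order [h^s]. *)
have -> : s * C * fracint s c phi (c + h * i%:R) -
    h `^ s * convn (bcoef s) (fun j => phi (c + h * j%:R)) i =
    C * X + h `^ s * (Y + a i * (E i - bcoef s i)).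
  have -> : convn (bcoef s) (fun j => phi (c + h * j%:R)) i =
      \sum_(j < i) bcoef s j * a j + bcoef s i * a i.
    by rewrite /convn big_ord_recr.
  have -> : Y = \sum_(j < i) (C * (a j * (j.+1%:R `^ s - j%:R `^ s))) -
      \sum_(j < i) bcoef s j * a j - a i * E i.
    rewrite /Y -sumrB; congr (_ - _); apply: eq_bigr => j _; rewrite Ed; ring.
  rewrite /X.
  have -> : \sum_(j < i) phi (c + h * (i - j)%:R) * (h `^ s * (j.+1%:R `^ s - j%:R `^ s)) =
    h `^ s * \sum_(j < i) (a j * (j.+1%:R `^ s - j%:R `^ s)).
    by rewrite mulr_sumr; apply: eq_bigr => j _; rewrite /a; ring.
  rewrite -mulr_sumr; ring.
have hs0 : 0 < h `^ s by rewrite powR_gt0.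
have aM : `|a i| <= M by apply: phiM; apply: hi; rewrite leq_subr.
have M0 : 0 <= M by apply: le_trans aM.
have b1 : bcoef s i <= 1.
  by rewrite -(bcoef0 s); apply: bcoef_nincreasing => //; rewrite ltW.
have b0 : 0 <= bcoef s i by apply: bcoef_ge0; exact: ltW.
have hE : `|E i - bcoef s i| <= C + 1.
  have := E0 i; have := E1 i; rewrite ler_norml; clear -b0 b1 C0 => h1 h2.
  by apply/andP; split; lra.
have h1 : `|C * X| <= C * (eps * (h * i%:R) `^ s).
  by rewrite normrM (gtr0_norm C0) ler_pM2l.
have h2 : `|h `^ s * (Y + a i * (E i - bcoef s i))| <= h `^ s * (eps * (C * i%:R `^ s) + M * (C + 1)).
  rewrite normrM (gtr0_norm hs0) ler_pM2l//; apply: (le_trans (ler_normD _ _)).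
  apply: lerD; first by rewrite (le_trans ab)// ler_wpM2l.
  by rewrite normrM ler_pM.
apply: (le_trans (ler_normD _ _)); apply: (le_trans (lerD h1 h2)).
rewrite le_eqVlt; apply/orP; left; apply/eqP; rewrite powRM ?(ltW h0)//; ring.
Qed.

End quadrature.

(** * Discretization in space *)

Section space.
Context {R : realType}.
Implicit Types (a b c d s q x y M h C eps : R) (phi : R -> R).

Definition grid a b (n i : nat) : R := a + (b - a) / n%:R * i%:R.

(* These bounds force [q = Gamma s], a fact that is not needed. *)
Definition quad_weight s q :=
  0 < q /\ forall k, k%:R `^ s / s <= q * bcoef (1 + s) k <= k.+1%:R `^ s / s.

Lemma quad_weight_ex s : 0 < s <= 1 -> exists q, quad_weight s q.
Proof.
move=> s01; have [C C0 h] := bcoef_sandwich s01; have /andP[s0 _] := s01.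
exists (s * C)^-1; split; first by rewrite invr_gt0 mulr_gt0.
move=> k; have /andP[h1 h2] := h k.
rewrite (_ : _ * bcoef _ _ = bcoef (1 + s) k / C / s); last by field; rewrite !gt_eqF.
rewrite !ler_pM2r ?invr_gt0// ler_pdivlMr// ler_pdivrMr//.
by rewrite ![_ * C]mulrC h1.
Qed.

Lemma quad_error s q c d h eps M phi (i : nat) : 0 < s <= 1 -> quad_weight s q ->
  0 < h -> c + h * i%:R <= d -> {within `[c, d], continuous phi} ->
  (forall x, c <= x <= d -> `|phi x| <= M) ->
  (forall x y, c <= x <= d -> c <= y <= d -> `|x - y| <= h -> `|phi x - phi y| <= eps) ->
  `|q * h `^ s * convn (bcoef s) (fun j => phi (c + h * j%:R)) i - fracint s c phi (c + h * i%:R)|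
  <= 2 / s * (h * i%:R) `^ s * eps + h `^ s * (M * (s^-1 + q)).
Proof.
move=> s01 [q0 sand] h0 xd cphi phiM osc; have /andP[s0 _] := s01.
pose C := (s * q)^-1; have C0 : 0 < C by rewrite invr_gt0 mulr_gt0.
have sandC k : C * k%:R `^ s <= bcoef (1 + s) k <= C * k.+1%:R `^ s.
  have /andP[h1 h2] := sand k.
  rewrite (_ : bcoef (1 + s) k = C * (q * bcoef (1 + s) k * s)); last by rewrite /C; field; rewrite !gt_eqF.
  rewrite !ler_pM2l//; apply/andP; split; first by rewrite -ler_pdivrMr.
  by rewrite -ler_pdivlMr.
have := convn_bcoef_fracint s01 C0 sandC h0 xd cphi phiM osc.
set w := fracint s c phi _; set u := convn _ _ _ => hh.
rewrite (_ : _ - w = - (q * (s * C * w - h `^ s * u))); last first.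
  by rewrite /C; field; rewrite !gt_eqF.
rewrite normrN normrM gtr0_norm//; apply: (le_trans (ler_wpM2l (ltW q0) hh)).
rewrite le_eqVlt; apply/orP; left; apply/eqP; rewrite /C.
by field; rewrite !gt_eqF.
Qed.

Lemma powR_small s eps : 0 < s -> 0 < eps ->
  exists2 h0, 0 < h0 & forall h, 0 < h <= h0 -> h `^ s <= eps.
Proof.
move=> s0 e0; exists (eps `^ s^-1); first by rewrite powR_gt0.
move=> h /andP[h0 hh]; rewrite -[leRHS](powRr1 (ltW e0)) -(mulVf (lt0r_neq0 s0)) powRrM.
by apply: ge0_ler_powR; rewrite ?nnegrE ?powR_ge0// ltW.
Qed.

Lemma within_uniform c d phi eps : {within `[c, d], continuous phi} -> 0 < eps ->
  exists2 h0, 0 < h0 & forall x y, c <= x <= d -> c <= y <= d -> `|x - y| <= h0 ->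
    `|phi x - phi y| <= eps.
Proof.
move=> cphi e0.
have [dl dl0 hd] := compact_within_uniform (@segment_compact _ c d) cphi e0.
exists (dl / 2); first by rewrite divr_gt0.
move=> x y hx hy xy; apply: hd; rewrite /= ?in_itv//.
by rewrite /ball/= (le_lt_trans xy)// ltr_pdivrMr// ltr_pMr// ltr1n.
Qed.

Lemma quad_cvg s q c d phi eps : 0 < s <= 1 -> quad_weight s q -> c <= d ->
  {within `[c, d], continuous phi} -> 0 < eps ->
  exists2 h0, 0 < h0 & forall h (i : nat), 0 < h <= h0 -> c + h * i%:R <= d ->
  `|q * h `^ s * convn (bcoef s) (fun j => phi (c + h * j%:R)) i - fracint s c phi (c + h * i%:R)|
  <= eps.
Proof.
move=> s01 hq cd cphi e0; have /andP[s0 _] := s01; have [q0 _] := hq.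
have [M M0 hM] := itv_within_bounded cphi.
pose L := (d - c) `^ s + 1; have L0 : 0 < L by rewrite ltr_wpDl// powR_ge0.
pose e1 := eps * s / (4 * L).
have e10 : 0 < e1 by rewrite divr_gt0 ?mulr_gt0.
have [h1 h10 osc] := within_uniform cphi e10.
pose K := M * (s^-1 + q) + 1.
have K0 : 0 < K by rewrite ltr_wpDl// mulr_ge0// addr_ge0 ?invr_ge0 ?(ltW s0) ?(ltW q0).
have e20 : 0 < eps / 2 / K by rewrite !divr_gt0.
have [h2 h20 hs] := powR_small s0 e20.
exists (Num.min h1 h2); first by rewrite lt_min h10.
move=> h i /andP[h0]; rewrite le_min => /andP[hh1 hh2] xd.
have osc' x y : c <= x <= d -> c <= y <= d -> `|x - y| <= h -> `|phi x - phi y| <= e1.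
  by move=> hx hy xy; apply: osc => //; apply: le_trans hh1.
apply: (le_trans (quad_error s01 hq h0 xd cphi hM osc')).
rewrite [leRHS]splitr; apply: lerD.
  have hL : (h * i%:R) `^ s <= L.
    rewrite /L -[leLHS]addr0; apply: lerD => //.
    apply: ge0_ler_powR; rewrite ?nnegrE ?subr_ge0 ?(ltW s0)// ?mulr_ge0 ?(ltW h0)//.
    by rewrite lerBrDl.
  have -> : eps / 2 = 2 / s * L * e1 by rewrite /e1; field; rewrite !gt_eqF.
  by rewrite ler_wpM2r ?(ltW e10)// ler_wpM2l// divr_ge0// ltW.
have := hs h; rewrite h0 hh2 => /(_ isT); rewrite ler_pdivlMr// => /(le_trans _); apply.
by rewrite ler_wpM2l ?powR_ge0// /K lerDl.
Qed.

(** Stability of the quadrature: the weights are nonnegative and their sum is at most the integral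
    of the kernel over a length [h * i.+1]. *)
Lemma convn_norm_le s q h M (e : nat -> R) (i : nat) : 0 < s <= 1 -> quad_weight s q ->
  0 < h -> 0 <= M -> (forall j, (j <= i)%N -> `|e j| <= M) ->
  `|q * h `^ s * convn (bcoef s) e i| <= M * ((h * i.+1%:R) `^ s / s).
Proof.
move=> s01 [q0 sand] h0 M0 eM; have /andP[s0 _] := s01.
have bp k : 0 <= bcoef s k by apply: bcoef_ge0; exact: ltW.
have : `|convn (bcoef s) e i| <= M * bcoef (1 + s) i.
  rewrite -sum_bcoef mulr_sumr; apply: (le_trans (ler_norm_sum _ _ _)).
  apply: ler_sum => j _; rewrite normrM mulrC (ger0_norm (bp _)) ler_wpM2r//.
  by apply: eM; rewrite leq_subr.
have qh : 0 < q * h `^ s by rewrite mulr_gt0 ?powR_gt0.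
rewrite normrM (gtr0_norm qh) -(ler_pM2l qh) => /le_trans; apply.
rewrite powRM ?(ltW h0)// (_ : q * h `^ s * _ = M * (h `^ s * (q * bcoef (1 + s) i))); last by ring.
rewrite ler_wpM2l// -mulrA ler_wpM2l ?powR_ge0//.
by case/andP: (sand i).
Qed.

Lemma convn_bcoef_cst s k (i : nat) : convn (bcoef s) (fun=> k) i = k * bcoef (1 + s) i :> R.
Proof. by rewrite -sum_bcoef /convn -mulr_suml mulrC. Qed.

Section approx.
Variables (be1 be2 q1 q2 a b k1 k2 V : R) (g : R -> R).
Hypotheses (be101 : 0 < be1 <= 1) (be201 : 0 < be2 <= 1).
Hypotheses (hq1 : quad_weight be1 q1) (hq2 : quad_weight be2 q2).
Hypotheses (ab : a < b) (k10 : 0 < k1) (k20 : 0 < k2).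
Hypothesis cg : {within `[a, b], continuous g}.

Let v x := V + k1 * fracint be1 a g x.
Let w x := k2 * fracint be2 a v x.
Hypothesis wb : w b = 0.

Let L := b - a.
Let L0 : 0 < L. Proof. by rewrite subr_gt0. Qed.

Let cvv : {within `[a, b], continuous v}.
Proof.
move=> x; apply: cvgD; first exact: cvg_cst.
by apply: cvgMl_tmp; exact: (fracint_within_continuous be101 cg).
Qed.

Let cw : {within `[a, b], continuous w}.
Proof. by move=> x; apply: cvgMl_tmp; exact: (fracint_within_continuous be201 cvv). Qed.

(* Discarding the value of [g] at the left end makes [frac_op] exact on [wt] for
   every shift [dl]; the shift serves to meet the boundary condition at [b]. *)
Let gh n (j : nat) : R := if j is _.+1 then g (a + L / n%:R * j%:R) else 0.
Let vt n (j : nat) : R := V + k1 * q1 * (L / n%:R) `^ be1 * convn (bcoef be1) (gh n) j.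
Let c2 n := k2 * q2 * (L / n%:R) `^ be2.
(** The shift to the right compensates the left shift in [frac_op]; the node values lag by one step,
    which costs one modulus of continuity of [w]. *)
Let wt n dl (i : nat) : R := if i is i'.+1 then c2 n * convn (bcoef be2) (fun j => vt n j + dl) i' else 0.

(** The exponents add up: only [(1 - z)^(- be1)^(-1)] is left to act on [vt + dl]. It returns [gh]
    from the convolution part, and turns the constant [V + dl] into a multiple of [bcoef (1 - be1)].
    As [gh 0 = 0], that multiple is exactly the term carried by [wt 1]. *)
Let frac_op_wt n dl (i : nat) : frac_op be1 (be1 + be2) (wt n dl) i =
  c2 n * (k1 * q1 * (L / n%:R) `^ be1) * gh n i.
Proof.
rewrite /frac_op convn_shift// /=.
rewrite (_ : convn _ _ i = c2 n * convn (bcoef (- (be1 + be2))) (convn (bcoef be2) (fun j => vt n j + dl)) i); last first.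
  by rewrite -convnZr; apply: eq_convn.
rewrite convnA (@eq_convn _ _ (bcoef (- be1)) _ (fun j => (V + dl) + (k1 * q1 * (L / n%:R) `^ be1) * convn (bcoef be1) (gh n) j)); first last.
- by move=> k _; rewrite /vt; ring.
- by move=> k _; rewrite convn_bcoef; congr bcoef; ring.
rewrite convnDr convnZr convnA convn_bcoef_cst.
rewrite (_ : convn _ (gh n) i = gh n i); last first.
  rewrite -[RHS](convn_delta (gh n) i); apply: eq_convn => // k _.
  by rewrite convn_bcoef addNr bcoef_zero.
rewrite /convn big_ord1/= bcoef0 /vt /convn big_ord1/= bcoef0; ring.
Qed.

Let wt_diff n dl i : wt n dl i.+1 = wt n 0 i.+1 + c2 n * dl * bcoef (1 + be2) i.
Proof.
rewrite /wt -mulrA -convn_bcoef_cst -mulrDr -convnDr; congr (_ * _); apply: eq_convn => // k _; ring.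
Qed.

Let wt_cvg eps : 0 < eps -> exists n0, forall n, (n0 <= n)%N -> (1 < n)%N ->
  forall i, (i <= n)%N -> `|wt n 0 i - w (a + L / n%:R * i%:R)| <= eps.
Proof.
move=> e0; have /andP[s10 s11] := be101; have /andP[s20 s21] := be201.
have [q10 _] := hq1; have [q20 _] := hq2.
have [M M0 hM] := itv_within_bounded cg.
(* [K] bounds the amplification by the second convolution. The budget is [eps / 2] for the error of
   [vt], [eps / 4] for the second quadrature and [eps / 4] for the lag of one node. *)
pose K := k2 * ((2 * L) `^ be2 / be2) + 1.
have K0 : 0 < K by rewrite ltr_wpDl// mulr_ge0 ?divr_ge0 ?powR_ge0 ?(ltW k20) ?(ltW s20).
have ea0 : 0 < eps / 4 / K / k1 by rewrite !divr_gt0.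
have [h1 h10 Q1] := quad_cvg be101 hq1 (ltW ab) cg ea0.
have eb0 : 0 < eps / 4 / k2 by rewrite !divr_gt0.
have [h2 h20 Q2] := quad_cvg be201 hq2 (ltW ab) cvv eb0.
have ec0 : 0 < eps / 4 by rewrite !divr_gt0.
have [h3 h30 U] := within_uniform cw ec0.
have P0 : 0 < k1 * q1 * M + 1 by rewrite ltr_wpDl// !mulr_ge0 ?(ltW k10) ?(ltW q10).
have ed0 : 0 < eps / 4 / K / (k1 * q1 * M + 1) by rewrite !divr_gt0.
have [h4 h40 Q4] := powR_small s10 ed0.
pose hh := Num.min (Num.min h1 h2) (Num.min h3 h4).
have hh0 : 0 < hh by rewrite !lt_min h10 h20 h30.
exists (Num.bound (L / hh)) => n nb n1 i hi.
have n0 : 0 < n%:R :> R by rewrite ltr0n ltnW.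
set h := L / n%:R.
have h0 : 0 < h by rewrite divr_gt0.
have : h <= hh.
  rewrite /h ler_pdivrMr// mulrC -ler_pdivrMr//.
  apply: (le_trans (ltW (archimedean.Num.Theory.archi_boundP (ltW (divr_gt0 L0 hh0))))).
  by rewrite ler_nat.
rewrite !le_min => /andP[/andP[hh1 hh2] /andP[hh3 hh4]].
have hn : a + h * n%:R = b by rewrite /h divfK ?gt_eqF// /L; ring.
have xb (j : nat) : (j <= n)%N -> a + h * j%:R <= b.
  by move=> jn; rewrite -hn lerD2l ler_pM2l// ler_nat.
have xab (j : nat) : (j <= n)%N -> a <= a + h * j%:R <= b.
  by move=> jn; rewrite xb// andbT lerDl mulr_ge0 ?(ltW h0).
case: i hi => [_|i hi] /=.
  by rewrite mulr0 addr0 /w fracint_set1 mulr0 subr0 normr0 ltW.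
have hv j : (j <= n)%N -> `|vt n j - v (a + h * j%:R)| <= eps / 2 / K.
  move=> jn; have := Q1 h j; rewrite h0 hh1 => /(_ isT (xb _ jn)) A1.
  have := Q4 h; rewrite h0 hh4 => /(_ isT) A2.
  have -> : vt n j - v (a + h * j%:R) = k1 * (q1 * h `^ be1 *
      convn (bcoef be1) (fun j : nat => g (a + h * j%:R)) j - fracint be1 a g (a + h * j%:R)) -
      k1 * q1 * h `^ be1 * (bcoef be1 j * g a).
    rewrite /vt /v -/h.
    have -> : convn (bcoef be1) (gh n) j = convn (bcoef be1) (fun j : nat => g (a + h * j%:R)) j - bcoef be1 j * g a.
      by rewrite !(convnC (bcoef be1)) /convn !big_ord_recl/= mulr0 addr0 subn0 mul0r; ring.
    ring.
  have -> : eps / 2 / K = eps / 4 / K + eps / 4 / K by field; rewrite gt_eqF.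
  apply: (le_trans (ler_normB _ _)); apply: lerD.
    by rewrite normrM gtr0_norm// mulrC -ler_pdivlMr.
  move: A2; rewrite ler_pdivlMr// => /(le_trans _); apply.
  have b1 : bcoef be1 j <= 1.
    by rewrite -(bcoef0 be1); apply: bcoef_nincreasing => //; rewrite ltW.
  have b0 : 0 <= bcoef be1 j by apply: bcoef_ge0; exact: ltW.
  have p0 : 0 <= k1 * q1 * h `^ be1 by rewrite !mulr_ge0 ?powR_ge0 ?(ltW k10) ?(ltW q10).
  have ga : `|g a| <= M by apply: hM; rewrite lexx ltW.
  rewrite normrM (ger0_norm p0) normrM (ger0_norm b0) mulrDr mulr1.
  apply: (@le_trans _ _ (k1 * q1 * h `^ be1 * (1 * M))); last first.
    rewrite mul1r (_ : k1 * q1 * h `^ be1 * M = h `^ be1 * (k1 * q1 * M)); last by ring.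
    by rewrite lerDl powR_ge0.
  by rewrite ler_wpM2l// ler_pM.
have := Q2 h i; rewrite h0 hh2 => /(_ isT (xb _ (ltnW hi))) B1.
have eK0 : 0 <= eps / 2 / K by rewrite !divr_ge0 ?ltW.
have B2 := convn_norm_le be201 hq2 h0 eK0 (fun j (ji : (j <= i)%N) => hv j (leq_trans ji (ltnW hi))).
have B3 : `|w (a + h * i%:R) - w (a + h * i.+1%:R)| <= eps / 4.
  apply: U; [exact/xab/ltnW|exact: xab|].
  rewrite -natr1 (_ : _ - _ = - h); last by ring.
  by rewrite normrN gtr0_norm.
rewrite (_ : _ - _ = k2 * (q2 * h `^ be2 * convn (bcoef be2) (fun j => vt n j - v (a + h * j%:R)) i) +
  k2 * (q2 * h `^ be2 * convn (bcoef be2) (fun j => v (a + h * j%:R)) i - fracint be2 a v (a + h * i%:R)) +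
  (w (a + h * i%:R) - w (a + h * i.+1%:R))); last first.
  rewrite /c2 -/h /w (@eq_convn _ _ (bcoef be2) (fun j => vt n j + 0) (fun j => (vt n j - v (a + h * j%:R)) + v (a + h * j%:R)))//; last first.
    by move=> k _; ring.
  rewrite convnDr.
  have alg (k q p X Y I J : R) :
    k * q * p * (X + Y) - k * J = k * (q * p * X) + k * (q * p * Y - I) + (k * I - k * J).
    by ring.
  exact: alg.
have -> : eps = eps / 2 + eps / 4 + eps / 4 by field.
apply: (le_trans (ler_normD _ _)); apply: lerD => //.
apply: (le_trans (ler_normD _ _)); apply: lerD.
  rewrite normrM gtr0_norm//; apply: (le_trans (ler_wpM2l (ltW k20) B2)).
  have hb : (h * i.+1%:R) `^ be2 <= (2 * L) `^ be2.
    apply: ge0_ler_powR; rewrite ?nnegrE ?mulr_ge0 ?(ltW L0) ?(ltW h0) ?(ltW s20)//.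
    have := xb _ hi; rewrite -lerBrDl -/L => /le_trans; apply.
    by rewrite ler_peMl ?(ltW L0)// ler1n.
  rewrite mulrCA -[leRHS](divfK (lt0r_neq0 K0)); apply: ler_wpM2l => //.
  rewrite /K -[leLHS]addr0; apply: lerD => //.
  by rewrite ler_pM2l// ler_pM2r ?invr_gt0.
by rewrite normrM gtr0_norm// mulrC -ler_pdivlMr.
Qed.

Lemma space_approx eps : 0 < eps -> exists n0, forall n, (n0 <= n)%N -> (1 < n)%N ->
  exists wh : nat -> R, exists2 K, 0 < K &
  [/\ wh 0%N = 0, wh n = 0,
      forall i, (0 < i < n)%N -> frac_op be1 (be1 + be2) wh i = K * g (a + (b - a) / n%:R * i%:R) &
      forall i, (0 < i < n)%N -> `|wh i - w (a + (b - a) / n%:R * i%:R)| <= eps].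
Proof.
move=> e0; have e20 : 0 < eps / 2 by rewrite divr_gt0.
have [n0 hn0] := wt_cvg e20; exists n0 => n nn n1; have {}hn0 := hn0 n nn n1.
have /andP[s10 s11] := be101; have /andP[s20 s21] := be201.
have [q10 _] := hq1; have [q20 _] := hq2.
have n0' : 0 < n%:R :> R by rewrite ltr0n ltnW.
have c20 : 0 < c2 n by rewrite !mulr_gt0 ?powR_gt0 ?divr_gt0.
have b2 k : 0 < bcoef (1 + be2) k by rewrite bcoef_gt0// addr_gt0.
(* [dl] cancels the value at node [n], which is at most [eps / 2] since [w b = 0]. The response to
   [dl] is proportional to the nondecreasing [bcoef (1 + be2)], so no earlier node moves by more. *)
pose dl := - wt n 0 n / (c2 n * bcoef (1 + be2) n.-1).
exists (wt n dl), (c2 n * (k1 * q1 * (L / n%:R) `^ be1)).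
  by rewrite !mulr_gt0 ?powR_gt0 ?divr_gt0.
have nS : n = n.-1.+1 by rewrite prednK// ltnW.
have wn : wt n dl n.-1.+1 = 0.
  by rewrite wt_diff -nS /dl; field; rewrite !gt_eqF.
have eb : `|wt n 0 n| <= eps / 2.
  have := hn0 n (leqnn n); rewrite divfK ?gt_eqF// (_ : a + L = b); last by rewrite /L; ring.
  by rewrite wb subr0.
split => //.
- by rewrite {2}nS.
- by move=> [//|i] _; rewrite frac_op_wt.
move=> [//|i] /andP[_ hi]; rewrite wt_diff addrAC [eps]splitr.
apply: (le_trans (ler_normD _ _)); apply: lerD; first exact/hn0/ltnW.
apply: le_trans eb; rewrite /dl.
have cE (c W X Y : R) : c != 0 -> Y != 0 -> c * (- W / (c * Y)) * X = - (W * (X / Y)).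
  by move=> ? ?; field; exact/andP.
rewrite cE ?gt_eqF//.
rewrite normrN normrM ler_piMr// ger0_norm ?divr_ge0 ?(ltW (b2 _))// ler_pdivrMr// mul1r.
by apply: bcoef_ndecreasing; [rewrite lerDl ltW|rewrite -ltnS -nS ltnW].
Qed.

Lemma space_step nu lam (G Ph : R -> R) : 1 < be1 + be2 <= 2 -> 0 < nu -> 0 <= lam ->
  (forall x, a < x < b -> G x = nu * g x + Ph x) ->
  (forall x, a < x < b -> Ph x * w x <= 0) ->
  (forall eps, 0 < eps -> exists2 eta, 0 < eta &
     forall x, a < x < b -> `|w x| <= eta -> `|Ph x| <= eps) ->
  forall eps, 0 < eps -> exists n0, forall n, (n0 <= n)%N -> (1 < n)%N ->
    gridnorm be1 n (fun i => w (grid a b n i)) <=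
    gridnorm be1 n (fun i => w (grid a b n i) - lam * G (grid a b n i)) + eps * gridnorm1 be1 n.
Proof.
move=> g12 nu0 lam0 hG hPw hPs eps e0.
have l1 : 0 < lam + 1 by rewrite ltr_wpDl.
have e1 : 0 < eps / 3 / (lam + 1) by rewrite !divr_gt0.
have [eta eta0 heta] := hPs _ e1.
have e2 : 0 < Num.min eta (eps / 3) by rewrite lt_min eta0 divr_gt0.
have [n0 hn0] := space_approx e2; exists n0 => n nn n1; set x := grid a b n.
have [wh [K K0 [w0 wn hA hw]]] := hn0 n nn n1.
have x_in i : (0 < i < n)%N -> a < x i < b.
  move=> /andP[i0 ilt]; have np : 0 < n%:R :> R by rewrite ltr0n ltnW.
  have hp : 0 < (b - a) / n%:R by rewrite divr_gt0.
  rewrite /x /grid ltrDl mulr_gt0 ?ltr0n//= -ltrBrDl mulrAC ltr_pdivrMr// ltr_pM2l//.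
  by rewrite ltr_nat.
(* [F] discards [Ph] where it has the sign of [wh]: there [w] is at most [eta],
   so that [Ph] is small. *)
pose F i := if (0 < i < n)%N && (Ph (x i) * wh i <= 0) && (wh i != 0) then lam * Ph (x i) else 0.
have hF i : (0 < i < n)%N -> F i * wh i <= 0 /\ (wh i = 0 -> F i = 0).
  move=> hi; rewrite /F hi /=; split; last by move=> ->; rewrite eqxx andbF.
  by case: ifP => [/andP[h _]|]; rewrite ?mul0r// -mulrA mulr_ge0_le0.
(* This [th] turns [frac_op wh = K * g] into [lam * nu * g]. The three thirds of [eps] pay for the
   two exchanges of [w] with [wh] and for the exchange of [lam * Ph] with [F]. *)
have th0 : 0 <= lam * nu / K by rewrite divr_ge0 ?mulr_ge0 ?(ltW nu0) ?(ltW K0).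
have step := gridnorm_accretive be101 g12 n1 th0 w0 wn hF.
have e30 : 0 <= eps / 3 by rewrite divr_ge0 ?ltW.
have near1 : gridnorm be1 n (fun i => w (x i)) <= gridnorm be1 n wh + eps / 3 * gridnorm1 be1 n.
  apply: gridnorm_near => // i hi; rewrite distrC (le_trans (hw i hi))// ge_min lexx orbT//.
have near2 : gridnorm be1 n (fun i => wh i - lam * nu / K * frac_op be1 (be1 + be2) wh i - F i) <=
    gridnorm be1 n (fun i => w (x i) - lam * G (x i)) + (eps / 3 + eps / 3) * gridnorm1 be1 n.
  apply: gridnorm_near => //; first by rewrite addr_ge0.
  move=> i hi; have hwi := hw i hi.
  rewrite hA// hG ?x_in// -/(x i).
  rewrite (_ : _ - _ = (wh i - w (x i)) + (lam * Ph (x i) - F i)); last by field; rewrite gt_eqF.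
  apply: (le_trans (ler_normD _ _)); apply: lerD.
    by rewrite (le_trans hwi)// ge_min lexx orbT.
  have small : `|w (x i)| <= eta -> `|lam * Ph (x i)| <= eps / 3.
    move=> wxe; have := heta _ (x_in _ hi) wxe; rewrite ler_pdivlMr// mulrDr mulr1 mulrC.
    rewrite normrM (ger0_norm lam0) => h; apply: le_trans h.
    by rewrite lerDl.
  rewrite /F hi /=; case: ifPn => [_|]; first by rewrite subrr normr0.
  rewrite subr0 negb_and negbK -ltNge => hh; apply: small.
  have hPx := hPw _ (x_in _ hi).
  have hwe : `|wh i - w (x i)| <= eta by rewrite (le_trans hwi)// ge_min lexx.
  (* Either [wh] is 0, or it has the strict sign of [Ph] while [w] has the opposite sign or
     vanishes; in both cases [|w| <= |wh - w|]. *)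
  apply: le_trans hwe; case/orP: hh => [hp|/eqP ->]; last by rewrite sub0r normrN.
  have [pw|pw] := ltP 0 (Ph (x i)).
    have h1 : 0 < wh i by move: hp; rewrite pmulr_rgt0.
    have h2 : w (x i) <= 0 by move: hPx; rewrite pmulr_rle0.
    by rewrite ler0_norm// (le_trans _ (ler_norm _))// lerDr ltW.
  have pw' : Ph (x i) < 0.
    rewrite lt_neqAle pw andbT; apply/eqP => p0; by rewrite p0 mul0r ltxx in hp.
  have h1 : wh i < 0 by move: hp; rewrite nmulr_rgt0.
  have h2 : 0 <= w (x i) by move: hPx; rewrite nmulr_rle0.
  rewrite ger0_norm// -normrN (le_trans _ (ler_norm _))// opprB lerDl oppr_ge0 ltW//.
have -> : eps * gridnorm1 be1 n = (eps / 3 + eps / 3) * gridnorm1 be1 n + eps / 3 * gridnorm1 be1 n by field.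
apply: (le_trans near1); rewrite addrA lerD2r; exact: le_trans step near2.
Qed.

End approx.
End space.

(** * The time recursion *)

Section vanish.
Context {R : realType}.
Implicit Types (a b x : R) (f : R -> R).

Lemma grid_itv a b n i : a < b -> (0 < n)%N -> (i <= n)%N -> a <= grid a b n i <= b.
Proof.
move=> ab n0 ni; have np : 0 < n%:R :> R by rewrite ltr0n.
have L0 : 0 < b - a by rewrite subr_gt0.
rewrite /grid lerDl mulr_ge0 ?divr_ge0 ?(ltW L0)//= -lerBrDl mulrAC.
by rewrite ler_pdivrMr// ler_pM2l// ler_nat.
Qed.

(** If [f x > 0], then [f >= f x / 2] on a cell of relative length [1/k], which contains about
    [n / k] nodes. The lower bound of the norm and [bcoef_mul_le] then keep its ratio to [gridnorm1]
    above a constant depending on [k] alone. *)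
Lemma gridnorm_vanish_le be a b f : 0 < be <= 1 -> a < b -> {within `[a, b], continuous f} ->
  (forall eps, 0 < eps -> exists n0, forall n, (n0 <= n)%N -> (1 < n)%N ->
     gridnorm be n (fun i => f (grid a b n i)) <= eps * gridnorm1 be n) ->
  forall x, a <= x < b -> f x <= 0.
Proof.
move=> be01 ab cf hn x /andP[ax xb]; rewrite leNgt; apply/negP => fx.
have L0 : 0 < b - a by rewrite subr_gt0.
pose mu := f x / 2; have mu0 : 0 < mu by rewrite divr_gt0.
have [dl dl0 hd] := within_uniform cf mu0.
have [k k0' kd] : exists2 k : nat, (0 < k)%N & (b - a) / k%:R <= dl.
  exists (Num.bound ((b - a) / dl)).+1 => //.
  rewrite ler_pdivrMr// mulrC -ler_pdivrMr// -natr1.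
  apply: (le_trans (ltW (archimedean.Num.Theory.archi_boundP (ltW (divr_gt0 L0 dl0))))).
  by rewrite lerDl.
have k0 : 0 < k%:R :> R by rewrite ltr0n.
have h0 : 0 < (b - a) / k%:R by rewrite divr_gt0.
have z0 : 0 <= (x - a) / ((b - a) / k%:R) by rewrite divr_ge0 ?subr_ge0 ?(ltW h0).
have [c c1 c2] : exists2 c : nat, c%:R * ((b - a) / k%:R) <= x - a &
    x - a < c.+1%:R * ((b - a) / k%:R).
  have /andP[c1 c2] := archimedean.Num.Theory.truncn_itv z0.
  by exists (Num.trunc ((x - a) / ((b - a) / k%:R)));
    [rewrite -ler_pdivlMr|rewrite -ltr_pdivrMr].
have ck : (c < k)%N.
  rewrite -(ltr_nat R) -(ltr_pM2r h0) (le_lt_trans c1)// mulrC divfK ?gt_eqF//.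
  by rewrite ltrD2r.
(* The 32 is the 2 of [gridnorm1], the 4 of [bcoef_mul_le] and a spare 4; the contradiction is
   [mu * (s - 1) <= mu * s / 4] with [s >= 2]. *)
have e0 : 0 < mu / (32 * k%:R) by rewrite divr_gt0 ?mulr_gt0.
have [n0 hn0] := hn _ e0.
(* With [n] a multiple of [k] the cell ends are nodes, and exactly [s - 1] nodes lie strictly inside
   a cell. *)
pose s := n0.+2; pose n := (k * s)%N.
have sn : (s <= n)%N by rewrite leq_pmull.
have n0n : (n0 <= n)%N by by apply: leq_trans sn; rewrite /s leqW.
have n1 : (1 < n)%N by apply: leq_trans sn.
have csn : (c * s + s <= n)%N by rewrite addnC -mulSn leq_mul2r ck orbT.
have := hn0 n n0n n1.
have s0 : 0 < s%:R :> R by [].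
have nE : n%:R = k%:R * s%:R :> R by rewrite /n natrM.
pose P i := (c * s < i < c * s + s)%N.
have hP i : P i -> mu <= f (grid a b n i).
  move=> /andP[i1 i2].
  have iN : (i <= n)%N by apply: leq_trans csn; exact: ltnW.
  have g1 : grid a b n i - a = (i%:R / s%:R) * ((b - a) / k%:R).
    by rewrite /grid nE; field; rewrite !gt_eqF.
  have j1 : c%:R <= i%:R / s%:R :> R by rewrite ler_pdivlMr// -natrM ler_nat ltnW.
  have j2 : i%:R / s%:R <= c.+1%:R :> R.
    by rewrite ler_pdivrMr// -natrM ler_nat mulSn addnC ltnW.
  have {}j1 := ler_wpM2r (ltW h0) j1; have {}j2 := ler_wpM2r (ltW h0) j2.
  have : `|f x - f (grid a b n i)| <= mu.
    apply: hd; first by rewrite ax ltW.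
      by apply: grid_itv => //; exact: ltnW.
    apply: le_trans kd; rewrite -natr1 mulrDl mul1r in c2 j2.
    rewrite ler_norml; move: c1 c2 j1 j2; rewrite -g1.
    move: ((b - a) / k%:R) (grid a b n i) (c%:R * _) => H g C.
    by clear => *; apply/andP; split; lra.
  rewrite ler_norml => /andP[_]; rewrite /mu; clear; lra.
have hP0 i : P i -> 0 <= f (grid a b n i) by move=> /hP; apply: le_trans; exact: ltW.
move=> /(le_trans (gridnorm_lower n be01 hP0)).
have B0 : 0 < bcoef (2 - be) n.
  by rewrite bcoef_gt0// subr_gt0 (le_lt_trans (proj2 (andP be01)))// ltr1n.
rewrite -mulr_suml ler_pdivrMr//.
have cnt : mu * n0.+1%:R <= \sum_(1 <= i < n | P i) f (grid a b n i).
  apply: (@le_trans _ _ (\sum_(1 <= i < n | P i) mu)); last exact: ler_sum.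
  rewrite (_ : \sum_(_ <= _ < _ | _) mu = \sum_((c * s).+1 <= i < (c * s + s)) mu); last first.
    rewrite [RHS](big_nat_widenl _ 1)//= [RHS](big_nat_widen _ _ n)//=.
  rewrite sumr_const_nat -[mu *+ _]mulr_natr.
  by rewrite ler_pM2l// ler_nat subnS addKn.
move=> /(le_trans cnt).
have -> : mu / (32 * k%:R) * gridnorm1 be n * bcoef (2 - be) n =
  mu / (32 * k%:R) * 2 * (bcoef (1 + be) n * bcoef (2 - be) n) by rewrite /gridnorm1 !mulrA.
move=> hh; have := le_trans hh (ler_wpM2l _ (bcoef_mul_le be01 (ltnW n1))).
have e2 : 0 <= mu / (32 * k%:R) * 2 by rewrite mulr_ge0// ltW.
move=> /(_ e2).
have -> : mu / (32 * k%:R) * 2 * (4 * n%:R) = mu * (s%:R / 4) by rewrite nE; field; rewrite gt_eqF.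
rewrite ler_pM2l// /s -natr1.
have : 1 <= n0.+1%:R :> R by rewrite ler1n.
clear; lra.
Qed.

Lemma gridnorm_vanish be a b f : 0 < be <= 1 -> a < b -> {within `[a, b], continuous f} ->
  (forall eps, 0 < eps -> exists n0, forall n, (n0 <= n)%N -> (1 < n)%N ->
     gridnorm be n (fun i => f (grid a b n i)) <= eps * gridnorm1 be n) ->
  forall x, a <= x < b -> f x = 0.
Proof.
move=> be01 ab cf hn x hx; apply/eqP; rewrite eq_le (gridnorm_vanish_le be01 ab cf hn hx)/=.
rewrite -oppr_le0; apply: (@gridnorm_vanish_le be a b (fun y => - f y) be01 ab _ _ x hx).
  by move=> y; apply: cvgN; exact: cf.
move=> eps e0; have [n0 hn0] := hn eps e0; exists n0 => n nn n1.
apply: le_trans (hn0 n nn n1); rewrite /gridnorm addrC.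
rewrite (_ : (fun i => - - f _) = fun i => f (grid a b n i))//.
by apply/funext => i; rewrite opprK.
Qed.

End vanish.

(** * Truncated fractional integrals in time *)

Section window.
Context {R : realType}.
Variables (al : R) (m : nat).
Hypotheses (al01 : 0 < al <= 1) (m0 : (0 < m)%N).
Implicit Types (Y : nat -> R).

Let trunc (j : nat) : R := if (j < m)%N then bcoef al j else 0.
Let S := bcoef (1 + al) m.-1.

(** The series [1 - (1 - z)^al * trunc]. Multiplied by [(1 - z)^(- al)] it leaves precisely the
    discarded tail of that series. *)
Definition window (j : nat) : R := (j == 0%N)%:R - convn (bcoef (- al)) trunc j.

Let bal_ge0 j : 0 <= bcoef al j. Proof. by apply: bcoef_ge0; case/andP: al01 => /ltW. Qed.

Let trunc_ge0 j : 0 <= trunc j. Proof. by rewrite /trunc; case: ifP. Qed.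

Lemma window_lt j : (j < m)%N -> window j = 0.
Proof.
move=> jm; rewrite /window (@eq_convn _ _ (bcoef (- al)) _ (bcoef al))//.
  by rewrite convn_bcoef addNr bcoef_zero subrr.
by move=> k kj; rewrite /trunc (leq_ltn_trans kj jm).
Qed.

(** For [j >= m] each nonzero [trunc i] has [i < m], so it meets a coefficient of [(1 - z)^al] of
    positive index, which is nonpositive. *)
Lemma window_ge0 j : 0 <= window j.
Proof.
have [jm|mj] := ltnP j m; first by rewrite window_lt.
rewrite /window gtn_eqF ?(leq_trans m0)// sub0r oppr_ge0 convnC; apply: sumr_le0 => i _.
rewrite /trunc; case: ifP => [im|]; last by rewrite mul0r.
rewrite mulr_ge0_le0// -subnSK ?(leq_trans im)// bcoef_neg//.
by rewrite lerN2 oppr_le0; case/andP: al01 => /ltW -> ->.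
Qed.

(** Summation divides by [1 - z], and the missing mass is the convolution of [trunc] with the
    nonnegative coefficients of [(1 - z)^(al - 1)]. *)
Lemma sum_window k : \sum_(j < k.+1) window j <= 1.
Proof.
rewrite sumrB; have -> : \sum_(j < k.+1) (j == 0%N :> nat)%:R = 1 :> R.
  by rewrite big_ord_recl big1 ?addr0.
rewrite gerBl -convn1 (@eq_convn _ _ (convn trunc (bcoef (- al))) _ (fun=> 1))//; last first.
  by move=> j _; rewrite convnC.
rewrite -convnA; apply: convn_ge0 => // j _; rewrite convn1 sum_bcoef; apply: bcoef_ge0.
by rewrite subr_ge0; case/andP: al01.
Qed.

Lemma convn_window Y k : convn window (convn (bcoef al) Y) k = convn (bcoef al) Y k - convn trunc Y k.
Proof.
have -> : convn window (convn (bcoef al) Y) k = convn (fun k => (k == 0%N)%:R) (convn (bcoef al) Y) k -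
    convn (convn (bcoef (- al)) trunc) (convn (bcoef al) Y) k.
  by rewrite /convn -sumrB; apply: eq_bigr => j _; rewrite /window mulrBl.
rewrite convn_delta -convnA; congr (_ - _).
rewrite (@eq_convn _ _ (bcoef (- al)) _ (convn (bcoef al) (convn trunc Y))) //; last first.
  by move=> j _; rewrite !convnA (@eq_convn _ _ (convn (bcoef al) trunc) _ Y)// => i _; rewrite convnC.
rewrite convnA (@eq_convn _ _ (fun k => (k == 0%N)%:R) _ (convn trunc Y)) ?convn_delta// => j _.
by rewrite convn_bcoef addNr bcoef_zero.
Qed.

Let sum_trunc k : (m <= k)%N -> \sum_(j < k.+1) trunc j = S.
Proof.
move=> mk; rewrite -big_mkcond/= -(big_ord_widen _ (bcoef al)) ?(leq_trans mk)//.
have h p : (0 < p)%N -> \sum_(j < p) bcoef al j = bcoef (1 + al) p.-1.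
  by case: p => // p _; rewrite sum_bcoef.
exact: h.
Qed.

(** What the window leaves of the discrete integral is a weighted sum of the last [m] values of [Y],
    of total weight [S]. Up to the time-step factor, [S] is the parameter [lam] of the accretivity
    estimate. *)
Lemma convn_trunc_near Y om k : (m <= k)%N -> (forall j, (j < m)%N -> `|Y (k - j)%N - Y k| <= om) ->
  `|convn (bcoef al) Y k - convn window (convn (bcoef al) Y) k - S * Y k| <= S * om.
Proof.
move=> mk hY; rewrite convn_window opprB addrCA subrr addr0.
rewrite -(sum_trunc mk) !mulr_suml /convn -sumrB; apply: (le_trans (ler_norm_sum _ _ _)).
apply: ler_sum => j _; rewrite -mulrBr normrM (ger0_norm (trunc_ge0 _)).
rewrite /trunc; case: ifP => [jm|]; last by rewrite !mul0r.
by rewrite ler_wpM2l// hY.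
Qed.

Lemma window_comparison (X : nat -> R) C0 C1 p : 0 <= C0 -> 0 <= C1 ->
  (forall k, (k < m)%N -> X k <= C0) ->
  (forall k, (m <= k <= p)%N -> X k <= convn window (fun j => X j) k + C1 * S) ->
  forall k, (k <= p)%N -> X k <= C0 + C1 * bcoef (1 + al) k.
Proof.
move=> C00 C10 h0 h1 k; have bp j : 0 <= bcoef (1 + al) j.
  by apply: bcoef_ge0; rewrite addr_ge0//; case/andP: al01 => /ltW.
elim/ltn_ind: k => k IH kp; have [km|mk] := ltnP k m.
  by apply: (le_trans (h0 _ km)); rewrite lerDl mulr_ge0.
apply: le_trans (h1 k _) _; first by rewrite mk.
have h : convn window (fun j => X j) k <= convn window (fun j => C0 + C1 * bcoef (1 + al) j) k.
  rewrite /convn !big_ord_recl/= window_lt// !mul0r !add0r; apply: ler_sum => j _.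
  rewrite ler_wpM2l ?window_ge0// IH//.
    by rewrite ltn_subrL (leq_trans m0 mk).
  by rewrite (leq_trans (leq_subr _ _)).
have e : convn window (fun j => C0 + C1 * bcoef (1 + al) j) k <= C0 + C1 * (bcoef (1 + al) k - S).
  rewrite convnDr convnZr; apply: lerD.
    by rewrite /convn -mulr_suml ler_piMl// sum_window.
  rewrite ler_wpM2l// (@eq_convn _ window window _ (convn (bcoef al) (fun=> 1)))//; last first.
    by move=> j _; rewrite convn1 sum_bcoef.
  by rewrite convn_window !convn1 sum_bcoef sum_trunc.
apply: le_trans (lerD (le_trans h e) (lexx _)) _.
by rewrite le_eqVlt; apply/orP; left; apply/eqP; ring.
Qed.

End window.

Lemma eventually_finite (P : nat -> nat -> Prop) (p : nat) :
  (forall k, (k <= p)%N -> exists n0, forall n, (n0 <= n)%N -> P k n) ->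
  exists n0, forall n, (n0 <= n)%N -> forall k, (k <= p)%N -> P k n.
Proof.
elim: p => [|p IH] h.
  have [n0 hn] := h 0%N (leqnn _); exists n0 => n /hn hn' k.
  by rewrite leqn0 => /eqP ->.
have [n1 h1] := IH (fun k kp => h k (leqW kp)).
have [n2 h2] := h p.+1 (leqnn _).
exists (maxn n1 n2) => n; rewrite geq_max => /andP[/h1 k1 /h2 k2] k.
by rewrite leq_eqVlt => /predU1P[->//|]; rewrite ltnS; exact: k1.
Qed.

Section time.
Context {R : realType}.
Variables (a b T al be1 be2 nu kt k1 k2 M : R) (w G g Ph : R -> R -> R).
Hypotheses (al01 : 0 < al <= 1) (be101 : 0 < be1 <= 1) (be201 : 0 < be2 <= 1).
Hypotheses (g12 : 1 < be1 + be2 <= 2) (ab : a < b) (T0 : 0 < T) (nu0 : 0 < nu).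
Hypotheses (kt0 : 0 < kt) (k10 : 0 < k1) (k20 : 0 < k2).
Hypothesis hwt : forall x t, a <= x <= b -> 0 <= t <= T -> w x t = kt * fracint al 0 (G x) t.
Hypothesis hwx : forall t, 0 <= t <= T -> exists V, forall x, a <= x <= b ->
  w x t = k2 * fracint be2 a (fun y => V + k1 * fracint be1 a (g^~ t) y) x.
Hypothesis hwb : forall t, 0 <= t <= T -> w b t = 0.
Hypothesis cgx : forall t, 0 <= t <= T -> {within `[a, b], continuous (g^~ t)}.
Hypothesis cGt : forall x, a <= x <= b -> {within `[0, T], continuous (G x)}.
Hypothesis GM : forall x t, a <= x <= b -> 0 <= t <= T -> `|G x t| <= M.
Hypothesis Gu : forall eps, 0 < eps -> exists2 h0, 0 < h0 & forall x t t',
  a <= x <= b -> 0 <= t <= T -> 0 <= t' <= T -> `|t - t'| <= h0 -> `|G x t - G x t'| <= eps.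
Hypothesis hG : forall x t, a < x < b -> 0 < t <= T -> G x t = nu * g x t + Ph x t.
Hypothesis hPw : forall x t, a < x < b -> 0 < t <= T -> Ph x t * w x t <= 0.
Hypothesis hPs : forall t, 0 < t <= T -> forall eps, 0 < eps -> exists2 eta, 0 < eta &
  forall x, a < x < b -> `|w x t| <= eta -> `|Ph x t| <= eps.

Lemma space_step_time t lam : 0 < t <= T -> 0 <= lam ->
  forall eps, 0 < eps -> exists n0, forall n, (n0 <= n)%N -> (1 < n)%N ->
    gridnorm be1 n (fun i => w (grid a b n i) t) <=
    gridnorm be1 n (fun i => w (grid a b n i) t - lam * G (grid a b n i) t) + eps * gridnorm1 be1 n.
Proof.
move=> /[dup] ht /andP[t0 tT] lam0 eps e0.
have ht' : 0 <= t <= T by rewrite ltW.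
have [V hV] := hwx ht'.
have [q1 hq1] := quad_weight_ex be101; have [q2 hq2] := quad_weight_ex be201.
have io x : a < x < b -> a <= x <= b by move=> /andP[ax xb]; rewrite !ltW.
have wb : k2 * fracint be2 a (fun y => V + k1 * fracint be1 a (g^~ t) y) b = 0.
  by rewrite -hV ?hwb// lexx ltW.
have [|||n0 hn] := @space_step R be1 be2 q1 q2 a b k1 k2 V (g^~ t) be101 be201 hq1 hq2 ab k10 k20
  (cgx ht') wb nu lam (G^~ t) (Ph^~ t) g12 nu0 lam0 _ _ _ eps e0.
- by move=> x hx; exact: hG.
- by move=> x hx; rewrite -hV ?io//; exact: hPw.
- move=> e' e'0; have [eta eta0 h] := hPs ht e'0; exists eta => // x hx.
  by rewrite -hV ?io//; exact: h.
exists n0 => n nn n1.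
have gi i : (0 < i < n)%N -> a <= grid a b n i <= b.
  by move=> /andP[_ ilt]; apply: grid_itv => //; [exact: ltnW|exact: ltnW].
rewrite (@eq_gridnorm _ _ _ be101 _ (fun i => k2 * fracint be2 a (fun y => V + k1 * fracint be1 a (g^~ t) y) (grid a b n i))); last first.
  by move=> i /gi /hV.
apply: (le_trans (hn n nn n1)); rewrite lerD2r le_eqVlt; apply/orP; left; apply/eqP.
by apply: eq_gridnorm => // i /gi /hV ->.
Qed.

(** The final bound has two parts. The first window contributes about [lam * M], small with [H]; the
    later steps contribute [4 * e] times [ck * bcoef (1 + al) p], a discrete integral of 1 that is
    bounded independently of [tau]. *)
Lemma time_step t0 : 0 < t0 <= T -> forall eps, 0 < eps ->
  exists n0, forall n, (n0 <= n)%N -> (1 < n)%N ->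
    gridnorm be1 n (fun i => w (grid a b n i) t0) <= eps * gridnorm1 be1 n.
Proof.
move=> /andP[t00 t0T] eps eps0.
have [q hq] := quad_weight_ex al01; have [q0 sand] := hq.
have /andP[al0 al1] := al01.
have M0 : 0 <= M by apply: le_trans (GM (x := a) (t := 0) _ _) => //; rewrite lexx ltW.
(* The upper bound of the quadrature weights reaches one step too far, and [tau * p.+1 <= 2 * T]. *)
pose E0 := kt * ((2 * T) `^ al / al).
have E00 : 0 <= E0 by rewrite mulr_ge0 ?divr_ge0 ?powR_ge0 ?(ltW kt0) ?(ltW al0).
pose e := eps / (8 * (E0 + 1)).
have e0 : 0 < e by rewrite divr_gt0// mulr_gt0// ltr_wpDl.
have D0 : 0 < 2 * (M + e + 1) by rewrite mulr_gt0// ltr_wpDl// addr_ge0// ltW.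
have et0 : 0 < eps / (2 * (M + e + 1)) / (kt / al) by rewrite !divr_gt0.
have [H1 H10 hH1] := powR_small al0 et0.
have [H2 H20 hH2] := Gu e0.
have mH0 : 0 < Num.min H1 H2 by rewrite lt_min H10.
have subdivide (r z : R) k : 0 < r -> 0 < z -> exists m : nat, exists tau : R,
    [/\ (k <= m)%N, (0 < m)%N, 0 < tau, tau * m%:R = r & tau <= z].
  move=> r0 z0; pose m := ((Num.bound (r / z)).+1 + k)%N.
  have m0 : 0 < m%:R :> R by rewrite ltr0n.
  exists m, (r / m%:R); split; rewrite ?leq_addl ?divr_gt0 ?divfK ?gt_eqF//.
  rewrite ler_pdivrMr// mulrC -ler_pdivrMr// /m natrD -natr1.
  apply: (le_trans (ltW (archimedean.Num.Theory.archi_boundP (ltW (divr_gt0 r0 z0))))).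
  by rewrite -addrA lerDl addr_ge0.
(* The window length [H] is fixed before the step [tau], so that [lam] stays
   bounded below as [tau] decreases. *)
have [Q [H [_ Q0 H0 HQ]]] := subdivide t0 _ 0%N t00 mH0.
rewrite le_min => /andP[HH1 HH2].
(* A lower bound for [lam] depending on [H] only: [m >= 2] gives [tau * m.-1 >= H / 2]. *)
pose lam0 := kt * ((H / 2) `^ al / al).
have lam00 : 0 < lam0 by rewrite mulr_gt0// divr_gt0// powR_gt0// divr_gt0.
have T'0 : 0 < T `^ al by rewrite powR_gt0.
have le00 : 0 < lam0 * e := mulr_gt0 lam00 e0.
have es0 : 0 < lam0 * e * al / (4 * kt * T `^ al).
  exact: divr_gt0 (mulr_gt0 le00 al0) (mulr_gt0 (mulr_gt0 (ltr0n R 4) kt0) T'0).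
have [H3 H30 hH3] := Gu es0.
have K0 : 0 < M * (al^-1 + q) + 1.
  by rewrite ltr_wpDl// mulr_ge0// addr_ge0 ?invr_ge0 ?(ltW al0) ?(ltW q0).
have es20 : 0 < lam0 * e / (2 * kt * (M * (al^-1 + q) + 1)).
  exact: divr_gt0 le00 (mulr_gt0 (mulr_gt0 (ltr0n R 2) kt0) K0).
have [H4 H40 hH4] := powR_small al0 es20.
have mH20 : 0 < Num.min H3 H4 by rewrite lt_min H30.
have [m [tau [m1 m0 tau0 taum]]] := subdivide H _ 2%N H0 mH20.
rewrite le_min => /andP[tH3 tH4].
have m0' : 0 < m%:R :> R by rewrite ltr0n.
pose p := (Q * m)%N.
have taup : tau * p%:R = t0 by rewrite /p natrM mulrCA taum mulrC.
have tk k : (k <= p)%N -> 0 <= tau * k%:R <= T.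
  move=> kp; rewrite mulr_ge0 ?(ltW tau0)//=; apply: le_trans t0T.
  by rewrite -taup ler_pM2l// ler_nat.
have ta0 : 0 < tau `^ al by rewrite powR_gt0.
pose ck := kt * q * tau `^ al.
have ck0 : 0 < ck by rewrite !mulr_gt0.
pose Y x (j : nat) := G x (0 + tau * j%:R).
pose W k x := ck * convn (bcoef al) (Y x) k.
have hW x k : a <= x <= b -> (k <= p)%N -> `|W k x - w x (tau * k%:R)| <= lam0 * e.
  move=> hx kp; have tkT := tk _ kp; rewrite (hwt hx tkT).
  have tkT' : 0 + tau * k%:R <= T by rewrite add0r; case/andP: tkT.
  have osc t t' : 0 <= t <= T -> 0 <= t' <= T -> `|t - t'| <= tau ->
      `|G x t - G x t'| <= lam0 * e * al / (4 * kt * T `^ al).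
    by move=> ht ht' tt; apply: hH3 => //; exact: le_trans tH3.
  have := quad_error al01 hq tau0 tkT' (cGt hx) (fun t ht => GM hx ht) osc.
  rewrite add0r => qe.
  have -> : W k x - kt * fracint al 0 (G x) (tau * k%:R) =
    kt * (q * tau `^ al * convn (bcoef al) (fun j => G x (0 + tau * j%:R)) k - fracint al 0 (G x) (tau * k%:R)).
    by rewrite /W /ck; ring.
  rewrite normrM (gtr0_norm kt0).
  apply: (le_trans (ler_wpM2l (ltW kt0) qe)).
  have le0E : lam0 * e = kt * (2 / al * T `^ al * (lam0 * e * al / (4 * kt * T `^ al)) + lam0 * e / (2 * kt)).
    by field; rewrite !gt_eqF.
  rewrite [leRHS]le0E.
  rewrite ler_wpM2l ?(ltW kt0)//; apply: lerD.
    rewrite ler_wpM2r ?(ltW es0)// ler_wpM2l ?divr_ge0 ?(ltW al0)//.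
    apply: ge0_ler_powR; rewrite ?nnegrE ?(ltW al0) ?(ltW T0) //; first by case/andP: tkT.
    by case/andP: tkT.
  have := hH4 tau; rewrite tau0 tH4 => /(_ isT) h4.
  have le1E : lam0 * e / (2 * kt) = lam0 * e / (2 * kt * (M * (al^-1 + q) + 1)) * (M * (al^-1 + q) + 1).
    by move: (M * (al^-1 + q) + 1) K0 => K' K'0; field; rewrite !gt_eqF.
  rewrite [leRHS]le1E.
  by apply: ler_pM => //; rewrite ?powR_ge0 ?lerDl// mulr_ge0// addr_ge0 ?invr_ge0 ?(ltW al0) ?(ltW q0).
pose S := bcoef (1 + al) m.-1; pose lam := ck * S.
have S0 : 0 < S by rewrite bcoef_gt0// addr_gt0.
have lamp : 0 < lam by rewrite mulr_gt0.
have lamE : lam = kt * (tau `^ al * (q * S)) by rewrite /lam /ck; ring.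
have lamlo : lam0 <= lam.
  rewrite lamE /lam0 ler_wpM2l ?(ltW kt0)//.
  have /andP[s1 _] := sand m.-1; apply: (@le_trans _ _ (tau `^ al * (m.-1%:R `^ al / al))).
    rewrite mulrA -powRM ?(ltW tau0)// ler_wpM2r ?invr_ge0 ?(ltW al0)//.
    have h1 : 0 <= H / 2 := divr_ge0 (ltW H0) (ler0n R 2).
    have h2 : 0 <= tau * m.-1%:R := mulr_ge0 (ltW tau0) (ler0n R m.-1).
    apply: ge0_ler_powR; [exact: ltW|by rewrite nnegrE|by rewrite nnegrE|].
    rewrite -taum -mulrA ler_wpM2l ?(ltW tau0)// ler_pdivrMr// -natrM ler_nat.
    by case: (m) m1 => [|[|m']]//= _; rewrite muln2 -addnn addSn ltnS addnS leq_addr.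
  by rewrite ler_wpM2l// ltW.
have lamhi : lam * (M + e) <= eps / 2.
  have l1 : lam <= kt / al * H `^ al.
    have /andP[_ s1] := sand m.-1.
    rewrite lamE -mulrA ler_wpM2l ?(ltW kt0)//.
    apply: (le_trans (ler_wpM2l (ltW ta0) s1)).
    by rewrite prednK// mulrA -powRM ?(ltW tau0)// taum mulrC.
  have := hH1 H; rewrite H0 HH1 => /(_ isT); rewrite ler_pdivlMr ?divr_gt0// mulrC => h1.
  have {h1}l1 := le_trans l1 h1.
  have Me : 0 <= M + e by rewrite addr_ge0// ltW.
  apply: (le_trans (ler_wpM2r Me l1)).
  rewrite mulrAC ler_pdivrMr// (_ : eps / 2 * _ = eps * (M + e + 1)); last by field.
  by rewrite ler_wpM2l ?(ltW eps0)// lerDl.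
have le0 : 0 < lam * e by rewrite mulr_gt0.
(* The number [p] of time steps is already fixed, so a single [n0] serves all of them. *)
have [n0 hn0] : exists n0, forall n, (n0 <= n)%N -> forall k, (k <= p)%N ->
    (m <= k)%N -> (1 < n)%N ->
    gridnorm be1 n (fun i => w (grid a b n i) (tau * k%:R)) <=
    gridnorm be1 n (fun i => w (grid a b n i) (tau * k%:R) - lam * G (grid a b n i) (tau * k%:R)) +
      lam * e * gridnorm1 be1 n.
  apply: eventually_finite => k kp; have [km|mk] := ltnP k m; first by exists 0%N.
  have tkp : 0 < tau * k%:R <= T.
    have /andP[_ ->] := tk _ kp; rewrite andbT mulr_gt0// ltr0n (leq_trans m0)//.
  have [n0 hn] := space_step_time tkp (ltW lamp) le0.
  by exists n0 => n nn _; exact: hn.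
exists n0 => n nn n1; have {}hn0 := hn0 n nn.
have gi i : (0 < i < n)%N -> a <= grid a b n i <= b.
  by move=> /andP[_ ilt]; apply: grid_itv => //; exact: ltnW.
have N1 := gridnorm1_ge0 n be101.
pose X k := gridnorm be1 n (fun i => W k (grid a b n i)).
have bp j : 0 <= bcoef al j by apply: bcoef_ge0; exact: ltW.
have Xsmall k : (k < m)%N -> X k <= lam * M * gridnorm1 be1 n.
  move=> km; apply: gridnorm_small => //; first by rewrite mulr_ge0// ltW.
  move=> i /gi hx; rewrite normrM (gtr0_norm ck0) /lam -mulrA ler_wpM2l ?(ltW ck0)//.
  have kp : (k <= p)%N by rewrite /p (leq_trans (ltnW km))// leq_pmull.
  apply: (@le_trans _ _ (bcoef (1 + al) k * M)).
    rewrite -sum_bcoef mulr_suml; apply: (le_trans (ler_norm_sum _ _ _)); apply: ler_sum => j _.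
    rewrite normrM (ger0_norm (bp _)) ler_wpM2l// GM// add0r tk//.
    by rewrite (leq_trans (leq_subr _ _)).
  rewrite ler_wpM2r// bcoef_ndecreasing//; first by rewrite lerDl ltW.
  by rewrite -ltnS prednK.
(* The four errors [lam * e] are: [W] to [w], the accretivity estimate, [w] back to [W], and the
   oscillation of [G] over a window. *)
have Xrec k : (m <= k <= p)%N -> X k <= convn (window al m) (fun j => X j) k + 4 * e * ck * gridnorm1 be1 n * S.
  move=> /andP[mk kp].
  have s1 : X k <= gridnorm be1 n (fun i => w (grid a b n i) (tau * k%:R)) + lam * e * gridnorm1 be1 n.
    apply: gridnorm_near => // [|i /gi hx]; first exact: ltW.
    by rewrite (le_trans (hW _ _ hx kp))// ler_wpM2r// ltW.
  have s2 := hn0 k kp mk n1.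
  have s3 : gridnorm be1 n (fun i => w (grid a b n i) (tau * k%:R) - lam * G (grid a b n i) (tau * k%:R)) <=
      gridnorm be1 n (fun i => \sum_(j < k.+1) window al m j * W (k - j)%N (grid a b n i)) +
        (lam * e + lam * e) * gridnorm1 be1 n.
    apply: gridnorm_near => // [|i /gi hx]; first by rewrite addr_ge0// ltW.
    set x := grid a b n i in hx *.
    have -> : \sum_(j < k.+1) window al m j * W (k - j)%N x = ck * convn (window al m) (convn (bcoef al) (Y x)) k.
      by rewrite /convn mulr_sumr; apply: eq_bigr => j _; rewrite mulrCA.
    have om j : (j < m)%N -> `|Y x (k - j)%N - Y x k| <= e.
      move=> jm; apply: hH2 => //; rewrite ?add0r ?tk ?(leq_trans (leq_subr _ _))//.
      rewrite natrB ?(leq_trans (ltnW jm))// (_ : _ - _ = - (tau * j%:R)); last by ring.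
      rewrite normrN ger0_norm ?mulr_ge0 ?(ltW tau0)//; apply: le_trans HH2.
      by rewrite -taum ler_pM2l// ler_nat ltnW.
    have tn := convn_trunc_near al01 m0 mk om.
    rewrite (_ : _ - _ = (w x (tau * k%:R) - W k x) +
      ck * (convn (bcoef al) (Y x) k - convn (window al m) (convn (bcoef al) (Y x)) k - S * Y x k)); last first.
      by rewrite /W /lam /Y add0r; ring.
    apply: (le_trans (ler_normD _ _)); apply: lerD.
      by rewrite distrC (le_trans (hW _ _ hx kp))// ler_wpM2r// ltW.
    by rewrite normrM (gtr0_norm ck0) /lam -mulrA ler_wpM2l// ltW.
  have s4 : gridnorm be1 n (fun i => \sum_(j < k.+1) window al m j * W (k - j)%N (grid a b n i)) <=
      convn (window al m) (fun j => X j) k.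
    by apply: (@gridnorm_sum _ be1 n be101 k.+1 (window al m) (fun j i => W (k - j)%N (grid a b n i))) => j;
      exact: window_ge0.
  apply: (le_trans s1); apply: (le_trans (lerD s2 (lexx _))).
  apply: (le_trans (lerD (lerD s3 (lexx _)) (lexx _))).
  apply: (le_trans (lerD (lerD (lerD s4 (lexx _)) (lexx _)) (lexx _))).
  by rewrite le_eqVlt; apply/orP; left; apply/eqP; rewrite /lam; ring.
have C00 : 0 <= lam * M * gridnorm1 be1 n := mulr_ge0 (mulr_ge0 (ltW lamp) M0) N1.
have C10 : 0 <= 4 * e * ck * gridnorm1 be1 n :=
  mulr_ge0 (mulr_ge0 (mulr_ge0 (ler0n R 4) (ltW e0)) (ltW ck0)) N1.
have Xp := window_comparison al01 m0 C00 C10 Xsmall Xrec (leqnn p).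
have fin : gridnorm be1 n (fun i => w (grid a b n i) t0) <= X p + lam * e * gridnorm1 be1 n.
  apply: gridnorm_near => // [|i /gi hx]; first exact: ltW.
  by rewrite -taup distrC (le_trans (hW _ _ hx (leqnn p)))// ler_wpM2r// ltW.
apply: (le_trans fin); apply: (le_trans (lerD Xp (lexx _))).
have cP : ck * bcoef (1 + al) p <= E0.
  have /andP[_ s1] := sand p.
  rewrite /ck (_ : _ * bcoef _ _ = kt * (tau `^ al * (q * bcoef (1 + al) p))); last by ring.
  rewrite ler_wpM2l ?(ltW kt0)//; apply: (le_trans (ler_wpM2l (ltW ta0) s1)).
  rewrite mulrA -powRM ?(ltW tau0)// ler_wpM2r ?invr_ge0 ?(ltW al0)//.
  apply: ge0_ler_powR; rewrite ?nnegrE ?mulr_ge0 ?(ltW al0) ?(ltW tau0) ?(ltW T0)//.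
  rewrite -natr1 mulrDr mulr1 taup mulrDl mul1r; apply: lerD => //.
  apply: le_trans t0T; rewrite -taup ler_peMr ?(ltW tau0)// ler1n /p muln_gt0 Q0//.
rewrite (_ : _ + _ + _ = (lam * (M + e) + 4 * e * (ck * bcoef (1 + al) p)) * gridnorm1 be1 n); last by ring.
rewrite ler_wpM2r// [leRHS]splitr; apply: lerD => //.
apply: (@le_trans _ _ (4 * e * (E0 + 1))).
  apply: ler_wpM2l; first exact: mulr_ge0 (ler0n R 4) (ltW e0).
  by apply: (le_trans cP); rewrite lerDl.
rewrite /e le_eqVlt; apply/orP; left; apply/eqP; field.
by rewrite gt_eqF// ltr_wpDl.
Qed.

End time.

(** * Differences of solutions *)

Section solutions.
Context {R : realType}.
Implicit Types (a b T x t : R) (h : R -> R -> R).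

Lemma rectE a b T : rect a b T = `[a, b] `*` `[0, T].
Proof. by apply/seteqP; split => -[x t]; rewrite /rect/= !in_itv/=. Qed.

Lemma rect_compact a b T : compact (rect a b T).
Proof. by rewrite rectE; apply: compact_setX; exact: segment_compact. Qed.

Lemma rect_slice_space a b T t h : 0 <= t <= T ->
  {within rect a b T, continuous (fun p : R * R => h p.1 p.2)} ->
  {within `[a, b], continuous (h^~ t)}.
Proof.
move=> ht /within_continuousP ch; apply/within_continuousP => x /=.
rewrite in_itv/= => hx eps e0.
have [d d0 hd] := ch (x, t) (conj hx ht) eps e0; exists d => // y.
rewrite /= in_itv/= => hy xy; apply: (hd (y, t)) => //; split => //=.
exact: ballxx.
Qed.

Lemma rect_slice_time a b T x h : a <= x <= b ->
  {within rect a b T, continuous (fun p : R * R => h p.1 p.2)} ->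
  {within `[0, T], continuous (h x)}.
Proof.
move=> hx /within_continuousP ch; apply/within_continuousP => t /=.
rewrite in_itv/= => ht eps e0.
have [d d0 hd] := ch (x, t) (conj hx ht) eps e0; exists d => // y.
rewrite /= in_itv/= => hy xy; apply: (hd (x, y)) => //; split => //=.
exact: ballxx.
Qed.

(* The inner derivative [v] is not assumed continuous: it is first identified
   almost everywhere with its continuous representative, then everywhere,
   because it is itself a derivative. *)
Lemma sequential_caputo_inv (be1 be2 a b : R) (u v g : R -> R) :
  0 < be1 <= 1 -> 0 < be2 <= 1 -> a < b -> {within `[a, b], continuous u} ->
  (forall x, a <= x <= b -> is_caputo be2 a b u x (v x)) ->
  (forall x, a <= x <= b -> is_caputo be1 a b v x (g x)) ->
  {within `[a, b], continuous g} ->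
  exists V, forall x, a <= x <= b ->
    u x = u a + caputo_cst be2 * fracint be2 a (fun y => V + caputo_cst be1 * fracint be1 a g y) x.
Proof.
move=> be101 be201 ab cu huv hvg cg; exists (v a).
have contv0 := @caputo_inv_fracint_continuous R be1 a b v g be101 cg.
have ae := caputo_inv_ae be101 ab hvg cg.
have [vE _] := caputo_primitive ab huv contv0 ae.
apply: (caputo_inv be201 ab _ contv0 cu) => x hx.
by rewrite -vE//; exact: huv.
Qed.

End solutions.

Theorem theorem4p7 (R : realType) (a b T alpha beta1 beta2 nu : R)
    (phi : R -> R) (F : R -> R -> R -> R) :
  a < b -> 0 < T ->
  0 < alpha <= 1 ->
  0 < beta1 <= 1 -> 0 < beta2 <= 1 -> 1 < beta1 + beta2 <= 2 ->
  0 < nu ->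
  {within `[a, b], continuous phi} ->
  {within [set p : R * R * R | a <= p.1.1 <= b /\ 0 <= p.1.2 <= T],
     continuous (fun p : R * R * R => F p.1.1 p.1.2 p.2)} ->
  (forall x t w1 w2, a <= x <= b -> 0 <= t <= T -> w1 <= w2 ->
     F x t w2 <= F x t w1) ->
  forall u1 u2 : R -> R -> R,
    is_solution a b T alpha beta1 beta2 nu phi F u1 ->
    is_solution a b T alpha beta1 beta2 nu phi F u2 ->
    forall x t, a <= x <= b -> 0 <= t <= T -> u1 x t = u2 x t.
Proof.
move=> ab T0 al01 be101 be201 g12 nu0 _ cF monF u1 u2.
move=> [cu1 [Dt1 [Dx1 [Dxx1 [ht1 [cDt1 [hx1 [hxx1 [cDxx1 [eq1 [i1 bd1]]]]]]]]]]].
move=> [cu2 [Dt2 [Dx2 [Dxx2 [ht2 [cDt2 [hx2 [hxx2 [cDxx2 [eq2 [i2 bd2]]]]]]]]]]].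
have rectP x t : a <= x <= b -> 0 <= t <= T -> rect a b T (x, t) by [].
pose w x t := u1 x t - u2 x t.
pose G x t := Dt1 x t - Dt2 x t.
pose g x t := Dxx1 x t - Dxx2 x t.
pose Ph x t := F x t (u1 x t) - F x t (u2 x t).
have cB (h1 h2 : R -> R -> R) :
    {within rect a b T, continuous (fun p : R * R => h1 p.1 p.2)} ->
    {within rect a b T, continuous (fun p : R * R => h2 p.1 p.2)} ->
    {within rect a b T, continuous (fun p : R * R => h1 p.1 p.2 - h2 p.1 p.2)}.
  by move=> c1 c2 p; apply: cvgB; [exact: c1|exact: c2].
have cw : {within rect a b T, continuous (fun p : R * R => w p.1 p.2)} := cB _ _ cu1 cu2.
have cG : {within rect a b T, continuous (fun p : R * R => G p.1 p.2)} := cB _ _ cDt1 cDt2.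
have cg : {within rect a b T, continuous (fun p : R * R => g p.1 p.2)} := cB _ _ cDxx1 cDxx2.
have [al0 _] := andP al01; have [be10 _] := andP be101; have [be20 _] := andP be201.
have hwt x t : a <= x <= b -> 0 <= t <= T -> w x t = caputo_cst alpha * fracint alpha 0 (G x) t.
  move=> hx ht; have tT : t <= T by case/andP: ht.
  have e1 := caputo_inv al01 T0 (fun s hs => ht1 x s (rectP x s hx hs))
    (rect_slice_time hx cDt1) (rect_slice_time hx cu1) ht.
  have e2 := caputo_inv al01 T0 (fun s hs => ht2 x s (rectP x s hx hs))
    (rect_slice_time hx cDt2) (rect_slice_time hx cu2) ht.
  rewrite /w e1 e2 i1// i2//.
  rewrite (_ : G x = fun s => Dt1 x s - 1 * Dt2 x s); last first.
    by apply/funext => s; rewrite mul1r.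
  rewrite fracint_sub; first ring.
    exact: integrable_pker_mul (rect_slice_time hx cDt1) tT.
  exact: integrable_pker_mul (rect_slice_time hx cDt2) tT.
have hwx t : 0 <= t <= T -> exists V, forall x, a <= x <= b ->
    w x t = caputo_cst beta2 * fracint beta2 a (fun y => V + caputo_cst beta1 * fracint beta1 a (g^~ t) y) x.
  move=> ht.
  have cg1 := rect_slice_space ht cDxx1; have cg2 := rect_slice_space ht cDxx2.
  have [V1 e1] := sequential_caputo_inv be101 be201 ab (rect_slice_space ht cu1)
    (fun x hx => hx1 x t (rectP x t hx ht)) (fun x hx => hxx1 x t (rectP x t hx ht)) cg1.
  have [V2 e2] := sequential_caputo_inv be101 be201 ab (rect_slice_space ht cu2)
    (fun x hx => hx2 x t (rectP x t hx ht)) (fun x hx => hxx2 x t (rectP x t hx ht)) cg2.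
  (* Since both solutions vanish at [a], the constants [u a] drop out and only the constants of the
     inner integration remain. *)
  exists (V1 - V2) => x hx; have xb : x <= b by case/andP: hx.
  rewrite /w e1// e2// (bd1 t ht).1 (bd2 t ht).1.
  have c1 := @caputo_inv_fracint_continuous R beta1 a b (fun=> V1) _ be101 cg1.
  have c2 := @caputo_inv_fracint_continuous R beta1 a b (fun=> V2) _ be101 cg2.
  rewrite !add0r -mulrBr; congr (caputo_cst beta2 * _).
  have := fracint_sub 1 (integrable_pker_mul be20 c1 xb) (integrable_pker_mul be20 c2 xb).
  rewrite mul1r => <-; apply: eq_Rintegral => y.
  rewrite inE/= in_itv/= => /andP[ay yx]; congr (_ * _).
  rewrite (_ : g^~ t = fun s => Dxx1 s t - 1 * Dxx2 s t); last first.
    by apply/funext => s; rewrite mul1r.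
  have yb := le_trans yx xb.
  rewrite fracint_sub; [ring|exact: integrable_pker_mul cg1 yb|exact: integrable_pker_mul cg2 yb].
have hwb t : 0 <= t <= T -> w b t = 0.
  by move=> ht; rewrite /w (bd1 t ht).2 (bd2 t ht).2 subrr.
have io x : a < x < b -> a <= x <= b by move=> /andP[? ?]; rewrite !ltW.
have io' t : 0 < t <= T -> 0 <= t <= T by move=> /andP[? ->]; rewrite ltW.
have [M M0 hM] := compact_within_bounded (@rect_compact R a b T) cG.
have GM x t : a <= x <= b -> 0 <= t <= T -> `|G x t| <= M by move=> hx ht; exact: (hM (x, t)).
have Gu eps : 0 < eps -> exists2 h0, 0 < h0 & forall x t t', a <= x <= b ->
    0 <= t <= T -> 0 <= t' <= T -> `|t - t'| <= h0 -> `|G x t - G x t'| <= eps.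
  move=> e0; have [d d0 hd] := compact_within_uniform (@rect_compact R a b T) cG e0.
  exists (d / 2) => [|x t t' hx ht ht' tt]; first by rewrite divr_gt0.
  apply: (hd (x, t) (x, t')) => //; split => /=; first exact: ballxx.
  by rewrite /ball/= (le_lt_trans tt)// ltr_pdivrMr// ltr_pMr// ltr1n.
have hG x t : a < x < b -> 0 < t <= T -> G x t = nu * g x t + Ph x t.
  by move=> hx ht; rewrite /G /g /Ph eq1// eq2//; ring.
have hPw x t : a < x < b -> 0 < t <= T -> Ph x t * w x t <= 0.
  move=> /io hx /io' ht; have [le|/ltW le] := leP (u1 x t) (u2 x t).
    by rewrite mulr_ge0_le0// ?subr_ge0 ?subr_le0//; exact: monF.
  by rewrite mulr_le0_ge0// ?subr_ge0 ?subr_le0//; exact: monF.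
have hPs t : 0 < t <= T -> forall eps, 0 < eps -> exists2 eta, 0 < eta &
    forall x, a < x < b -> `|w x t| <= eta -> `|Ph x t| <= eps.
  move=> /io' ht eps e0.
  have [M1 M10 hM1] := compact_within_bounded (@rect_compact R a b T) cu1.
  have [M2 M20 hM2] := compact_within_bounded (@rect_compact R a b T) cu2.
  (* Both solutions are bounded, so their graphs lie in a compact box on which [F] is uniformly
     continuous. *)
  pose A := rect a b T `*` `[- (M1 + M2), M1 + M2]%classic.
  have cA : compact A by apply: compact_setX; [exact: rect_compact|exact: segment_compact].
  have cFA : {within A, continuous (fun p : R * R * R => F p.1.1 p.1.2 p.2)}.
    by apply: continuous_subspaceW cF => -[[x s] u] [].
  have [d d0 hd] := compact_within_uniform cA cFA e0.
  exists (d / 2); first by rewrite divr_gt0.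
  move=> x /io hx wd.
  have m1 := hM1 (x, t) (rectP _ _ hx ht); have m2 := hM2 (x, t) (rectP _ _ hx ht).
  apply: (hd ((x, t), u1 x t) ((x, t), u2 x t)).
  - split => //=; rewrite in_itv/= -ler_norml (le_trans m1)// lerDl//.
  - split => //=; rewrite in_itv/= -ler_norml (le_trans m2)// lerDr//.
  split; first exact: ballxx.
  by rewrite /ball/= (le_lt_trans wd)// ltr_pdivrMr// ltr_pMr// ltr1n.
move=> x t hx /andP[t0 tT].
(* The norm argument covers [t > 0] and [x < b]; the remaining points come from the initial and
   boundary data. *)
move: t0; rewrite le_eqVlt => /predU1P[<-|t0]; first by rewrite i1// i2.
have ht : 0 < t <= T by rewrite t0.
apply: subr0_eq; rewrite -/(w x t).
have /andP[ax xb] := hx; move: xb; rewrite le_eqVlt => /predU1P[->|xb].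
  exact/hwb/io'.
apply: (gridnorm_vanish be101 ab (rect_slice_space (io' _ ht) cw)); last by rewrite ax.
exact: (time_step al01 be101 be201 g12 ab T0 nu0 (caputo_cst_gt0 al01) (caputo_cst_gt0 be101)
  (caputo_cst_gt0 be201) hwt hwx hwb (fun t ht => rect_slice_space ht cg)
  (fun x hx => rect_slice_time hx cG) GM Gu hG hPw hPs ht).
Qed.
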